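(* Let $N\ge 2$, let $\Omega\subset\mathbb{R}^N$ be a bounded and smooth domain, and let $p>N$. Consider the inequality $$N(\omega_N)^{\frac pN}\left(\frac{p-N}{p-1}\right)^{p-1}|\Omega|^{1-\frac pN}\|u\|_\infty^p\le\|\nabla u\|_p^p,$$ which is valid for all $u\in W_0^{1,p}(\Omega)$. Equality in this inequality occurs for some $u\in W_0^{1,p}(\Omega)$ with $u\not\equiv0$ if, and only if, $\Omega$ is a ball.
   Context: $|\Omega|$ is the Lebesgue measure of $\Omega$, $\omega_N=\pi^{N/2}/\Gamma(\frac N2+1)$ is the volume of the unit ball of $\mathbb{R}^N$, and $\|\cdot\|_s$ denotes the standard norm of $L^s(\Omega)$. A domain is a nonempty connected open set. *)

(* Defs.v *)
From HB Require Import structures.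
From mathcomp Require Import all_boot all_order all_algebra.
From mathcomp Require Import all_classical all_reals all_analysis.
Set Implicit Arguments.
Unset Strict Implicit.
Unset Printing Implicit Defensive.
Import Order.TTheory GRing.Theory Num.Theory.
Import numFieldNormedType.Exports.
Local Open Scope classical_set_scope.
Local Open Scope ring_scope.

(* R^n is 'rV[R]_n.  Its library topology comes from the sup norm, so it is
   the usual one.  As for tuples in the library, the sigma-algebra is the one
   generated by the coordinates, i.e. the Borel sigma-algebra of R^n. *)
Section measurable_rV.
Context {R : realType} {n : nat}.

Definition rV_coord (i : 'I_n) (x : 'rV[R]_n) : measurableTypeR R := x 0 i.

Let rV_set0 : g_sigma_preimage rV_coord set0.
Proof. exact: sigma_algebra0. Qed.

Let rV_setC A : g_sigma_preimage rV_coord A -> g_sigma_preimage rV_coord (~` A).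
Proof. exact: sigma_algebraC. Qed.

Let rV_bigcup (F : (set 'rV[R]_n)^nat) :
  (forall i, g_sigma_preimage rV_coord (F i)) ->
  g_sigma_preimage rV_coord (\bigcup_i F i).
Proof. exact: sigma_algebra_bigcup. Qed.

HB.instance Definition _ := @isMeasurable.Build default_measure_display
  'rV[R]_n (g_sigma_preimage rV_coord) rV_set0 rV_setC rV_bigcup.

Lemma measurable_rV_coord (i : 'I_n) :
  measurable_fun [set: 'rV[R]_n] (rV_coord i).
Proof.
move=> _ A mA; rewrite setTI; apply: sub_sigma_algebra.
rewrite -bigcup_seq /=; exists i => /=; first by rewrite mem_index_enum.
by exists A => //; rewrite setTI.
Qed.

Lemma measurable_fun_rV d (T : measurableType d) (f : T -> 'rV[R]_n) :
  (forall i, measurable_fun [set: T] (rV_coord i \o f)) ->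
  measurable_fun [set: T] f.
Proof.
move=> mf; apply: (@measurability _ _ _ _ _ _
  (\big[setU/set0]_(i < n) preimage_set_system setT (rV_coord i) measurable)).
  by [].
move=> _ [C + <-]; rewrite -bigcup_seq => -[i _ [A mA <-]].
by have /(_ measurableT _ mA) := mf i; rewrite !setTI.
Qed.

End measurable_rV.

(* Lebesgue measure on R^n: R^0 is a single point, of measure 1, and R^n.+1 is
   identified with R * R^n through consrV. *)
Section lebesgue_rV.
Context {R : realType}.

Definition consrV n (xv : measurableTypeR R * 'rV[R]_n) : 'rV[R]_n.+1 :=
  row_mx (const_mx xv.1 : 'rV[R]_1) xv.2.

Lemma measurable_consrV n : measurable_fun [set: _] (@consrV n).
Proof.
apply: measurable_fun_rV => i.
case: (@split_ordP 1 n i) => j ->.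
- rewrite (_ : _ \o _ = fst) //; apply/funext => xv.
  by rewrite /= /rV_coord /consrV (@row_mxEl _ 1 1 n) mxE.
- rewrite (_ : _ \o _ = rV_coord j \o snd).
    exact: measurableT_comp (measurable_rV_coord j) measurable_snd.
  by apply/funext => xv; rewrite /= /rV_coord /consrV (@row_mxEr _ 1 1 n).
Qed.

Section step.
Context {n : nat} (mu : {sigma_finite_measure set 'rV[R]_n -> \bar R}).

Definition lebesgue_step : set 'rV[R]_n.+1 -> \bar R :=
  pushforward (@lebesgue_measure R \x mu)%E (@consrV n).

Let prod_measure : {measure set (measurableTypeR R * 'rV[R]_n) -> \bar R} :=
  (@lebesgue_measure R \x mu)%E.

Let mpre A : measurable A -> measurable (@consrV n @^-1` A).
Proof. by move=> mA; rewrite -[X in measurable X]setTI; exact: measurable_consrV. Qed.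

Let step0 : lebesgue_step set0 = 0%E.
Proof. by rewrite /lebesgue_step /pushforward preimage_set0 measure0. Qed.

Let step_ge0 A : (0 <= lebesgue_step A)%E.
Proof. exact: (@measure_ge0 _ _ _ prod_measure). Qed.

Let step_sigma_additive : semi_sigma_additive lebesgue_step.
Proof.
move=> F mF tF mUF; rewrite /lebesgue_step /pushforward preimage_bigcup.
apply: (@measure_semi_sigma_additive _ _ _ prod_measure).
- by move=> k; exact: mpre.
- apply/trivIsetP => /= i j _ _ ij; rewrite -preimage_setI.
  by move/trivIsetP : tF => /(_ _ _ _ _ ij) ->//; rewrite preimage_set0.
- by rewrite -preimage_bigcup; exact: mpre.
Qed.

HB.instance Definition _ := isMeasure.Build _ _ _ lebesgue_step
  step0 step_ge0 step_sigma_additive.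

Let step_sigma_finite : sigma_finite [set: 'rV[R]_n.+1] lebesgue_step.
Proof.
have /sigma_finiteP[F [TF ndF Foo]] := sigma_finiteT (@lebesgue_measure R).
have /sigma_finiteP[G [TG ndG Goo]] := sigma_finiteT mu.
pose g (y : 'rV[R]_n.+1) : measurableTypeR R * 'rV[R]_n :=
  (rV_coord ord0 y, \row_i rV_coord (lift ord0 i) y).
have gK : cancel (@consrV n) g.
  move=> [x v]; rewrite /g /consrV /rV_coord; congr pair => /=.
    rewrite (_ : ord0 = @lshift 1 n ord0); last exact/val_inj.
    by rewrite (@row_mxEl _ 1 1 n) mxE.
  apply/rowP => i; rewrite mxE (_ : lift ord0 i = @rshift 1 n i).
    by rewrite (@row_mxEr _ 1 1 n).
  exact/val_inj.
have mg : measurable_fun setT g.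
  apply: measurable_fun_pair; first exact: measurable_rV_coord.
  apply: measurable_fun_rV => i.
  rewrite (_ : _ \o _ = rV_coord (lift ord0 i)); first exact: measurable_rV_coord.
  by apply/funext => y; rewrite /= {1}/rV_coord mxE.
exists (fun k => g @^-1` (F k `*` G k)).
  rewrite -preimage_bigcup; apply/esym; rewrite -subTset => y _ /=.
  have : [set: measurableTypeR R] (g y).1 by [].
  have : [set: 'rV[R]_n] (g y).2 by [].
  rewrite {1}TF {1}TG => -[j _ Gj] [i _ Fi]; exists (maxn i j) => //; split.
  - by move: Fi; exact/subsetPset/ndF/leq_maxl.
  - by move: Gj; exact/subsetPset/ndG/leq_maxr.
move=> k; have [mFk Fk] := Foo k; have [mGk Gk] := Goo k; split.
  by rewrite -[X in measurable X]setTI; apply: mg => //; exact: measurableX.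
rewrite /lebesgue_step /pushforward -comp_preimage (_ : g \o _ = id).
  by rewrite product_measure1E// lte_mul_pinfty// ge0_fin_numE.
exact/funext.
Qed.

HB.instance Definition _ := Measure_isSigmaFinite.Build _ _ _ lebesgue_step
  step_sigma_finite.

End step.

Fixpoint lebesgue_rV n : {sigma_finite_measure set 'rV[R]_n -> \bar R} :=
  match n with
  | 0 => \d_(0 : 'rV[R]_0)
  | m.+1 => lebesgue_step (lebesgue_rV m)
  end.

Lemma lebesgue_rV_box n (A : 'I_n -> set (measurableTypeR R)) :
  (forall i, measurable (A i)) ->
  lebesgue_rV n [set x : 'rV[R]_n | forall i, A i (x ord0 i)] =
  (\prod_(i < n) @lebesgue_measure R (A i))%E.
Proof.
elim: n A => [|n ih] A mA.
  by rewrite big_ord0 /= diracE mem_set //= => -[].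
rewrite big_ord_recl/= -ih => [|i]; last exact: mA.
rewrite /lebesgue_step /pushforward.
rewrite -product_measure1E//; last first.
  rewrite (_ : mkset _ = \big[setI/setT]_(i < n) (rV_coord i @^-1` A (lift ord0 i))).
    apply: bigsetI_measurable => i _; rewrite -[X in measurable X]setTI.
    by apply: measurable_rV_coord => //; exact: mA.
  by rewrite -bigcap_seq; apply/seteqP; split => x /= h i => [_|]; apply: h; rewrite //= mem_index_enum.
congr (_ _); apply/seteqP; split => -[x v] /=; rewrite /consrV.
  move=> h; split => [|i].
    have := h ord0; rewrite (_ : ord0 = @lshift 1 n ord0); last exact/val_inj.
    by rewrite (@row_mxEl _ 1 1 n) mxE.
  have := h (lift ord0 i); rewrite {2}(_ : lift ord0 i = @rshift 1 n i); last exact/val_inj.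
  by rewrite (@row_mxEr _ 1 1 n).
move=> [h1 h2] i; case: (@split_ordP 1 n i) => j ->.
  rewrite (@row_mxEl _ 1 1 n) mxE /=.
  by rewrite (_ : lshift n j = ord0) //; apply/val_inj; rewrite ord1.
rewrite (@row_mxEr _ 1 1 n) (_ : rshift 1 j = lift ord0 j) //; exact/val_inj.
Qed.

End lebesgue_rV.

Section euclidean.
Context {R : realType} {n : nat}.
Implicit Types (x c : 'rV[R]_n) (Omega : set 'rV[R]_n).

Definition enorm x : R := Num.sqrt (\sum_i x 0 i ^+ 2).

Definition eball c (r : R) : set 'rV[R]_n := [set x | enorm (x - c) < r].

Definition is_eball Omega := exists c (r : R), 0 < r /\ Omega = eball c r.

End euclidean.

Section smooth.
Context {R : realType}.

Definition partial n (i : 'I_n) (f : 'rV[R]_n -> R) : 'rV[R]_n -> R :=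
  'D_(delta_mx 0 i : 'rV[R]_n) f.

Definition gradient n (f : 'rV[R]_n -> R) (x : 'rV[R]_n) : 'rV[R]_n :=
  \row_i partial i f x.

Fixpoint Ck n (k : nat) (f : 'rV[R]_n -> R) : Prop :=
  continuous f /\
  if k is k'.+1 then
    forall i : 'I_n,
      (forall x, derivable f x (delta_mx 0 i)) /\ Ck k' (partial i f)
  else True.

Definition smooth n (f : 'rV[R]_n -> R) := forall k, Ck k f.

(* Near each of its boundary points, Omega is the region strictly on one side
   of the graph of a C^oo function expressing one of the coordinates in terms
   of the n - 1 others. *)
Definition smooth_boundary n (Omega : set 'rV[R]_n) :=
  forall x, (closure Omega `\` interior Omega) x ->
  exists (r : R) (i : 'I_n) (s : bool) (gamma : 'rV[R]_n.-1 -> R),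
    [/\ 0 < r, smooth gamma &
      Omega `&` eball x r =
        [set y | gamma (col' i y) < (-1) ^+ s * y 0 i] `&` eball x r].

Definition domain n (Omega : set 'rV[R]_n) :=
  [/\ Omega !=set0, open Omega & connected Omega].

End smooth.

(* Functions on Omega are represented by functions on R^n whose values outside
   Omega are irrelevant. *)
Section sobolev.
Context {R : realType} {n : nat}.
Variable Omega : set 'rV[R]_n.
Implicit Types (u phi : 'rV[R]_n -> R) (g : 'rV[R]_n -> 'rV[R]_n) (p : R).
Local Notation mu := (@lebesgue_rV R n).

Definition Lp p u := u \_ Omega \in Lfun mu p%:E.

Definition Lp_norm (s : \bar R) u : \bar R := ('N[mu]_s[EFin \o (u \_ Omega)])%E.

Definition L1loc u :=
  forall K, compact K -> K `<=` Omega -> mu.-integrable K (EFin \o u).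

Definition test_function phi :=
  [/\ smooth phi, compact (closure [set x | phi x != 0]) &
    closure [set x | phi x != 0] `<=` Omega].

Definition weak_partial (i : 'I_n) u v :=
  [/\ L1loc u, L1loc v & forall phi, test_function phi ->
    \int[mu]_(x in Omega) (u x * partial i phi x) =
    - \int[mu]_(x in Omega) (v x * phi x)].

(* u belongs to W^{1,p}(Omega) and g is its weak gradient (which is unique up
   to a null set). *)
Definition W1p p u g :=
  Lp p u /\ forall i, Lp p (fun x => g x 0 i) /\
                      weak_partial i u (fun x => g x 0 i).

(* W_0^{1,p}(Omega), the closure of the test functions in W^{1,p}(Omega), again
   with g the weak gradient of u. *)
Definition W01p p u g :=
  W1p p u g /\ exists phi : nat -> 'rV[R]_n -> R,
    [/\ forall k, test_function (phi k),
      Lp_norm p%:E (fun x => u x - phi k x) @[k --> \oo] --> 0%E &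
      Lp_norm p%:E (fun x => enorm (g x - gradient (phi k) x)) @[k --> \oo]
        --> 0%E].

End sobolev.

Section constants.
Context {R : realType}.

Definition Gamma (x : R) : R :=
  \int[lebesgue_measure]_(t in `]0%R, +oo[) (t `^ (x - 1) * expR (- t)).

Definition omega (N : nat) : R :=
  pi `^ (N%:R / 2) / Gamma (N%:R / 2 + 1).

End constants.

(* Main.v *)
(* With V = |B_1|, integrating grad phi along the rays issued from x gives
     n V |phi x| <= \int |grad phi y| |y - x|^(1 - n) dy
   for compactly supported C^1 functions phi.  Hoelder's inequality bounds the right
   side by |grad phi|_p times the norm of the kernel |y - x|^(1 - n) in the conjugate
   exponent on Omega, and by the bathtub principle that norm is at most its value when
   Omega is replaced by the ball centred at x of the same volume, with equality only if
   the ball is contained in Omega up to a null set.  The value for the ball is exactly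
   the sharp constant.  Elements of W_0^{1,p} are uniform limits of test functions,
   hence continuous and vanishing off Omega, so |u| attains its maximum at some x and
   the bound at x is the inequality; equality makes Omega agree with the ball centred
   at x up to a null set, and then exactly, the boundary being smooth.  Conversely
   rho^a - |x - c|^a with a = (p - n) / (p - 1) is extremal on the ball. *)

Require Import Defs.
From mathcomp Require Import all_boot all_order all_algebra.
From mathcomp Require Import all_classical all_reals all_analysis.
From mathcomp Require Import measurable_realfun.
From mathcomp Require Import ring lra.
Import Order.TTheory GRing.Theory Num.Theory.
Import numFieldNormedType.Exports.
Set Implicit Arguments.
Unset Strict Implicit.
Unset Printing Implicit Defensive.
Local Open Scope classical_set_scope.
Local Open Scope ring_scope.

(** * The Euclidean norm on R^n *)

(** Let q = p / (p - 1). The pointwise bound involves the potential at x, the integral over Omega of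
    |y - x|^(-(n-1)q), and this dependence on x has to survive the passage from test functions to
    W_0^{1,p}: only its value at a maximum point of |u| carries information on the shape of Omega.
    It is finite because p > n makes a = n - (n-1)q positive. At the centre of a ball of radius r it
    equals J = n V r^a / a, so the best constant is (n V)^p / J^(p-1); when r^n V = |Omega|, the
    powers of r turn into |Omega|^(1 - p/n). The exponent of the extremal function is dictated by
    equality in Hoelder: |grad u|^p must be a multiple of the q-th power of the kernel. For the
    converse the obstacle is membership in W_0^{1,p}: the extremal function is singular at c and is
    not compactly supported in the open ball. Explicit test functions built from t^b exp(-e/t)
    approximate it, and their gradients are dominated pointwise by the length of its gradient, so
    dominated convergence yields the weak gradient and the approximation together. *)

Section euclidean_norm.
Context {R : realType} {n : nat}.
Implicit Types (x y z c : 'rV[R]_n) (r : R).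

Lemma enorm_ge0 x : 0 <= enorm x.
Proof. exact: sqrtr_ge0. Qed.

Lemma enorm_sqr x : enorm x ^+ 2 = \sum_i x 0 i ^+ 2.
Proof. by rewrite sqr_sqrtr// sumr_ge0// => i _; exact: sqr_ge0. Qed.

Lemma enorm0 : enorm (0 : 'rV[R]_n) = 0.
Proof. by rewrite /enorm big1 ?sqrtr0// => i _; rewrite mxE expr0n. Qed.

Lemma enormZ r x : enorm (r *: x) = `|r| * enorm x.
Proof.
rewrite /enorm; under eq_bigr do rewrite mxE exprMn.
by rewrite -mulr_sumr sqrtrM ?sqr_ge0// sqrtr_sqr.
Qed.

Lemma enormN x : enorm (- x) = enorm x.
Proof. by rewrite -scaleN1r enormZ normrN1 mul1r. Qed.

Lemma enorm_distC x y : enorm (x - y) = enorm (y - x).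
Proof. by rewrite -enormN opprB. Qed.

Lemma enorm_eq0 x : (enorm x == 0) = (x == 0).
Proof.
apply/eqP/eqP => [x0|->]; last exact: enorm0.
have : enorm x ^+ 2 = 0 by rewrite x0 expr0n.
rewrite enorm_sqr => /eqP; rewrite psumr_eq0 => [/allP h|i _]; last exact: sqr_ge0.
by apply/rowP => i; have := h i; rewrite mem_index_enum mxE sqrf_eq0 => /(_ isT)/eqP.
Qed.

Lemma enorm_gt0 x : (0 < enorm x) = (x != 0).
Proof. by rewrite lt_def enorm_eq0 enorm_ge0 andbT. Qed.

(** Cauchy-Schwarz: with s the inner product, the sum of the squares (|x|^2 y_i - s x_i)^2 equals
    |x|^2 (|x|^2 |y|^2 - s^2), and it is nonnegative. *)
Lemma ler_sum_enormM x y : `|\sum_i x 0 i * y 0 i| <= enorm x * enorm y.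
Proof.
have [->|x0] := eqVneq x 0.
  by rewrite enorm0 mul0r big1 ?normr0// => i _; rewrite mxE mul0r.
set s := \sum_i _; have a0 : 0 < enorm x by rewrite enorm_gt0.
rewrite -sqrtr_sqr -(ler_pXn2r (n := 2))// ?nnegrE ?sqrtr_ge0 ?mulr_ge0 ?enorm_ge0//.
rewrite sqr_sqrtr ?sqr_ge0// exprMn.
have : 0 <= \sum_i (enorm x ^+ 2 * y 0 i - s * x 0 i) ^+ 2.
  by apply: sumr_ge0 => i _; exact: sqr_ge0.
have -> : \sum_i (enorm x ^+ 2 * y 0 i - s * x 0 i) ^+ 2 =
    enorm x ^+ 2 * (enorm x ^+ 2 * enorm y ^+ 2 - s ^+ 2).
  transitivity (\sum_i (enorm x ^+ 4 * y 0 i ^+ 2 + s ^+ 2 * x 0 i ^+ 2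
      - enorm x ^+ 2 * s *+ 2 * (x 0 i * y 0 i))).
    by apply: eq_bigr => i _; ring.
  rewrite big_split/= big_split/= -!mulr_sumr sumrN -mulr_sumr -!enorm_sqr -/s.
  ring.
by rewrite pmulr_rge0 ?exprn_gt0// subr_ge0.
Qed.

Lemma ler_enormD x y : enorm (x + y) <= enorm x + enorm y.
Proof.
rewrite -(ler_pXn2r (n := 2))// ?nnegrE ?addr_ge0 ?enorm_ge0//.
rewrite enorm_sqr; have := le_trans (ler_norm _) (ler_sum_enormM x y).
under [X in _ -> X <= _]eq_bigr do rewrite mxE sqrrD.
rewrite big_split/= big_split/= -!enorm_sqr => h.
by rewrite sumrMnl sqrrD lerD2r lerD2l lerMn2r h.
Qed.

Lemma ler_enormB x y : enorm x - enorm y <= enorm (x - y).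
Proof. by rewrite lerBlDr (le_trans _ (ler_enormD _ _))// subrK. Qed.

Lemma ler_enormBB x y : `|enorm x - enorm y| <= enorm (x - y).
Proof. by rewrite ler_norml ler_enormB andbT lerNl opprB enorm_distC ler_enormB. Qed.

Lemma coord_le_enorm x i : `|x 0 i| <= enorm x.
Proof.
rewrite -sqrtr_sqr ler_wsqrtr// (bigD1 i)//= lerDl sumr_ge0// => j _.
exact: sqr_ge0.
Qed.

Lemma coord_le_norm x i : `|x 0 i| <= `|x|.
Proof.
rewrite [X in _ <= X]mx_normrE.
exact: (@le_bigmax _ _ _ _ (fun ij : 'I_1 * 'I_n => `|x ij.1 ij.2|) (0, i)).
Qed.

Lemma norm_le_enorm x : `|x| <= enorm x.
Proof.
rewrite [X in X <= _]mx_normrE; apply/bigmax_leP; split => [|[i j] _ /=].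
  exact: enorm_ge0.
by rewrite ord1; exact: coord_le_enorm.
Qed.

Lemma enorm_le_sum x : enorm x <= \sum_i `|x 0 i|.
Proof.
have h (I : Type) (s : seq I) (a : I -> R) :
    Num.sqrt (\sum_(i <- s) a i ^+ 2) <= \sum_(i <- s) `|a i|.
  elim: s => [|i s ih]; first by rewrite !big_nil sqrtr0.
  rewrite !big_cons; apply: le_trans (lerD (lexx _) ih).
  rewrite -(ler_pXn2r (n := 2)) ?nnegrE ?addr_ge0 ?sqrtr_ge0//.
  have s0 : 0 <= \sum_(j <- s) a j ^+ 2 by apply: sumr_ge0 => j _; exact: sqr_ge0.
  rewrite sqr_sqrtr ?addr_ge0 ?sqr_ge0// sqrrD sqr_sqrtr// -normrX ger0_norm ?sqr_ge0//.
  by rewrite -addrA [X in _ <= _ + X]addrC addrA lerDl mulrn_wge0// mulr_ge0// sqrtr_ge0.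
exact: h.
Qed.

Lemma enorm_le_norm x : enorm x <= n%:R * `|x|.
Proof.
rewrite (le_trans (enorm_le_sum x))//.
rewrite (le_trans (ler_sum _ (fun i _ => coord_le_norm x i)))//.
by rewrite sumr_const card_ord mulr_natl.
Qed.

Lemma enorm_sub_continuous c : continuous (fun x => enorm (x - c)).
Proof.
move=> x; apply/(@cvgrPdist_le _ _ _ (nbhs x)) => /= e e0; apply/nbhs_ballP.
(* The Euclidean norm is at most n times the sup norm; the successor avoids a division by zero when
   n = 0. *)
exists (e / n.+1%:R) => /=; first by rewrite divr_gt0.
move=> y; rewrite -ball_normE/= ltr_pdivlMr// => /ltW h.
rewrite (le_trans (ler_enormBB _ _))// opprB addrA subrK.
rewrite (le_trans (enorm_le_norm _))//.
by apply: le_trans h; rewrite mulrC ler_wpM2l// ler_nat.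
Qed.

Lemma enorm_continuous : continuous (enorm : 'rV[R]_n -> R).
Proof.
rewrite (_ : enorm = fun x => enorm (x - 0)); first exact: enorm_sub_continuous.
by apply/funext => x; rewrite subr0.
Qed.

Lemma open_eball c r : open (eball c r).
Proof.
rewrite (_ : eball c r = (fun x => enorm (x - c)) @^-1` [set t | t < r])//.
by apply: open_comp => [x _|]; [exact: enorm_sub_continuous|exact: open_lt].
Qed.

Lemma closed_ecball c r : closed [set x | enorm (x - c) <= r].
Proof.
rewrite (_ : mkset _ = (fun x => enorm (x - c)) @^-1` [set t | t <= r])//.
by apply: closed_comp => [x _|]; [exact: enorm_sub_continuous|exact: closed_le].
Qed.

Lemma bounded_setP_enorm (A : set 'rV[R]_n) c : bounded_set A ->
  exists2 r, 0 < r & A `<=` eball c r.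
Proof.
move=> [M [Mreal MA]]; pose M1 := Num.max (M + 1) 1.
have AM1 : forall x, A x -> `|x| <= M1.
  by move=> x Ax; apply: MA => //; rewrite lt_max ltrDl ltr01.
exists (n%:R * M1 + enorm c + 1) => [|x Ax].
  rewrite ltr_wpDl// addr_ge0 ?enorm_ge0// mulr_ge0//.
  by rewrite le_max ler01 orbT.
rewrite /eball/= (le_lt_trans (ler_enormD _ _))// enormN ltr_pwDr//.
by rewrite lerD2r (le_trans (enorm_le_norm _))// ler_wpM2l// AM1.
Qed.

Lemma eball_bounded c r : bounded_set (eball c r).
Proof.
exists (r + enorm c); split; first exact: num_real.
move=> M rM x /= xr; rewrite (le_trans (norm_le_enorm _))// (le_trans _ (ltW rM))//.
by rewrite -[x](subrK c) (le_trans (ler_enormD _ _))// lerD2r ltW.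
Qed.

Lemma nbhs_eball x (A : set 'rV[R]_n) : nbhs x A ->
  exists2 r, 0 < r & eball x r `<=` A.
Proof.
move=> /nbhs_ballP[e /= e0 eA]; exists e => // y xy; apply: eA.
rewrite -ball_normE/= (le_lt_trans (norm_le_enorm _))//.
by rewrite enorm_distC.
Qed.

Lemma open_eballP (A : set 'rV[R]_n) x : open A -> A x ->
  exists2 r, 0 < r & eball x r `<=` A.
Proof. by move=> oA Ax; apply/nbhs_eball/open_nbhs_nbhs; split. Qed.

Lemma eball_nbhs x r : 0 < r -> nbhs x (eball x r).
Proof.
move=> r0; apply: open_nbhs_nbhs; split; first exact: open_eball.
by rewrite /eball/= subrr enorm0.
Qed.

End euclidean_norm.

(** * Lebesgue measure on R^n *)

Section measurability.
Context {R : realType}.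

Lemma measurable_rV_box n (A : 'I_n -> set (measurableTypeR R)) :
  (forall i, measurable (A i)) ->
  measurable [set x : 'rV[R]_n | forall i, A i (x 0 i)].
Proof.
move=> mA.
rewrite (_ : mkset _ = \big[setI/setT]_(i < n) (rV_coord i @^-1` A i)).
  apply: bigsetI_measurable => i _; rewrite -[X in measurable X]setTI.
  by apply: measurable_rV_coord => //; exact: mA.
rewrite -bigcap_seq; apply/seteqP; split => x /= h i => [_|]; apply: h.
by rewrite /= mem_index_enum.
Qed.

(** The sigma-algebra is generated by the coordinates, so boxes are measurable, and an open set is
    the countable union of the boxes with rational centre and half-side 1/(k+1) that it contains. *)
Lemma open_measurable_rV n (A : set 'rV[R]_n) : open A -> measurable A.
Proof.
move=> oA.
pose B (qk : 'rV[rat]_n * nat) : set 'rV[R]_n :=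
  [set x | forall i, ball (ratr (qk.1 0 i) : R) (qk.2.+1%:R^-1) (x 0 i)].
pose F qk := if `[< B qk `<=` A >] then B qk else set0.
have -> : A = \bigcup_qk F qk.
  apply/seteqP; split => [x Ax|x [qk _]]; last first.
    by rewrite /F; case: ifPn => // /asboolP + xB; exact.
  have : nbhs x A by apply: open_nbhs_nbhs; split.
  move=> /nbhs_ballP[e /= e0 eA].
  have [k ke] : exists k : nat, k.+1%:R^-1 < e / 2 :> R.
    have e20 : 0 < e / 2 by rewrite divr_gt0.
    by have := cvgr_lt _ (@cvg_harmonic R) _ e20; case => N _ /(_ N (leqnn N)); exists N.
  have /choice[q qx] : forall i : 'I_n, exists q : rat,
      ball (ratr q : R) k.+1%:R^-1 (x 0 i).
    move=> i; have [|q] := @rat_in_itvoo R (x 0 i - k.+1%:R^-1) (x 0 i + k.+1%:R^-1).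
      by rewrite ltrBlDr -addrA ltrDl addr_gt0// invr_gt0.
    rewrite in_itv/= => /andP[q1 q2]; exists q; rewrite /ball/= ltr_norml.
    by rewrite ltrBrDr addrC q1 ltrBlDr addrC q2.
  exists (\row_i q i, k) => //; rewrite /F ifT => [|]; last first.
    apply/asboolP => y yB; apply: eA; rewrite -ball_normE/=.
    rewrite [X in X < _]mx_normrE; apply/bigmax_ltP; split => // -[i j] _ /=.
    have := yB j; have := qx j; rewrite /ball/= ord1 !mxE => qxj qyj.
    rewrite distrC -(subrK (ratr (q j)) (y 0 j)) -addrA.
    rewrite (le_lt_trans (ler_normD _ _))// [e]splitr ltrD//.
      by rewrite distrC (lt_trans qyj).
    by rewrite (lt_trans qxj).
  by move=> i; rewrite /= mxE.
apply: countable_bigcupT_measurable; first exact: countableP.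
move=> qk; rewrite /F; case: ifPn => _ //.
apply: (@measurable_rV_box n (fun i => ball (ratr (qk.1 0 i) : R) qk.2.+1%:R^-1)) => i.
exact: measurable_ball.
Qed.

Lemma closed_measurable_rV n (A : set 'rV[R]_n) : closed A -> measurable A.
Proof.
by move=> cA; rewrite -[A]setCK; apply: measurableC; apply: open_measurable_rV; exact: closed_openC.
Qed.

Lemma measurable_eball n (c : 'rV[R]_n) r : measurable (eball c r).
Proof. by apply: open_measurable_rV; exact: open_eball. Qed.

Lemma continuous_measurable_rV n (f : 'rV[R]_n -> R) :
  continuous f -> measurable_fun setT f.
Proof.
move=> /continuousP cf; apply: (measurability _ (RGenOpens.measurableE R)).
move=> _ [_ [a [b ->]] <-].
by rewrite setTI; apply: open_measurable_rV; apply: cf; exact: interval_open.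
Qed.

Lemma measurable_enorm n : measurable_fun setT (enorm : 'rV[R]_n -> R).
Proof. by apply: continuous_measurable_rV; exact: enorm_continuous. Qed.

Lemma measurable_enorm_sub n (c : 'rV[R]_n) :
  measurable_fun setT (fun x : 'rV[R]_n => enorm (x - c)).
Proof. by apply: continuous_measurable_rV; exact: enorm_sub_continuous. Qed.

Lemma measurable_affine n d (T : measurableType d) (t : T -> R)
    (z : T -> 'rV[R]_n) (c : 'rV[R]_n) :
  measurable_fun setT t -> measurable_fun setT z ->
  measurable_fun setT (fun x => t x *: z x + c).
Proof.
move=> mt mz; apply: measurable_fun_rV => i.
rewrite (_ : _ \o _ = fun x => t x * z x 0 i + c 0 i); last first.
  by apply/funext => x; rewrite /= /rV_coord !mxE.
apply: measurable_funD => //; apply: measurable_funM => //.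
exact: (measurableT_comp (measurable_rV_coord i) mz).
Qed.

End measurability.

Section affine_change_of_variables.
Context {R : realType}.
Local Open Scope ereal_scope.
Local Notation leb := (@lebesgue_measure R).

Let affine (r c : R) : measurableTypeR R -> measurableTypeR R :=
  fun x => (r * x + c)%R.

Let measurable_affine1 r c : measurable_fun setT (affine r c).
Proof. by apply: measurable_funD => //; exact: measurable_funM. Qed.

(** The measure A |-> r * leb(preimage of A) agrees with Lebesgue measure on the intervals ]a, b],
    hence everywhere by uniqueness. *)
Lemma lebesgue_measure_affine (r c : R) (A : set R) : (0 < r)%R -> measurable A ->
  leb ((fun x => r * x + c)%R @^-1` A) = r^-1%:E * leb A.
Proof.
move=> r0 mA.
have ri0 : (0 <= r^-1)%R by rewrite invr_ge0 ltW.
pose nu : {measure set (measurableTypeR R) -> \bar R} :=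
  mscale (NngNum (ltW r0)) (pushforward leb (affine r c)).
suff /(_ A mA) -> : forall A, measurable A -> leb A = nu (measurable_affine1 r c) A.
  rewrite /nu /mscale/= muleA -EFinM mulVf ?mul1e//; exact: lt0r_neq0.
apply: lebesgue_measure_unique => _ [[a b] _ <-].
change (leb `]a, b] = r%:E * leb (affine r c @^-1` `]a, b])).
rewrite (_ : affine r c @^-1` _ = `](a - c) / r, (b - c) / r]%classic)%R; last first.
  apply/seteqP; split => x; rewrite /affine/= !in_itv/=.
    by rewrite ltr_pdivrMr// ler_pdivlMr// ltrBlDr lerBrDr mulrC.
  by rewrite ltr_pdivrMr// ler_pdivlMr// ltrBlDr lerBrDr mulrC.
rewrite !lebesgue_measure_itv/= !lte_fin ltr_pM2r ?invr_gt0// ltrD2r.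
case: ifPn => _; last by rewrite mule0.
by rewrite -!EFinD -EFinM; congr EFin; field; exact: lt0r_neq0.
Qed.

Lemma ge0_integral_affine (r c : R) (f : R -> \bar R) : (0 < r)%R ->
  measurable_fun setT f -> (forall x, 0 <= f x) ->
  \int[leb]_x f (r * x + c)%R = r^-1%:E * \int[leb]_x f x.
Proof.
move=> r0 mf f0.
have ri0 : (0 <= r^-1)%R by rewrite invr_ge0 ltW.
transitivity (\int[pushforward leb (affine r c)]_x f x).
  by rewrite ge0_integral_pushforward.
transitivity (\int[mscale (NngNum ri0) leb]_x f x).
  apply: eq_measure_integral => A mA _; rewrite /mscale/=.
  exact: lebesgue_measure_affine.
by rewrite ge0_integral_mscale.
Qed.

Local Notation L := (lebesgue_rV).

Lemma ge0_integral_rVS n (f : 'rV[R]_n.+1 -> \bar R) :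
  measurable_fun setT f -> (forall x, 0 <= f x) ->
  \int[L n.+1]_x f x = \int[leb]_x \int[L n]_v f (consrV (x, v)).
Proof.
move=> mf f0.
transitivity (\int[leb \x (L n)]_xv f (consrV xv)); last first.
  rewrite fubini_tonelli1//=.
  exact: (measurableT_comp mf (@measurable_consrV R n)).
pose pm : {measure set 'rV[R]_n.+1 -> \bar R} :=
  pushforward (leb \x (L n)) (@consrV R n).
transitivity (\int[pm (@measurable_consrV R n)]_x f x).
  by apply: eq_measure_integral => A mA _.
by rewrite /pm ge0_integral_pushforward//; exact: measurable_consrV.
Qed.

(** Induction on the dimension: the map acts separately on the first coordinate and on the rest, and
    each coordinate contributes one factor 1/r. In dimension 0 there is a single point. *)
Lemma ge0_integral_rV_affine n (r : R) (c : 'rV[R]_n) (f : 'rV[R]_n -> \bar R) :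
  (0 < r)%R -> measurable_fun setT f -> (forall x, 0 <= f x) ->
  \int[L n]_x f (r *: x + c)%R = (r ^- n)%:E * \int[L n]_x f x.
Proof.
move=> r0; elim: n c f => [|n ih] c f mf f0.
  rewrite expr0 invr1 mul1e; apply: eq_integral => x _; congr f.
  by apply/rowP => -[].
have maff : measurable_fun setT (fun x : 'rV[R]_n.+1 => r *: x + c)%R.
  by apply: (@measurable_affine R n.+1 _ _ (cst r) id c).
have ri0 : (0 <= r^-1)%R by rewrite invr_ge0 ltW.
have rin0 : (0 <= r ^- n)%R by rewrite invr_ge0 exprn_ge0 ?ltW.
pose c' : 'rV[R]_n := (\row_i c 0 (lift ord0 i))%R.
have consE x v : (r *: consrV (x, v) + c = consrV (r * x + c 0 0, r *: v + c'))%R.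
  have affE k (w d : 'rV[R]_k) (j : 'I_k) : ((r *: w + d) 0 j = r * w 0 j + d 0 j)%R.
    by rewrite !mxE.
  apply/rowP => i; rewrite affE; case: (@split_ordP 1 n i) => j ->.
    rewrite /consrV !(@row_mxEl _ 1 1 n) !mxE ord1; congr (_ + c _ _)%R.
    exact/val_inj.
  rewrite /consrV !(@row_mxEr _ 1 1 n) affE mxE; congr (_ + c _ _)%R.
  exact/val_inj.
rewrite ge0_integral_rVS//; last exact: measurableT_comp.
have mfc : measurable_fun setT (f \o @consrV R n).
  exact: (measurableT_comp mf (@measurable_consrV R n)).
have mF x : measurable_fun setT (fun v => f (consrV (x, v))).
  exact: (measurableT_comp mfc (@pair1_measurable _ _ _ _ x)).
transitivity (\int[leb]_x ((r ^- n)%:E * \int[L n]_v f (consrV ((r * x + c 0 0)%R, v)))).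
  apply: eq_integral => x _; under eq_integral do rewrite consE.
  by rewrite (ih c' (fun v => f (consrV ((r * x + c 0 0)%R, v)))).
have mG : measurable_fun setT (fun x => \int[L n]_v f (consrV (x, v))).
  by have := @measurable_fun_fubini_tonelli_F _ _ _ _ _ (L n) (f \o @consrV R n) mfc
    (fun xv => f0 _).
rewrite ge0_integralZl//; last 2 first.
- apply: (measurableT_comp mG); exact: measurable_affine1.
- by move=> x _; exact: integral_ge0.
rewrite (@ge0_integral_affine r (c 0 0)%R (fun x => \int[L n]_v f (consrV (x, v))))//.
  by rewrite -ge0_integral_rVS// muleA -EFinM exprSr invfM mulrC.
by move=> x; exact: integral_ge0.
Qed.

End affine_change_of_variables.

(** * Layer cake and integrals of powers *)

Section layer_cake.
Context {R : realType}.
Local Open Scope ereal_scope.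
Local Notation leb := (@lebesgue_measure R).

(* Tonelli on the region rho y < t. *)
Lemma layer_cake d (T : measurableType d) (m : {sigma_finite_measure set T -> \bar R})
    (A : set T) (rho : T -> R) (g : R -> R) :
  measurable A -> measurable_fun setT rho -> measurable_fun setT g ->
  (forall t, (0 <= g t)%R) ->
  \int[m]_(y in A) \int[leb]_(t in `]rho y, +oo[) (g t)%:E =
  \int[leb]_t ((g t)%:E * m (A `&` [set y | (rho y < t)%R])).
Proof.
move=> mA mrho mg g0.
pose E : set (T * measurableTypeR R) :=
  (fst @^-1` A) `&` ((fun yt => yt.2 - rho yt.1)%R @^-1` `]0%R, +oo[%classic).
have mE : measurable E.
  apply: measurableI.
    by rewrite -[X in measurable X]setTI; exact: measurable_fst.
  rewrite -[X in measurable X]setTI.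
  have : measurable_fun setT (fun yt : T * measurableTypeR R => yt.2 - rho yt.1)%R.
    apply: measurable_funB; first exact: measurable_snd.
    by apply: (measurableT_comp mrho); exact: measurable_fst.
  by apply => //; exact: measurable_itv.
have inE' y t : ((y, t) \in E) = (y \in A) && (rho y < t)%R.
  apply/idP/andP => [/set_mem [/= yA]|[yA yt]].
    by rewrite in_itv/= andbT subr_gt0 => ?; split => //; exact: mem_set.
  by apply/mem_set; split => /=; [exact: set_mem|rewrite in_itv/= andbT subr_gt0].
pose h (yt : T * measurableTypeR R) : \bar R := (g yt.2 * \1_E yt)%:E.
have mh : measurable_fun setT h.
  apply/measurable_EFinP; apply: measurable_funM => //.
  exact: (measurableT_comp mg measurable_snd).
have h0 x : 0 <= h x by rewrite lee_fin mulr_ge0.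
transitivity (\int[m]_y \int[leb]_t h (y, t)).
  rewrite integral_mkcond; apply: eq_integral => y _; rewrite patchE; case: ifPn => yA.
    rewrite integral_mkcond; apply: eq_integral => t _; rewrite patchE /h/= indicE inE' yA/=.
    by rewrite mem_setE in_itv/= andbT; case: ifPn; rewrite ?mulr1 ?mulr0.
  rewrite integral0_eq// => t _.
  by rewrite /h/= indicE inE' (negbTE yA) mulr0.
rewrite (fubini_tonelli h)//; apply: eq_integral => t _.
have mEt : measurable (A `&` [set y | (rho y < t)%R]).
  apply: measurableI => //; rewrite -[X in measurable X]setTI.
  rewrite (_ : [set y | _] = rho @^-1` `]-oo, t[%classic).
    by apply: mrho => //; exact: measurable_itv.
  by apply/seteqP; split => y; rewrite /= in_itv/=.
transitivity (\int[m]_y ((g t)%:E * (\1_(A `&` [set y | (rho y < t)%R]) y)%:E)).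
  apply: eq_integral => y _; rewrite /h/= EFinM; congr (_ * _%:E).
  rewrite !indicE inE' in_setI; congr (_ && _)%:R.
  by apply/idP/idP => [/mem_set|/set_mem].
rewrite ge0_integralZl//; last by rewrite lee_fin.
  by rewrite integral_indic// setIT.
by apply/measurable_EFinP.
Qed.

End layer_cake.

Section power_integrals.
Context {R : realType}.
Local Notation leb := (@lebesgue_measure R).

Lemma powR_cvgy_lt0 (a : R) : 0 < a -> (x `^ (- a) @[x --> +oo] --> (0 : R)).
Proof.
move=> a0; apply/cvgrPdist_le => /= e e0; near=> x.
have x0 : 0 < x by near: x; apply: nbhs_pinfty_gt; exact: num_real.
rewrite sub0r normrN ger0_norm ?powR_ge0// powRN invf_ple ?posrE ?powR_gt0//.
have xe : e^-1 `^ a^-1 <= x.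
  by near: x; apply: nbhs_pinfty_ge; exact: num_real.
have ei0 : 0 <= e^-1 by rewrite invr_ge0 ltW.
have -> : e^-1 = ((e^-1) `^ a^-1) `^ a.
  by rewrite -powRrM mulVf ?powRr1// lt0r_neq0.
by apply: (ge0_ler_powR (ltW a0)) => //; rewrite nnegrE ?powR_ge0 ?(ltW x0).
Unshelve. all: by end_near. Qed.

Lemma continuous_powR_gt0 (a x : R) : 0 < x -> {for x, continuous (fun t : R => t `^ a)}.
Proof.
move=> x0; apply: differentiable_continuous; apply/derivable1_diffP.
by apply: derivable_powR; rewrite in_itv/= x0.
Qed.

Lemma integral_powR_tail (a s : R) : 0 < a -> 0 < s ->
  (\int[leb]_(t in `]s, +oo[) (t `^ (- a - 1))%:E = (s `^ (- a) / a)%:E)%E.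
Proof.
move=> a0 s0.
rewrite integral_itv_obnd_cbnd; last first.
  apply/measurable_EFinP; apply: measurable_funTS; exact: measurable_powR.
have d (x : R) : 0 < x -> is_derive x 1 (fun t : R => - a^-1 * t `^ (- a)) (x `^ (- a - 1)).
  move=> x0.
  have := @is_deriveZ _ _ _ (@powR R ^~ (- a)) (- a^-1) x 1 _ (is_derive1_powR (- a) x0).
  rewrite (_ : - a^-1 *: _ = x `^ (- a - 1)) //.
  by rewrite /GRing.scale/= mulrA mulNr mulrN opprK mulVf ?mul1r// lt0r_neq0.
rewrite (@ge0_continuous_FTC2y _ _ (fun t => - a^-1 * t `^ (- a)) _ 0).
- by rewrite sub0e -EFinN mulNr opprK mulrC.
- by move=> x _; exact: powR_ge0.
- apply: continuous_in_subspaceT => x; rewrite inE/= in_itv/= andbT => sx.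
  by apply: continuous_powR_gt0; exact: lt_le_trans sx.
- rewrite -[X in _ --> X](mulr0 (- a^-1)); apply: cvgMr; exact: powR_cvgy_lt0.
- by move=> x sx; apply: ex_derive; apply: d; exact: lt_trans sx.
- apply: cvg_at_right_filter; apply: cvgMr; exact: continuous_powR_gt0.
- move=> x; rewrite in_itv/= andbT => sx; rewrite derive1E.
  by apply: derive_val; apply: d; exact: lt_trans sx.
Qed.

(** For a < 1 the integrand blows up at 0, so the interval is exhausted by ]s/(k+1), s], where the
    fundamental theorem applies, and monotone convergence concludes. *)
Lemma integral_powR_head (a s : R) : 0 < a -> 0 < s ->
  (\int[leb]_(t in `]0%R, s[) (t `^ (a - 1))%:E = (s `^ a / a)%:E)%E.
Proof.
move=> a0 s0.
have mf (D : set R) : measurable D -> measurable_fun D (fun t : R => (t `^ (a - 1))%:E).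
  by move=> mD; apply/measurable_EFinP; apply: measurable_funTS; exact: measurable_powR.
rewrite -(@integral_itv_bndoo _ 0 s _ false false)//; last exact: mf.
pose F k := [set` `](s / k.+1%:R), s]] : set R.
have d (x : R) : 0 < x -> is_derive x 1 (fun t : R => a^-1 * t `^ a) (x `^ (a - 1)).
  move=> x0.
  have := @is_deriveZ _ _ _ (@powR R ^~ a) a^-1 x 1 _ (is_derive1_powR a x0).
  rewrite (_ : a^-1 *: _ = x `^ (a - 1)) //.
  by rewrite /GRing.scale/= mulKf// lt0r_neq0.
have FE k : (\int[leb]_(t in F k) (t `^ (a - 1))%:E =
    (a^-1 * s `^ a - a^-1 * (s `^ a * k.+1%:R `^ (- a)))%:E)%E.
  have sk0 : 0 < s / k.+1%:R by rewrite divr_gt0.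
  have sks : s / k.+1%:R <= s by rewrite ler_pdivrMr// ler_peMr// ?ler1n// ltW.
  have -> : s `^ a * k.+1%:R `^ (- a) = (s / k.+1%:R) `^ a.
    rewrite powRM ?invr_ge0 ?(ltW s0)//; congr (_ * _).
    by rewrite -powR_inv1// -powRrM mulN1r.
  (* For k = 0 the interval is empty, whereas the fundamental theorem wants distinct end points. *)
  move: sks; rewrite le_eqVlt => /predU1P[E|sks].
    by rewrite /F E set_itvoc0 integral_set0 subrr.
  rewrite /F integral_itv_obnd_cbnd; last exact: mf.
  rewrite (@continuous_FTC2 _ _ (fun t => a^-1 * t `^ a))//.
  - apply: continuous_in_subspaceT => x; rewrite inE/= in_itv/= => /andP[sx _].
    by apply: continuous_powR_gt0; exact: lt_le_trans sx.
  - split.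
    + move=> x; rewrite in_itv/= => /andP[sx _].
      by apply: ex_derive; apply: d; exact: lt_trans sx.
    + by apply: cvg_at_right_filter; apply: cvgMr; exact: continuous_powR_gt0.
    + by apply: cvg_at_left_filter; apply: cvgMr; exact: continuous_powR_gt0.
  - move=> x; rewrite in_itv/= => /andP[sx _]; rewrite derive1E.
    by apply: derive_val; apply: d; exact: lt_trans sx.
have UF : `]0%R, s]%classic = \bigcup_k F k.
  apply/seteqP; split => [x|x [k _]]; rewrite /F/= !in_itv/= => /andP[].
    move=> x0 xs; have [k kx] : exists k : nat, s / x < k.+1%:R.
      exists (Num.bound (s / x)); rewrite (lt_trans (archi_boundP _))//.
        by rewrite divr_ge0// ltW.
      by rewrite ltr_nat.
    exists k => //=; rewrite in_itv/= xs andbT.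
    by rewrite ltr_pdivrMr// mulrC -ltr_pdivrMr.
  by move=> sx ->; rewrite andbT (lt_trans _ sx)// divr_gt0.
have cvgF : (\int[leb]_(t in F k) (t `^ (a - 1))%:E)%E @[k --> \oo] -->
    (\int[leb]_(t in `]0%R, s]) (t `^ (a - 1))%:E)%E.
  rewrite UF; apply: ge0_nondecreasing_set_cvg_integral.
  - move=> i j ij; apply/subsetPset => x; rewrite /F/= !in_itv/= => /andP[sx ->].
    rewrite andbT (le_lt_trans _ sx)// ler_pM2l// lef_pV2 ?posrE//.
    by rewrite ler_nat ltnS.
  - by move=> k; exact: measurable_itv.
  - by move=> k; apply: mf; exact: measurable_itv.
  - by move=> k x _; rewrite lee_fin powR_ge0.
move/cvg_lim : (cvgF) => <- //; apply/cvg_lim => //.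
under eq_fun do rewrite FE.
apply: cvg_EFin; first by near=> k.
rewrite (_ : s `^ a / a = a^-1 * s `^ a - a^-1 * (s `^ a * 0)); last by ring.
apply: cvgB; first exact: cvg_cst.
apply: cvgMr; apply: cvgMr.
apply: (@cvg_comp _ _ _ (fun k : nat => k.+1%:R : R) (@powR R ^~ (- a)) _ +oo) => /=.
  by have := @cvgr_idn R; rewrite -cvg_shiftS.
exact: powR_cvgy_lt0.
Unshelve. all: by end_near. Qed.

Lemma integral_expR_tail (s : R) :
  (\int[leb]_(t in `]s, +oo[) (expR (- t))%:E = (expR (- s))%:E)%E.
Proof.
have ce : continuous (fun t : R => expR (- t)).
  by move=> x; apply: continuous_comp; [exact: opp_continuous|exact: continuous_expR].
have d (x : R) : is_derive x 1 (fun t : R => - expR (- t)) (expR (- x)).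
  by apply: is_derive_eq;
    rewrite ?mulrN1 ?mulrN ?mulr1 ?scalerN ?opprK /GRing.scale/= ?mulr1 ?mulrN1 ?opprK.
rewrite integral_itv_obnd_cbnd; last first.
  apply/measurable_EFinP; apply: measurable_funTS.
  exact: continuous_measurable_fun.
rewrite (@ge0_continuous_FTC2y _ _ (fun t => - expR (- t)) _ 0).
- by rewrite sub0e -EFinN opprK.
- by move=> x _; exact: expR_ge0.
- exact: continuous_subspaceT.
- by rewrite -[X in _ --> X]oppr0; apply: cvgN; exact: cvgr_expR.
- by move=> x _; apply: ex_derive.
- by apply: cvg_at_right_filter; apply: cvgN; exact: ce.
- by move=> x _; rewrite derive1E; exact: derive_val.
Qed.

End power_integrals.

(** * The volume of balls *)

Section ball_volume.
Context {R : realType}.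
Local Open Scope ereal_scope.
Local Notation L := (@lebesgue_rV R).
Implicit Types (n : nat) (r : R).

Lemma lebesgue_rV_set1 n (c : 'rV[R]_n) : (0 < n)%N -> L n [set c] = 0.
Proof.
move=> n0; rewrite (_ : [set c] = [set x : 'rV[R]_n | forall i, [set c 0%R i] (x ord0 i)]).
  rewrite (@lebesgue_rV_box R n (fun i => [set c 0%R i])) => [|i]; last exact: measurable_set1.
  by rewrite (bigD1 (Ordinal n0))//= lebesgue_measure_set1 mul0e.
apply/seteqP; split => [x ->//|x /= h]; apply/rowP => i; exact: h.
Qed.

Lemma measurable_rV_set1 n (c : 'rV[R]_n) : measurable [set c].
Proof.
rewrite (_ : [set c] = [set x : 'rV[R]_n | forall i, [set c 0%R i] (x 0%R i)]).
  by apply: (@measurable_rV_box R n (fun i => [set c 0%R i])) => i; exact: measurable_set1.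
by apply/seteqP; split => [x ->//|x /= h]; apply/rowP => i; exact: h.
Qed.

(** Used to puncture balls at the singularity of the kernel, where a power with negative exponent
    takes the default value 0. *)
Lemma lebesgue_rV_setD1 n (A : set 'rV[R]_n) c : (0 < n)%N -> measurable A ->
  L n (A `\ c) = L n A.
Proof.
move=> n0 mA; have mc := measurable_rV_set1 c.
rewrite [RHS](@measureDI _ _ _ (L n) A [set c])//.
rewrite [X in _ = _ + X](_ : _ = 0) ?adde0//.
apply: (@subset_measure0 _ _ _ (L n) _ [set c]) => //.
  exact: measurableI.
exact: lebesgue_rV_set1.
Qed.

Lemma lebesgue_rV_cube n (a : R) : (0 < a)%R ->
  0 < L n [set x : 'rV[R]_n | forall i, `](- a)%R, a[%classic (x ord0 i)] < +oo.
Proof.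
move=> a0; rewrite (@lebesgue_rV_box R n (fun=> `](- a)%R, a[%classic)); last first.
  by move=> i; exact: measurable_itv.
elim/big_ind : _ => [|x y /andP[x0 xoo] /andP[y0 yoo]|i _].
- by rewrite lte01 ltry.
- by rewrite mule_gt0//= lte_mul_pinfty// ?ge0_fin_numE// ltW.
- rewrite lebesgue_measure_itv/= lte_fin gtrN// -EFinB lte_fin ltry andbT.
  by rewrite opprK addr_gt0.
Qed.

Lemma lebesgue_eball_lty n (c : 'rV[R]_n) r : L n (eball c r) < +oo.
Proof.
have [M [_ MB]] := eball_bounded c r.
pose a := (`|M| + 2)%R; have a0 : (0 < a)%R by rewrite ltr_wpDl.
have /andP[_] := lebesgue_rV_cube n a0; apply: le_lt_trans.
apply: le_measure; rewrite ?inE.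
- exact: measurable_eball.
- by apply: (@measurable_rV_box _ _ (fun=> `](- a)%R, a[%classic)) => i; exact: measurable_itv.
move=> x xc i /=; rewrite in_itv/= -ltr_norml (le_lt_trans (coord_le_norm x i))//.
have := MB (`|M| + 1)%R; rewrite (le_lt_trans (ler_norm M)) ?ltrDl// => /(_ isT x xc)/=.
by move=> /le_lt_trans; apply; rewrite /a ltrD2l ltr1n.
Qed.

Lemma lebesgue_eball_gt0 n (c : 'rV[R]_n) r : (0 < r)%R -> 0 < L n (eball c r).
Proof.
move=> r0.
have mB : measurable (eball c r) by exact: measurable_eball.
have : \int[L n]_x (\1_(eball (0 : 'rV[R]_n) r) x)%:E = \int[L n]_x (\1_(eball c r) x)%:E.
  transitivity (\int[L n]_x (EFin \o \1_(eball c r)) (1 *: x + c)%R).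
    apply: eq_integral => x _ /=; rewrite !indicE scale1r; congr ((nat_of_bool _)%:R)%:E.
    by apply/idP/idP => /set_mem h; apply/mem_set; move: h; rewrite /eball/= subr0 addrK.
  have E1 : ((1 : R) ^- n)%:E = 1 by rewrite expr1n invr1.
  rewrite ge0_integral_rV_affine ?ltr01 ?E1 ?mul1e//.
  - exact/measurable_EFinP.
  - by move=> x; rewrite lee_fin.
rewrite !integral_indic ?setIT//; last exact: measurable_eball.
(* The cube of half-side a fits in the ball of radius r, because |x| is at most the sum of the
   |x_i|, hence at most n a < r. *)
move=> <-; pose a := (r / n.+1%:R)%R; have a0 : (0 < a)%R by rewrite divr_gt0.
have /andP[h _] := lebesgue_rV_cube n a0; apply: (lt_le_trans h).
apply: le_measure; rewrite ?inE.
- by apply: (@measurable_rV_box _ _ (fun=> `](- a)%R, a[%classic)) => i; exact: measurable_itv.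
- exact: measurable_eball.
move=> x xa; rewrite /eball/= subr0 (le_lt_trans (enorm_le_sum x))//.
have : (\sum_i `|x 0%R i| <= n%:R * a)%R.
  rewrite mulr_natl -[X in (_ *+ X)%R]card_ord -sumr_const; apply: ler_sum => i _.
  by have := xa i; rewrite /= in_itv/= -ltr_norml => /ltW.
move=> /le_lt_trans; apply.
by rewrite /a mulrCA -[X in (_ < X)%R]mulr1 ltr_pM2l// ltr_pdivrMr// mul1r ltr_nat.
Qed.

Definition unit_ball_volume n : R := fine (L n (eball 0%R 1%R)).

Lemma unit_ball_volume_gt0 n : (0 < unit_ball_volume n)%R.
Proof. by apply: fine_gt0; rewrite lebesgue_eball_gt0//= lebesgue_eball_lty. Qed.

Lemma lebesgue_eball n (c : 'rV[R]_n) r : (0 < r)%R ->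
  L n (eball c r) = (r ^+ n * unit_ball_volume n)%:E.
Proof.
move=> r0.
have mB : measurable (eball c r) by exact: measurable_eball.
rewrite EFinM fineK; last first.
  by rewrite ge0_fin_numE ?measure_ge0// lebesgue_eball_lty.
have aff := @ge0_integral_rV_affine R n r c (EFin \o \1_(eball c r)) r0.
have : \int[L n]_x (\1_(eball (0 : 'rV[R]_n) 1) x)%:E =
    (r ^- n)%:E * \int[L n]_x (\1_(eball c r) x)%:E.
  rewrite -aff//.
  - apply: eq_integral => x _ /=; rewrite !indicE; congr ((nat_of_bool _)%:R)%:E.
    apply/idP/idP => /set_mem h; apply/mem_set; move: h; rewrite /eball/= subr0 addrK.
      by rewrite enormZ gtr0_norm// gtr_pMr.
    by rewrite enormZ gtr0_norm// gtr_pMr.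
  - exact/measurable_EFinP.
  - by move=> x; rewrite lee_fin.
rewrite !integral_indic ?setIT//; last exact: measurable_eball.
by move=> ->; rewrite muleA -EFinM mulfV ?mul1e// expf_neq0// lt0r_neq0.
Qed.

Lemma lebesgue_bounded_lty n (A : set 'rV[R]_n) : measurable A -> bounded_set A ->
  L n A < +oo.
Proof.
move=> mA /(bounded_setP_enorm 0%R)[r r0 Ar].
apply: le_lt_trans (lebesgue_eball_lty 0%R r); apply: le_measure => //; rewrite ?inE//.
exact: measurable_eball.
Qed.

Lemma lebesgue_open_gt0 n (A : set 'rV[R]_n) : open A -> A !=set0 -> 0 < L n A.
Proof.
move=> oA [x Ax]; have [r r0 rA] := open_eballP oA Ax.
apply: (lt_le_trans (lebesgue_eball_gt0 x r0)); apply: le_measure => //; rewrite ?inE//.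
  exact: measurable_eball.
exact: open_measurable_rV.
Qed.

Lemma integral_rV_gauss n :
  \int[L n]_x (expR (- enorm x ^+ 2))%:E = (Num.sqrt pi ^+ n)%:E.
Proof.
have ce m : continuous (fun x : 'rV[R]_m => expR (- enorm x ^+ 2)).
  move=> x; apply: (@continuous_comp _ _ _ (fun x => - enorm x ^+ 2)%R (@expR R)).
    apply: (@continuousN _ _ _ (fun x : 'rV[R]_m => enorm x ^+ 2)%R).
    apply: (@continuousM _ _ enorm enorm); exact: enorm_continuous.
  exact: continuous_expR.
have me m : measurable_fun setT (fun x : 'rV[R]_m => (expR (- enorm x ^+ 2))%:E).
  by apply/measurable_EFinP; exact: continuous_measurable_rV.
elim: n => [|n ih].
  rewrite expr0 integral_dirac//=.
  - by rewrite diracE mem_set//= mul1e enorm0 expr0n oppr0 expR0.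
  - exact: me.
rewrite ge0_integral_rVS//.
have consE x v : (enorm (consrV (x, v) : 'rV[R]_n.+1) ^+ 2 = x ^+ 2 + enorm v ^+ 2)%R.
  rewrite !enorm_sqr big_ord_recl; congr (_ ^+ 2 + _)%R.
    rewrite /consrV (_ : ord0 = @lshift 1 n ord0); last exact/val_inj.
    by rewrite (@row_mxEl _ 1 1 n) mxE.
  apply: eq_bigr => i _; rewrite /consrV.
  rewrite (_ : lift ord0 i = @rshift 1 n i); last exact/val_inj.
  by rewrite (@row_mxEr _ 1 1 n).
transitivity (\int[@lebesgue_measure R]_x ((Num.sqrt pi ^+ n)%:E * (gauss_fun x)%:E)).
  apply: eq_integral => x _; under eq_integral do rewrite consE opprD expRD EFinM.
  rewrite ge0_integralZl//.
  - by rewrite ih muleC.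
  - exact: me.
rewrite ge0_integralZl//; last 2 first.
- by apply/measurable_EFinP; exact: measurable_gauss_fun.
- by move=> x _; rewrite lee_fin gauss_fun_ge0.
by rewrite integralT_gauss -EFinM -exprSr.
Qed.

Lemma integral_gt0_restrict (F : R -> \bar R) : (forall t, (t <= 0)%R -> F t = 0) ->
  \int[lebesgue_measure]_t F t = \int[lebesgue_measure]_(t in `]0%R, +oo[) F t.
Proof.
move=> F0; rewrite [RHS]integral_mkcond; apply: eq_integral => t _.
by rewrite patchE mem_setE in_itv/= andbT; case: ltP => // /F0.
Qed.

(** The integral of exp(-|x|^2) is computed twice: coordinate by coordinate it is pi^(n/2), and by
    layers, the ball of radius sqrt t having volume V t^(n/2), it is V Gamma(n/2 + 1). *)
Lemma omegaE n : omega n = unit_ball_volume n.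
Proof.
set V := unit_ball_volume n; have V0 : (0 < V)%R := unit_ball_volume_gt0 n.
pose h (t : R) : R := (t `^ (n%:R / 2 + 1 - 1) * expR (- t))%R.
have h0 t : (0 <= h t)%R by rewrite mulr_ge0 ?powR_ge0 ?expR_ge0.
have mh : measurable_fun setT h.
  apply: measurable_funM; first exact: measurable_powR.
  by apply: continuous_measurable_fun => x; apply: continuous_comp;
    [exact: opp_continuous|exact: continuous_expR].
have hV : V%:E * \int[lebesgue_measure]_(t in `]0%R, +oo[) (h t)%:E =
    (pi `^ (n%:R / 2))%:E.
  rewrite -ge0_integralZl//; last 3 first.
  - by apply/measurable_EFinP; exact: measurable_funTS.
  - by move=> t _; rewrite lee_fin.
  - by rewrite lee_fin ltW.
  have -> : (pi `^ (n%:R / 2) = Num.sqrt pi ^+ n :> R)%R.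
    by rewrite mulrC powRrM powR12_sqrt ?pi_ge0// powR_mulrn// sqrtr_ge0.
  rewrite -integral_rV_gauss.
  have mg : measurable_fun setT (fun t : R => expR (- t)).
    by apply: continuous_measurable_fun => x; apply: continuous_comp;
      [exact: opp_continuous|exact: continuous_expR].
  have mr : measurable_fun setT (fun x : 'rV[R]_n => enorm x ^+ 2)%R.
    apply: continuous_measurable_rV => x.
    apply: (@continuousM _ _ enorm enorm); exact: enorm_continuous.
  (* Writes exp(-|x|^2) as the integral of exp(-t) over t > |x|^2, the form that [layer_cake]
     expects. *)
  under [RHS]eq_integral do rewrite -integral_expR_tail.
  rewrite (layer_cake (L n) measurableT mr mg) => [|t]; last exact: expR_ge0.
  rewrite [RHS]integral_gt0_restrict => [|t t0]; last first.
    rewrite setTI (_ : mkset _ = set0) ?measure0 ?mule0//.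
    apply/seteqP; split => x //=; rewrite ltNge => /negP; apply.
    by rewrite (le_trans t0)// sqr_ge0.
  apply: eq_integral => t; rewrite inE/= in_itv/= andbT => t0.
  rewrite setTI (_ : mkset _ = eball 0%R (Num.sqrt t)); last first.
    have sq x : (enorm x ^+ 2 < t)%R = (enorm (x : 'rV[R]_n) < Num.sqrt t)%R.
      rewrite -[X in (_ < X)%R = _](sqr_sqrtr (ltW t0)) ltr_pXn2r ?nnegrE ?sqrtr_ge0 ?enorm_ge0//.
    by apply/seteqP; split => x; rewrite /eball/= subr0 sq.
  rewrite lebesgue_eball ?sqrtr_gt0// -!EFinM; congr EFin; rewrite /h -/V.
  rewrite addrK mulrC -mulrA mulrC -mulrA; congr (_ * _)%R.
  by rewrite mulrC; congr (_ * _)%R; rewrite mulrC powRrM powR12_sqrt ?ltW// powR_mulrn// sqrtr_ge0.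
have I0 : 0 <= \int[lebesgue_measure]_(t in `]0%R, +oo[) (h t)%:E.
  by apply: integral_ge0 => t _; rewrite lee_fin.
(* [Gamma] is a real integral, so the extended one must be shown finite and nonzero; both follow
   from [hV], since V > 0 and the product is a positive real. *)
rewrite /omega /Gamma /Rintegral -/h; move: hV I0.
case: (\int[lebesgue_measure]_(t in `]0%R, +oo[) (h t)%:E) => [I| |]//.
  rewrite -EFinM => -[VI] _ /=; rewrite -VI mulfK//; apply/eqP => I00.
  by move: VI; rewrite I00 mulr0 => /esym/eqP; rewrite gt_eqF// powR_gt0// pi_gt0.
by rewrite gt0_muley ?lte_fin.
Qed.

End ball_volume.

(** * The bathtub principle *)

(* The superlevel set B of k beats every set A of the same measure, because k <= c
   on A \ B while c < k on B \ A; the strict inequality settles equality. *)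
Section bathtub.
Context d (T : measurableType d) (R : realType) (m : {measure set T -> \bar R}).
Local Open Scope ereal_scope.
Variables (A B : set T) (k : T -> R) (c : R).
Hypotheses (mA : measurable A) (mB : measurable B) (mk : measurable_fun setT k).
Hypotheses (k0 : forall x, (0 <= k x)%R) (c0 : (0 <= c)%R).
Hypotheses (kA : forall x, A x -> ~ B x -> (k x <= c)%R).
Hypotheses (kB : forall x, B x -> (c < k x)%R).
Hypotheses (mAB : m A = m B) (mBoo : m B < +oo).

Let mkD (D : set T) : measurable_fun D (fun x => (k x)%:E).
Proof. by apply/measurable_EFinP; exact: measurable_funTS. Qed.

Let split_int (D E : set T) : measurable D -> measurable E ->
  \int[m]_(x in D) (k x)%:E =
  \int[m]_(x in D `&` E) (k x)%:E + \int[m]_(x in D `\` E) (k x)%:E.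
Proof.
move=> mD mE; rewrite -ge0_integral_setU//.
- by rewrite setUIDK.
- exact: measurableI.
- exact: measurableD.
- by move=> x _; rewrite lee_fin.
- by apply/disj_setPS => x [[_ ?] []].
Qed.

Let mADB : measurable (A `\` B). Proof. exact: measurableD. Qed.
Let mBDA : measurable (B `\` A). Proof. exact: measurableD. Qed.

Let meas_diff : m (A `\` B) = m (B `\` A).
Proof.
have mI : m (A `&` B) \is a fin_num.
  rewrite ge0_fin_numE ?measure_ge0//; apply: le_lt_trans mBoo.
  by apply: le_measure; rewrite ?inE//; exact: measurableI.
have := mAB; rewrite (@measureDI _ _ _ m A B)// (@measureDI _ _ _ m B A)//.
rewrite [B `&` A]setIC => E.
by have := congr1 (fun z => z - m (A `&` B)) E; rewrite !addeK.
Qed.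

Let int_AB : \int[m]_(x in A `\` B) (k x)%:E <= c%:E * m (B `\` A).
Proof.
rewrite -meas_diff -integral_cst//; apply: ge0_le_integral => //.
- by move=> x _; rewrite lee_fin.
- by move=> x [Ax Bx]; rewrite lee_fin kA.
Qed.

Let int_BA : c%:E * m (B `\` A) <= \int[m]_(x in B `\` A) (k x)%:E.
Proof.
rewrite -integral_cst//; apply: ge0_le_integral => //.
by move=> x [Bx _]; rewrite lee_fin ltW// kB.
Qed.

Lemma bathtub : \int[m]_(x in A) (k x)%:E <= \int[m]_(x in B) (k x)%:E.
Proof.
rewrite (@split_int A B)// (@split_int B A)// [B `&` A]setIC leeD2l//.
exact: le_trans int_AB int_BA.
Qed.

Lemma bathtub_eq : \int[m]_(x in B) (k x)%:E < +oo ->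
  \int[m]_(x in B) (k x)%:E <= \int[m]_(x in A) (k x)%:E -> m (B `\` A) = 0.
Proof.
move=> koo; rewrite (@split_int A B)// (@split_int B A)// [B `&` A]setIC.
(* The common part over the intersection of A and B is finite, hence can be cancelled. *)
rewrite leeD2lE => [BA|]; last first.
  rewrite ge0_fin_numE; last by apply: integral_ge0 => x _; rewrite lee_fin.
  apply: le_lt_trans koo; apply: ge0_subset_integral => //.
  - exact: measurableI.
  - by move=> x _; rewrite lee_fin.
have {}BA := le_trans BA int_AB.
have mkc : measurable_fun (B `\` A) (fun x => (k x - c)%:E).
  by apply/measurable_EFinP; apply: measurable_funTS; exact: measurable_funB.
have cfin : c%:E * m (B `\` A) \is a fin_num.
  rewrite fin_numM// ge0_fin_numE ?measure_ge0//; apply: le_lt_trans mBoo.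
  by apply: le_measure; rewrite ?inE//; exact: subDsetl.
have kc0 x : (B `\` A) x -> 0 <= (k x - c)%:E.
  by move=> [Bx _]; rewrite lee_fin subr_ge0 ltW// kB.
(* On B \ A the function k - c is positive, yet by [BA] its integral is at most 0; so B \ A is
   null. *)
have int0 : \int[m]_(x in B `\` A) `|(k x - c)%:E| = 0.
  rewrite (eq_integral (fun x => (k x - c)%:E)); last first.
    by move=> x /set_mem xBA; rewrite gee0_abs// kc0.
  apply/eqP; rewrite eq_le integral_ge0// andbT.
  rewrite -(@leeD2rE _ (c%:E * m (B `\` A)))// add0e -[X in _ + X]integral_cst//.
  rewrite -ge0_integralD// (eq_integral (fun x => (k x)%:E))// => x _.
  by rewrite /= -EFinD subrK.
have /(ae_eq_integral_abs m mBDA mkc)[N [mN N0 BAN]] := int0.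
apply: (@subset_measure0 _ _ _ m _ N) => // x xBA; apply: BAN => /(_ xBA)/eqP.
by rewrite eqe subr_eq0 gt_eqF// kB; case: xBA.
Qed.

End bathtub.

(** * The Riesz kernel on balls and on sets of the same volume *)

Section riesz_kernel.
Context {R : realType}.
Local Open Scope ereal_scope.
Local Notation L := (@lebesgue_rV R).
Local Notation leb := (@lebesgue_measure R).
Variables (n : nat) (g : R).
Hypotheses (g0 : (0 < g)%R) (gn : (g < n%:R)%R).

Let n0 : (0 < n)%N.
Proof. by rewrite -(ltr_nat R) (lt_trans g0). Qed.

Definition riesz_kernel (c y : 'rV[R]_n) : R := (enorm (y - c) `^ (- g))%R.

Lemma measurable_riesz_kernel c : measurable_fun setT (riesz_kernel c).
Proof.
apply: (measurableT_comp (measurable_powR _)); exact: measurable_enorm_sub.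
Qed.

Lemma riesz_kernel_ge0 c y : (0 <= riesz_kernel c y)%R.
Proof. exact: powR_ge0. Qed.

(** Layer cake with s^(-g) written as the integral of g t^(-g-1) over t > s: the layer at height t
    is the ball of radius min(r, t), which leaves a one-dimensional integral. It converges at 0
    because g < n. *)
Lemma integral_riesz_kernel_eball c r : (0 < r)%R ->
  \int[L n]_(y in eball c r) (riesz_kernel c y)%:E =
  (n%:R * unit_ball_volume n * r `^ (n%:R - g) / (n%:R - g))%:E.
Proof.
move=> r0; set V := unit_ball_volume n.
have V0 : (0 <= V)%R by rewrite ltW// unit_ball_volume_gt0.
have mB : measurable (eball c r) := measurable_eball c r.
have mc : measurable [set c] := measurable_rV_set1 c.
have mBc : measurable (eball c r `\ c) by exact: measurableD.
have mk (D : set 'rV[R]_n) : measurable_fun D (fun y => (riesz_kernel c y)%:E).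
  by apply/measurable_EFinP; apply: measurable_funTS; exact: measurable_riesz_kernel.
pose h (t : R) : R := (g * t `^ (- g - 1))%R.
have h0 t : (0 <= h t)%R by rewrite mulr_ge0 ?powR_ge0// ltW.
have mh : measurable_fun setT h.
  by apply: measurable_funM => //; exact: measurable_powR.
have mhD (D : set R) : measurable_fun D (EFin \o h).
  by apply/measurable_EFinP; exact: measurable_funTS.
(* At the centre the kernel has the default value 0 and the layer formula fails, so this null point
   is removed. *)
rewrite (@ge0_negligible_integral _ _ _ (L n) _ [set c])//; last 2 first.
- by move=> y _; rewrite lee_fin riesz_kernel_ge0.
- exact: lebesgue_rV_set1.
transitivity (\int[L n]_(y in eball c r `\ c)
    \int[leb]_(t in `]enorm (y - c), +oo[) (h t)%:E).
  apply: eq_integral => y /set_mem[_ /= /eqP yc].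
  have yc0 : (0 < enorm (y - c))%R by rewrite enorm_gt0 subr_eq0.
  under eq_integral do rewrite EFinM.
  rewrite ge0_integralZl_EFin ?(ltW g0)//; last first.
  - by apply/measurable_EFinP; apply: measurable_funTS; exact: measurable_powR.
  - by move=> t _; rewrite lee_fin powR_ge0.
  rewrite integral_powR_tail// -EFinM mulrCA divff ?mulr1//; exact: lt0r_neq0.
rewrite (layer_cake (L n) mBc (measurable_enorm_sub c) mh h0).
have ballI t : L n ((eball c r `\ c) `&` [set y | (enorm (y - c) < t)%R]) =
    L n (eball c (Num.min r t)).
  rewrite -[RHS](@lebesgue_rV_setD1 _ _ _ c)//; last exact: measurable_eball.
  congr (L n _); apply/seteqP; split => y /=; rewrite /eball/= lt_min.
    by move=> [[-> yc] ->].
  by move=> [/andP[-> ->] yc].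
under eq_integral do rewrite ballI.
rewrite integral_gt0_restrict => [|t t0]; last first.
  rewrite (_ : eball _ _ = set0) ?measure0 ?mule0//.
  apply/seteqP; split => y //=; rewrite /eball/= lt_min => /andP[_].
  by rewrite ltNge (le_trans t0)// enorm_ge0.
pose H (t : R) : R := (h t * (V * Num.min r t ^+ n))%R.
transitivity (\int[leb]_(t in `]0%R, +oo[) (H t)%:E).
  apply: eq_integral => t; rewrite inE/= in_itv/= andbT => t0.
  by rewrite lebesgue_eball ?lt_min ?r0// -EFinM; congr EFin; rewrite /H -/V; ring.
have mH (D : set R) : measurable_fun D (fun t => (H t)%:E).
  apply/measurable_EFinP; apply: measurable_funTS; apply: measurable_funM => //.
  apply: measurable_funM => //; apply: measurable_funX.
  by apply: measurable_minr.
(* Below r the layer is the ball of radius t, from r on it is the whole ball of radius r. *)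
have -> : `]0%R, +oo[%classic = `]0%R, r[%classic `|` `[r, +oo[%classic :> set R.
  by apply/seteqP; split => t; rewrite /= !in_itv/= !andbT;
    [case: (ltP t r) => tr t0; [left; rewrite t0|right]|
     move=> [/andP[]//|]; exact: lt_le_trans].
rewrite ge0_integral_setU//=; last 3 first.
- exact: mH.
- move=> t; rewrite /= !in_itv/= andbT => t0; rewrite lee_fin.
  rewrite !mulr_ge0// ?powR_ge0 ?(ltW g0)// exprn_ge0//.
  by rewrite le_min (ltW r0)/=; case: t0 => [/andP[/ltW]//|]; apply: le_trans; exact: ltW.
- by apply/disj_setPS => t [/=]; rewrite !in_itv/= => /andP[_ tr]; rewrite andbT leNgt tr.
have -> : \int[leb]_(t in `]0%R, r[) (H t)%:E =
    (g * V * (r `^ (n%:R - g) / (n%:R - g)))%:E.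
  rewrite EFinM -integral_powR_head ?subr_gt0//.
  rewrite -ge0_integralZl_EFin//=.
  - apply: eq_integral => t; rewrite inE/= in_itv/= => /andP[t0 tr].
    rewrite /H min_r ?(ltW tr)// -!EFinM; congr EFin.
    have -> : (n%:R - g - 1 = (- g - 1) + n%:R)%R by ring.
    rewrite powRD; last by rewrite (gt_eqF t0) implybT.
    by rewrite powR_mulrn ?(ltW t0)// /h; ring.
  - by move=> t _; rewrite lee_fin powR_ge0.
  - by apply/measurable_EFinP; apply: measurable_funTS; exact: measurable_powR.
  - by rewrite mulr_ge0// ltW.
have -> : \int[leb]_(t in `[r, +oo[) (H t)%:E = (V * r `^ (n%:R - g))%:E.
  transitivity (\int[leb]_(t in `[r, +oo[) ((g * V * r ^+ n)%:E * (t `^ (- g - 1))%:E)).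
    apply: eq_integral => t; rewrite inE/= in_itv/= andbT => rt.
    by rewrite /H min_l// -!EFinM; congr EFin; rewrite /h; ring.
  rewrite -integral_itv_obnd_cbnd; last first.
    apply: emeasurable_funM => //.
    by apply/measurable_EFinP; apply: measurable_funTS; exact: measurable_powR.
  rewrite ge0_integralZl_EFin//=.
  - rewrite integral_powR_tail// -EFinM; congr EFin.
    rewrite powRD; last by rewrite (gt_eqF r0) implybT.
    by rewrite powR_mulrn ?(ltW r0)//; field; rewrite lt0r_neq0.
  - by move=> t _; rewrite lee_fin powR_ge0.
  - by apply/measurable_EFinP; apply: measurable_funTS; exact: measurable_powR.
  - by rewrite !mulr_ge0 ?exprn_ge0// ltW.
rewrite -EFinD; congr EFin; field.
by rewrite subr_eq0 gt_eqF.
Qed.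

End riesz_kernel.

Section riesz_kernel_bathtub.
Context {R : realType}.
Local Open Scope ereal_scope.
Local Notation L := (@lebesgue_rV R).
Variables (n : nat) (g r : R) (c : 'rV[R]_n) (A : set 'rV[R]_n).
Hypotheses (g0 : (0 < g)%R) (gn : (g < n%:R)%R) (r0 : (0 < r)%R).
Hypotheses (mA : measurable A) (Ar : L n A = L n (eball c r)).

Let n0 : (0 < n)%N.
Proof. by rewrite -(ltr_nat R) (lt_trans g0). Qed.

(** The kernel being 0 at c by default, its strict superlevel set at the level r^(-g) is the
    punctured ball; [kA] and [kB] check the two sides. *)
Let B := eball c r `\ c.

Let mB : measurable B.
Proof. by apply: measurableD; [exact: measurable_eball|exact: measurable_rV_set1]. Qed.

Let LB : L n B = L n (eball c r).
Proof. by rewrite lebesgue_rV_setD1//; exact: measurable_eball. Qed.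

Let intB : \int[L n]_(y in eball c r) (riesz_kernel g c y)%:E =
  \int[L n]_(y in B) (riesz_kernel g c y)%:E.
Proof.
apply: ge0_negligible_integral.
- exact: measurable_rV_set1.
- exact: measurable_eball.
- by apply/measurable_EFinP; apply: measurable_funTS; exact: measurable_riesz_kernel.
- by move=> y _; rewrite lee_fin riesz_kernel_ge0.
- exact: lebesgue_rV_set1.
Qed.

Let kA x : A x -> ~ B x -> (riesz_kernel g c x <= r `^ (- g))%R.
Proof.
move=> _ nB; have [->|xc] := eqVneq x c.
  by rewrite /riesz_kernel subrr enorm0 powR0 ?powR_ge0// oppr_eq0 gt_eqF.
have rx : (r <= enorm (x - c))%R.
  by rewrite leNgt; apply/negP => xr; apply: nB; split => //=; exact/eqP.
rewrite /riesz_kernel !powRN lef_pV2 ?posrE ?powR_gt0//; last exact: lt_le_trans rx.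
by apply: (ge0_ler_powR (ltW g0)) => //; rewrite nnegrE ?enorm_ge0// ltW.
Qed.

Let kB x : B x -> (r `^ (- g) < riesz_kernel g c x)%R.
Proof.
move=> [xr /= /eqP xc].
have x0 : (0 < enorm (x - c))%R by rewrite enorm_gt0 subr_eq0.
rewrite /riesz_kernel !powRN ltf_pV2 ?posrE ?powR_gt0//.
by apply: (gt0_ltr_powR g0) => //; rewrite nnegrE ?enorm_ge0// ltW.
Qed.

Lemma integral_riesz_kernel_le :
  \int[L n]_(y in A) (riesz_kernel g c y)%:E <=
  (n%:R * unit_ball_volume n * r `^ (n%:R - g) / (n%:R - g))%:E.
Proof.
rewrite -(integral_riesz_kernel_eball g0 gn c r0) intB.
apply: (@bathtub _ _ R (L n) A B (riesz_kernel g c) (r `^ (- g))) => //.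
- exact: measurable_riesz_kernel.
- by move=> y; exact: riesz_kernel_ge0.
- exact: powR_ge0.
- exact: (etrans Ar (esym LB)).
- exact: (eq_ind _ (fun z => z < +oo) (lebesgue_eball_lty c r) _ (esym LB)).
Qed.

Lemma integral_riesz_kernel_eq :
  (n%:R * unit_ball_volume n * r `^ (n%:R - g) / (n%:R - g))%:E <=
    \int[L n]_(y in A) (riesz_kernel g c y)%:E ->
  L n (eball c r `\` A) = 0.
Proof.
rewrite -(integral_riesz_kernel_eball g0 gn c r0) => h.
rewrite -(@lebesgue_rV_setD1 _ _ _ c)//; last first.
  by apply: measurableD => //; exact: measurable_eball.
rewrite (_ : _ `\ c = B `\` A); last first.
  by apply/seteqP; split => y [[]].
apply: (@bathtub_eq _ _ R (L n) A B (riesz_kernel g c) (r `^ (- g))) => //.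
- exact: measurable_riesz_kernel.
- by move=> y; exact: riesz_kernel_ge0.
- exact: powR_ge0.
- exact: (etrans Ar (esym LB)).
- exact: (eq_ind _ (fun z => z < +oo) (lebesgue_eball_lty c r) _ (esym LB)).
- by rewrite -intB integral_riesz_kernel_eball// ltry.
- by rewrite -intB.
Qed.

End riesz_kernel_bathtub.

(** * Directional derivatives from continuous partial derivatives *)

Lemma cvg_is_derive {R : realType} {V : normedModType R} (f : V -> R) (x v : V) (d : R) :
  h^-1 *: (f (h *: v + x) - f x) @[h --> 0^'] --> d -> is_derive x v f d.
Proof.
move=> cd; split; first by apply/cvg_ex; exists d.
exact: cvg_lim cd.
Qed.

Section continuous_partials.
Context {R : realType} {n : nat}.
Implicit Types (f : 'rV[R]_n -> R) (x v w : 'rV[R]_n).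

Lemma is_derive_line f x v (t d : R) : is_derive (t *: v + x) v f d ->
  is_derive t 1 (fun s => f (s *: v + x)) d.
Proof.
move=> [fd fE]; have E : (fun h : R => h^-1 *: ((fun s : R => f (s *: v + x)) (h *: 1 + t) -
    (fun s : R => f (s *: v + x)) t)) =
    (fun h : R => h^-1 *: (f (h *: v + (t *: v + x)) - f (t *: v + x))).
  by apply/funext => h /=; rewrite addrA -scalerDl [h *: 1]mulr1.
by split; rewrite /derivable /derive ?E.
Qed.

(** The segment is parametrised by [0, 1], so that one application of the mean value theorem covers
    both signs of s. *)
Lemma mean_value_partial f (i : 'I_n) x (s : R) :
  (forall y, derivable f y (delta_mx 0 i)) ->
  exists2 th : R, 0 <= th <= 1 &
    f (s *: delta_mx 0 i + x) - f x =
    s * partial i f ((th * s) *: delta_mx 0 i + x).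
Proof.
move=> df.
have d1 (t : R) : is_derive t 1 (fun s : R => f (s *: delta_mx 0 i + x))
    (partial i f (t *: delta_mx 0 i + x)).
  by apply: is_derive_line; exact: derivableP.
have d2 (t : R) : is_derive t 1 (fun t : R => f ((t * s) *: delta_mx 0 i + x))
    (s * partial i f ((t * s) *: delta_mx 0 i + x)).
  have ds : is_derive t 1 (fun t : R => t * s) s.
    have := @is_deriveM _ _ id (cst s) t 1 _ _ (is_derive_id _ _) (is_derive_cst _ _ _).
    by rewrite scaler0 add0r [_ *: _]mulr1.
  have := @is_derive1_comp _ (fun u : R => f (u *: delta_mx 0 i + x))
    (fun t => t * s) t _ _ (d1 _) ds.
  by rewrite mulrC.
pose F (t : R) := f ((t * s) *: delta_mx 0 i + x).
have cF : {within `[0, 1], continuous F}.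
  apply: continuous_subspaceT => t; apply: differentiable_continuous.
  by apply/derivable1_diffP; apply: ex_derive; exact: d2.
have [t0 t01] := MVT_segment ler01 (fun t _ => d2 t) cF.
rewrite /F !mul1r mul0r scale0r add0r subr0 mulr1 => E.
by exists t0 => //; move: t01; rewrite in_itv.
Qed.

(** [Ck] only provides derivatives along the axes, while integration along rays needs every
    direction. The increment is split one coordinate at a time: each new coordinate is handled by
    the mean value theorem, whose intermediate point tends to x, and continuity of the partial
    derivative gives the limit. *)
Lemma continuous_partials_is_derive f :
  (forall i y, derivable f y (delta_mx 0 i)) ->
  (forall i, continuous (partial i f)) ->
  forall x v, is_derive x v f (\sum_i v 0 i * partial i f x).
Proof.
move=> df cf x v; rewrite [X in is_derive _ X](row_sum_delta v).
elim: (index_enum _) => [|i s ih].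
  rewrite !big_nil; exact: is_derive0.
rewrite !big_cons.
move: ih; set w := \sum_(j <- s) _; set dw : R := \sum_(j <- s) _ => ih.
set a := v 0 i; apply: cvg_is_derive.
have /choice[th thE] : forall h : R, exists th : R, 0 <= th <= 1 /\
    f ((h * a) *: delta_mx 0 i + (h *: w + x)) - f (h *: w + x) =
    (h * a) * partial i f ((th * (h * a)) *: delta_mx 0 i + (h *: w + x)).
  move=> h; have [th t01 E] := @mean_value_partial f i (h *: w + x) (h * a) (df i).
  by exists th.
pose xi h := (th h * (h * a)) *: delta_mx 0 i + (h *: w + x).
have xi0 : xi h @[h --> (0 : R)^'] --> x.
  pose C := `|a| * `|delta_mx 0 i : 'rV[R]_n| + `|w| + 1.
  have C0 : 0 < C by rewrite ltr_wpDl// addr_ge0// mulr_ge0.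
  apply/cvgrPdist_le => /= e e0; near=> h.
  have he : `|h| <= e / C by near: h; apply: dnbhs0_le; rewrite divr_gt0.
  have [/andP[th0 th1] _] := thE h.
  rewrite /xi opprD opprD !addrA addrAC [_ - x]addrAC subrr add0r.
  rewrite (le_trans (ler_normB _ _))// normrN !normrZ ?normrM (ger0_norm th0).
  apply: (@le_trans _ _ (`|h| * C)); last by rewrite -ler_pdivlMr.
  have h1 : 0 <= 1 - th h by rewrite subr_ge0.
  have h2 : 0 <= `|h| * `|a| * `|delta_mx 0 i : 'rV[R]_n| by rewrite !mulr_ge0.
  have := mulr_ge0 h1 h2; have := normr_ge0 h.
  by rewrite /C; lra.
have cw : h^-1 *: (f (h *: w + x) - f x) @[h --> (0 : R)^'] --> (dw : R).
  by case: ih => [ed <-]; exact: ed.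
have : a * partial i f (xi h) + h^-1 *: (f (h *: w + x) - f x) @[h --> (0 : R)^'] -->
    a * partial i f x + dw.
  apply: cvgD => //; apply: cvgMr.
  exact: (cvg_comp _ _ xi0 (cf i x)).
apply: cvg_trans; apply: near_eq_cvg; near=> h.
have h0 : h != 0 by near: h; exact: nbhs_dnbhs_neq.
rewrite [h *: (_ + _)]scalerDr scalerA -addrA.
have [_ E] := thE h.
rewrite -[X in _ = _ *: X](subrKA (f (h *: w + x))) E -/(xi h) [in RHS]scalerDr; congr (_ + _).
by rewrite /GRing.scale/= -!mulrA mulKf.
Unshelve. all: by end_near. Qed.

End continuous_partials.

(** * Pointwise bound by the Riesz potential of the gradient *)

Section cone.
Context {R : realType} {n : nat}.
Local Open Scope ereal_scope.
Local Notation L := (@lebesgue_rV R).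
Local Notation leb := (@lebesgue_measure R).
Variables (G w : 'rV[R]_n -> R) (x : 'rV[R]_n).
Hypotheses (mG : measurable_fun setT G) (mw : measurable_fun setT w).
Hypotheses (G0 : forall y, (0 <= G y)%R) (w0 : forall y, (0 <= w y)%R).

Local Notation P := (`]0%R, +oo[%classic : set R).

(* Substitute y = t z + x, exchanging the two integrals before and after. *)
Lemma integral_cone :
  \int[L n]_z \int[leb]_(t in P) (G (t *: z + x)%R * w z)%:E =
  \int[L n]_y ((G y)%:E *
    \int[leb]_(t in P) (t `^ (- n%:R) * w (t `^ (- 1) *: (y - x)))%:E).
Proof.
have mP : measurable P by exact: measurable_itv.
have mt (b : R) : measurable_fun setT (fun t : measurableTypeR R => t `^ b)%R.
  exact: measurable_powR.
pose h1 (zt : 'rV[R]_n * measurableTypeR R) : \bar R :=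
  (G (zt.2 *: zt.1 + x)%R * w zt.1 * \1_P zt.2)%:E.
have mh1 : measurable_fun setT h1.
  apply/measurable_EFinP; apply: measurable_funM; [apply: measurable_funM|].
  - apply: (measurableT_comp mG).
    by apply: measurable_affine; [exact: measurable_snd|exact: measurable_fst].
  - by apply: (measurableT_comp mw); exact: measurable_fst.
  - by apply: (measurableT_comp (measurable_indic _)) => //; exact: measurable_snd.
have h10 zt : 0 <= h1 zt by rewrite lee_fin !mulr_ge0.
pose h2 (ty : measurableTypeR R * 'rV[R]_n) : \bar R :=
  (\1_P ty.1 * (ty.1 `^ (- n%:R) * w (ty.1 `^ (- 1) *: (ty.2 - x))) * G ty.2)%:E.
have mh2 : measurable_fun setT h2.
  apply/measurable_EFinP; apply: measurable_funM; [apply: measurable_funM|].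
  - by apply: (measurableT_comp (measurable_indic _)) => //; exact: measurable_fst.
  - apply: measurable_funM.
      by apply: (measurableT_comp (mt _)); exact: measurable_fst.
    apply: (measurableT_comp mw).
    rewrite (_ : (fun _ => _) = (fun ty : measurableTypeR R * 'rV[R]_n =>
      (ty.1 `^ (- 1) *: (1 *: ty.2 - x) + 0)%R)); last first.
      by apply/funext => ty; rewrite scale1r addr0.
    apply: measurable_affine; first by apply: (measurableT_comp (mt _)); exact: measurable_fst.
    by apply: measurable_affine; [exact: measurable_cst|exact: measurable_snd].
  - by apply: (measurableT_comp mG); exact: measurable_snd.
have h20 ty : 0 <= h2 ty by rewrite lee_fin !mulr_ge0// powR_ge0.
transitivity (\int[L n]_z \int[leb]_t h1 (z, t)).
  apply: eq_integral => z _; rewrite integral_mkcond; apply: eq_integral => t _.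
  by rewrite patchE /h1/= indicE; case: ifPn; rewrite ?mulr1 ?mulr0.
rewrite (fubini_tonelli h1)//.
transitivity (\int[leb]_t \int[L n]_y h2 (t, y)).
  apply: eq_integral => t _; have [tP|tP] := boolP (t \in P); last first.
    rewrite !integral0_eq// => y _; first by rewrite /h2/= indicE (negbTE tP) !mul0r.
    by rewrite /h1/= indicE (negbTE tP) mulr0.
  have t0 : (0 < t)%R by move: tP; rewrite inE/= in_itv/= andbT.
  pose F y : \bar R := (w (t `^ (- 1) *: (y - x)) * G y)%:E.
  have mF : measurable_fun setT F.
    apply/measurable_EFinP; apply: measurable_funM => //.
    apply: (measurableT_comp mw).
    rewrite (_ : (fun _ => _) = (fun y : 'rV[R]_n =>
      (t `^ (- 1) *: (1 *: y - x) + 0)%R)); last first.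
      by apply/funext => y; rewrite scale1r addr0.
    apply: measurable_affine => //.
    by apply: measurable_affine; [exact: measurable_cst|exact: measurable_id].
  have F0 y : 0 <= F y by rewrite lee_fin mulr_ge0.
  transitivity (\int[L n]_z F (t *: z + x)%R).
    apply: eq_integral => z _; rewrite /h1 /F/= indicE tP mulr1 addrK scalerA.
    by rewrite powR_inv1 ?(ltW t0)// mulVf ?gt_eqF// scale1r mulrC.
  rewrite ge0_integral_rV_affine// -ge0_integralZl_EFin//; last first.
    by rewrite invr_ge0 exprn_ge0// ltW.
  apply: eq_integral => y _; rewrite /h2 /F/= indicE tP mul1r -EFinM mulrA.
  by rewrite powR_invn// ltW.
rewrite (fubini_tonelli h2)//; apply: eq_integral => y _.
rewrite -ge0_integralZl_EFin//.
- rewrite [RHS]integral_mkcond; apply: eq_integral => t _.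
  rewrite patchE /h2/= indicE; case: ifPn => _; last by rewrite !mul0r.
  by rewrite mul1r mulrC -EFinM.
- by move=> t _; rewrite lee_fin mulr_ge0// powR_ge0.
- apply/measurable_EFinP; apply: measurable_funTS; apply: measurable_funM; first exact: mt.
  apply: (measurableT_comp mw).
  rewrite (_ : (fun _ => _) = (fun t : measurableTypeR R =>
    (t `^ (- 1) *: (y - x) + 0)%R)); last by apply/funext => t; rewrite addr0.
  by apply: measurable_affine; [exact: mt|exact: measurable_cst].
Qed.

End cone.

Section representation.
Context {R : realType} {n : nat}.
Local Notation L := (@lebesgue_rV R).
Local Notation leb := (@lebesgue_measure R).
Variable f : 'rV[R]_n -> R.
Hypothesis df : forall i y, derivable f y (delta_mx 0 i).
Hypothesis cf : forall i, continuous (partial i f).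

Lemma measurable_enorm_gradient : measurable_fun setT (fun y => enorm (gradient f y)).
Proof.
apply: (measurableT_comp (continuous_measurable_fun (@sqrt_continuous R))).
under eq_fun do under eq_bigr do rewrite mxE.
apply: measurable_sum => i; apply: measurable_funX.
exact: continuous_measurable_rV.
Qed.

Let D (z x : 'rV[R]_n) (t : R) : R := \sum_i z 0 i * partial i f (t *: z + x).

Let D_continuous z x : continuous (D z x).
Proof.
apply: continuous_big => [|i _ t]; last apply: cvgMr.
  by move=> x1; exact: add_continuous.
apply: (@continuous_comp _ _ _ (fun t : R => t *: z + x) (partial i f)); last exact: cf.
apply: cvgD; last exact: cvg_cst.
exact: scalel_continuous.
Qed.

(** Far out on the ray f vanishes, so -f(x) is the integral of the derivative of t |-> f(t z + x),
    which Cauchy-Schwarz bounds. *)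
Lemma norm_le_integral_ray x z M : (forall y, M <= enorm y -> f y = 0) -> z != 0 ->
  (`|f x|%:E <=
    \int[leb]_(t in `]0%R, +oo[) (enorm (gradient f (t *: z + x)) * enorm z)%:E)%E.
Proof.
move=> fM z0; have ez0 : 0 < enorm z by rewrite enorm_gt0.
(* Chosen so that |T z| = |M| + |x| + |z|, which puts T z + x outside the ball of radius |M|. *)
pose T := (`|M| + enorm x) / enorm z + 1.
have T0 : 0 < T by rewrite ltr_wpDl// divr_ge0 ?addr_ge0 ?enorm_ge0.
have fT : f (T *: z + x) = 0.
  apply: fM; rewrite (le_trans (ler_norm M))//.
  have : enorm (T *: z) <= enorm (T *: z + x) + enorm x.
    by rewrite -{1}(addrK x (T *: z)) (le_trans (ler_enormD _ _))// enormN.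
  rewrite -lerBlDr; apply: le_trans; rewrite enormZ (gtr0_norm T0).
  by rewrite lerBrDr /T mulrDl mul1r divfK ?gt_eqF// lerDl ltW.
have dF (t : R) : is_derive t 1 (fun s : R => f (s *: z + x)) (D z x t).
  exact/is_derive_line/continuous_partials_is_derive.
have cF : continuous (fun s : R => f (s *: z + x)).
  by move=> t; apply/differentiable_continuous/derivable1_diffP; apply: ex_derive; exact: dF.
have mD (A : set R) : measurable_fun A (EFin \o D z x).
  by apply/measurable_EFinP; apply: measurable_funTS;
    apply: continuous_measurable_fun; exact: D_continuous.
have mg (A : set R) : measurable_fun A
    (fun t => (enorm (gradient f (t *: z + x)) * enorm z)%:E).
  apply/measurable_EFinP; apply: measurable_funTS; apply: measurable_funM => //.
  apply: (measurableT_comp measurable_enorm_gradient).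
  by apply: (@measurable_affine R n _ (measurableTypeR R) id (cst z) x).
have : (\int[leb]_(t in `[0%R, T]) (D z x t)%:E = - (f x)%:E)%E.
  rewrite (@continuous_FTC2 _ _ (fun s : R => f (s *: z + x)))//.
  - by rewrite fT scale0r !add0r.
  - exact: continuous_subspaceT.
  - split.
    + by move=> t _; apply: ex_derive; exact: dF.
    + by apply: cvg_at_right_filter; exact: cF.
    + by apply: cvg_at_left_filter; exact: cF.
  - by move=> t _; rewrite derive1E; apply: derive_val; exact: dF.
move=> /(congr1 abse); rewrite abseN /= => <-.
apply: le_trans (le_abse_integral _ _ _) _ => //; first exact: mD.
rewrite integral_itv_obnd_cbnd//.
apply: (@le_trans _ _ (\int[leb]_(t in `[0%R, T])
    (enorm (gradient f (t *: z + x)) * enorm z)%:E)%E).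
  apply: ge0_le_integral => //.
  - by apply: measurableT_comp => //; exact: mD.
  - exact: mg.
  - move=> t _; rewrite lee_fin mulrC (le_trans _ (ler_sum_enormM _ _))//.
    by under [in X in _ <= X]eq_bigr do rewrite mxE.
apply: ge0_subset_integral => //.
- exact: mg.
- by move=> t _; rewrite lee_fin mulr_ge0// enorm_ge0.
- by move=> t; rewrite /= !in_itv/= => /andP[->].
Qed.

(* Average |f x| <= \int_0^oo |grad f (t z + x)| |z| dt over z in the unit ball. *)
Lemma norm_le_riesz_potential x M : (forall y, M <= enorm y -> f y = 0) -> (1 < n)%N ->
  ((n%:R * unit_ball_volume n * `|f x|)%:E <=
    \int[L n]_y (enorm (gradient f y) * enorm (y - x) `^ (1 - n%:R))%:E)%E.
Proof.
move=> fM n1; have n0 : (0 < n)%N by exact: ltnW.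
set V := unit_ball_volume n; have V0 : 0 < V := unit_ball_volume_gt0 n.
(* The ray estimate needs a nonzero direction; removing 0 does not change the volume V. *)
pose B : set 'rV[R]_n := eball 0 1 `\ 0.
have mB : measurable B.
  by apply: measurableD; [exact: measurable_eball|exact: measurable_rV_set1].
pose w z := enorm z * \1_B z.
have w0 z : 0 <= w z by rewrite mulr_ge0 ?enorm_ge0.
have mw : measurable_fun setT w by apply: measurable_funM => //; exact: measurable_enorm.
have mG := measurable_enorm_gradient.
have G0 y : 0 <= enorm (gradient f y) := enorm_ge0 _.
have : ((V * `|f x|)%:E <= \int[L n]_z \int[leb]_(t in `]0%R, +oo[)
    (enorm (gradient f (t *: z + x)) * w z)%:E)%E.
  have -> : (V * `|f x|)%:E = (\int[L n]_(z in B) `|f x|%:E)%E.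
    transitivity (`|f x|%:E * L n B)%E; last by rewrite integral_cst.
    rewrite lebesgue_rV_setD1//; last exact: measurable_eball.
    by rewrite lebesgue_eball// expr1n mul1r mulrC.
  rewrite integral_mkcond; apply: ge0_le_integral => //.
  - by move=> z _; rewrite patchE; case: ifPn.
  - by apply/(measurable_restrictT _ _).1.
  - have mh : measurable_fun setT (fun zt : 'rV[R]_n * measurableTypeR R =>
        (enorm (gradient f (zt.2 *: zt.1 + x)) * w zt.1 *
          \1_(`]0%R, +oo[%classic : set R) zt.2)%:E).
      apply/measurable_EFinP; apply: measurable_funM; [apply: measurable_funM|].
      + apply: (measurableT_comp mG).
        by apply: measurable_affine; [exact: measurable_snd|exact: measurable_fst].
      + by apply: (measurableT_comp mw); exact: measurable_fst.
      + by apply: (measurableT_comp (measurable_indic _)) => //; exact: measurable_snd.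
    have H := @measurable_fun_fubini_tonelli_F _ _ _ _ _ leb _ mh.
    have /H : forall zt : 'rV[R]_n * measurableTypeR R, (0 <=
        (enorm (gradient f (zt.2 *: zt.1 + x)) * w zt.1 *
          \1_(`]0%R, +oo[%classic : set R) zt.2)%:E)%E.
      by move=> zt; rewrite lee_fin !mulr_ge0 ?enorm_ge0.
    apply: eq_measurable_fun => z _.
    rewrite /fubini_F/= [RHS]integral_mkcond; apply: eq_integral => t _.
    by rewrite patchE indicE; case: ifPn; rewrite ?mulr1 ?mulr0.
  - move=> z _; rewrite patchE; case: ifPn => zB; last first.
      by apply: integral_ge0 => t _; rewrite lee_fin mulr_ge0.
    rewrite /w indicE zB mulr1; apply: norm_le_integral_ray fM _.
    by case: (set_mem zB) => _ /eqP.
rewrite (integral_cone x mG mw G0 w0) => h.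
have n0R : 0 < n%:R :> R by rewrite ltr0n.
rewrite -mulrA EFinM -lee_pdivlMl// (le_trans h)//.
rewrite -ge0_integralZl_EFin//; last 2 first.
- by move=> y _; rewrite lee_fin mulr_ge0// powR_ge0.
- apply/measurable_EFinP; apply: measurable_funM => //.
  apply: (measurableT_comp (measurable_powR _)); exact: measurable_enorm_sub.
rewrite le_eqVlt; apply/orP; left; apply/eqP; apply: eq_integral => y _.
rewrite EFinM muleCA; congr (_ * _)%E.
(* At y = x both sides are 0: the power with nonzero exponent 1 - n vanishes at 0 by default, and so
   does [w]. *)
have [->|yx] := eqVneq y x.
  have n1' : (1 - n%:R : R) != 0 by rewrite subr_eq0 eq_sym pnatr_eq1 gtn_eqF.
  rewrite subrr enorm0 powR0// -EFinM mulr0 integral0_eq// => t _.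
  by rewrite scaler0 /w enorm0 mul0r mulr0.
have e0 : 0 < enorm (y - x) by rewrite enorm_gt0 subr_eq0.
(* The weight w((y - x) / t) is |y - x| / t if t > |y - x| and 0 otherwise, so the inner integral is
   |y - x|^(1 - n) / n. *)
transitivity (\int[leb]_(t in `]enorm (y - x), +oo[)
    ((enorm (y - x))%:E * (t `^ (- n%:R - 1))%:E))%E.
  rewrite integral_mkcond [RHS]integral_mkcond; apply: eq_integral => t _.
  rewrite !patchE !mem_setE !in_itv/= !andbT.
  have [t0|t0] := ltP 0 t; last by rewrite ltNge (le_trans t0)// ltW.
  have tE : t `^ (- 1) = t^-1 by rewrite powR_inv1// ltW.
  rewrite /w indicE /B enormZ tE ger0_norm ?invr_ge0 1?ltW//.
  have -> : (t^-1 *: (y - x) \in eball 0 1 `\ 0) = (enorm (y - x) < t).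
    apply/idP/idP => [/set_mem[]|h1].
      by rewrite /eball/= subr0 enormZ ger0_norm ?invr_ge0 1?ltW// ltr_pdivrMl// mulr1.
    apply/mem_set; split.
      by rewrite /eball/= subr0 enormZ ger0_norm ?invr_ge0 1?ltW// ltr_pdivrMl// mulr1.
    by move=> /eqP; rewrite scaler_eq0 invr_eq0 gt_eqF//= subr_eq0; exact/negP.
  case: ifPn => _; last by rewrite !mulr0.
  rewrite mulr1 -EFinM; congr EFin.
  rewrite powRD; last by rewrite (gt_eqF t0) implybT.
  by rewrite tE; ring.
rewrite ge0_integralZl_EFin ?enorm_ge0//; last 2 first.
- by move=> t _; rewrite lee_fin powR_ge0.
- by apply/measurable_EFinP; apply: measurable_funTS; exact: measurable_powR.
rewrite integral_powR_tail// -!EFinM; congr EFin.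
rewrite powRD; last by rewrite (gt_eqF e0) implybT.
by rewrite powRr1 1?ltW//; ring.
Qed.

End representation.

(** * Morrey's inequality with the sharp constant *)

Section compactly_supported.
Context {R : realType} {n : nat}.
Variable Omega : set 'rV[R]_n.
Implicit Types (f phi : 'rV[R]_n -> R).

(** What the estimates use of a test function, in a form visibly stable under differences. Vanishing
    off Omega is required of the partial derivatives as well, so that integrals over the space
    reduce to integrals over Omega. *)
Definition C1_supported f :=
  [/\ forall i y, derivable f y (delta_mx 0 i), forall i, continuous (partial i f),
      exists M, forall y, M <= enorm y -> f y = 0,
      forall y, ~ Omega y -> f y = 0 /\ forall i, partial i f y = 0 &
      continuous f].

Lemma partial_near0 f i y : (\forall z \near y, f z = 0) -> partial i f y = 0.
Proof.
move=> f0; by rewrite /partial (near_eq_derive _ (g := cst 0)) ?derive_cst.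
Qed.

Lemma test_function_C1_supported phi : test_function Omega phi -> C1_supported phi.
Proof.
move=> [sphi cphi phiO]; have [cont1 C1] := sphi 1%N.
have phi0 y : ~ closure [set x | phi x != 0] y -> phi y = 0.
  by move=> ny; apply/eqP/negPn/negP => yn0; apply: ny; apply: subset_closure.
have [M M0 phiM] := bounded_setP_enorm 0 (compact_bounded cphi).
split.
- by move=> i y; have [] := C1 i.
- by move=> i; have [_ []] := C1 i.
- exists M => y My; apply: phi0 => /phiM; rewrite /eball/= subr0.
  by rewrite ltNge My.
- move=> y nOy; have ny : ~ closure [set x | phi x != 0] y by move=> /phiO.
  split; first exact: phi0.
  move=> i; apply: partial_near0.
  have : open_nbhs y (~` closure [set x | phi x != 0]).
    by split => //; apply: closed_openC; exact: closed_closure.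
  move=> /open_nbhs_nbhs; apply: filterS => z; exact: phi0.
- exact: cont1.
Qed.

Lemma partialB f phi i y : derivable f y (delta_mx 0 i) ->
  derivable phi y (delta_mx 0 i) ->
  partial i (f - phi) y = partial i f y - partial i phi y.
Proof. exact: deriveB. Qed.

Lemma C1_supportedB f phi : C1_supported f -> C1_supported phi ->
  C1_supported (f - phi).
Proof.
move=> [df cf [M fM] fO f0] [dphi cphi [M' phiM] phiO phi0].
have pB i : partial i (f - phi) = partial i f - partial i phi.
  by apply/funext => y; exact: partialB.
split.
- by move=> i y; exact: derivableB.
- move=> i; by rewrite pB => y; exact: (continuousB (cf i y) (cphi i y)).
- exists (Num.max M M') => y; rewrite ge_max => /andP[My M'y].
  by rewrite [LHS](_ : _ = f y - phi y)// fM// phiM// subrr.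
- move=> y Oy; have [fy0 pf0] := fO y Oy; have [phiy0 pphi0] := phiO y Oy.
  split=> [|i]; first by rewrite [LHS](_ : _ = f y - phi y)// fy0 phiy0 subrr.
  by rewrite pB [LHS](_ : _ = partial i f y - partial i phi y)// pf0 pphi0 subrr.
- by move=> y; exact: (continuousB (f0 y) (phi0 y)).
Qed.

Lemma gradientB f phi y : C1_supported f -> C1_supported phi ->
  gradient (f - phi) y = gradient f y - gradient phi y.
Proof.
move=> [df _ _ _ _] [dphi _ _ _ _]; apply/rowP => i; rewrite !mxE.
exact: partialB.
Qed.

Lemma gradient_out f y : C1_supported f -> ~ Omega y -> gradient f y = 0.
Proof. by move=> [_ _ _ fO _] /fO[_ f0]; apply/rowP => i; rewrite !mxE. Qed.

End compactly_supported.

(** With volume r^N V, the volume factor contributes r^(N - p), which cancels (r^a)^(p-1) = r^(p -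
    N); the powers of a cancel, and V^(p/N) V^(1 - p/N) = V supplies the missing factor of (N
    V)^p. *)
Lemma sharp_constant_algebra {R : realType} (N p V r a : R) : 0 < N -> 1 < p ->
  0 < V -> 0 < r -> 0 < a -> a * (p - 1) = p - N ->
  N * V `^ (p / N) * a `^ (p - 1) * (r `^ N * V) `^ (1 - p / N) *
    (N * V * r `^ a / a) `^ (p - 1) = (N * V) `^ p.
Proof.
move=> N0 p1 V0 r0 a0 aE; have p0 : 0 < p := lt_trans ltr01 p1.
have NV0 : 0 <= N * V by rewrite mulr_ge0// ltW.
rewrite (powRM _ (powR_ge0 _ _) (ltW V0)).
have -> : (r `^ N) `^ (1 - p / N) = (r `^ (p - N))^-1.
  by rewrite -powRrM -powRN; congr (_ `^ _); field; rewrite gt_eqF.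
have -> : (N * V * r `^ a / a) `^ (p - 1) =
    (N * V) `^ (p - 1) * r `^ (p - N) * (a `^ (p - 1))^-1.
  have ai : 0 <= a^-1 by rewrite invr_ge0 ltW.
  rewrite (powRM _ (mulr_ge0 NV0 (powR_ge0 _ _)) ai) (powRM _ NV0 (powR_ge0 _ _)).
  rewrite -[(r `^ a) `^ _]powRrM aE; congr (_ * _).
  by rewrite -(powR_inv1 (ltW a0)) -powRrM mulN1r powRN.
rewrite -(mulr_powRB1 NV0 p0).
have VE : V `^ (p / N) * V `^ (1 - p / N) = V.
  by rewrite -powRD ?subrKC ?(powRr1 (ltW V0))// (gt_eqF V0) implybT.
set x := (N * V) `^ (p - 1).
rewrite -[in RHS]VE.
have r1 : r `^ (p - N) != 0 by rewrite gt_eqF// powR_gt0.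
have a1 : a `^ (p - 1) != 0 by rewrite gt_eqF// powR_gt0.
by field; rewrite r1 a1.
Qed.

Section morrey.
Context {R : realType} {n : nat}.
Variables (Omega : set 'rV[R]_n) (p : R).
Local Notation L := (@lebesgue_rV R n).
Hypotheses (n2 : (2 <= n)%N) (pn : n%:R < p).
Hypotheses (oO : open Omega) (bO : bounded_set Omega) (O0 : Omega !=set0).

(** The conjugate exponent of p is p / (p - 1), and the corresponding power of |y - x|^(1 - n) is
    the Riesz kernel with this exponent. *)
Definition kernel_exponent : R := (n%:R - 1) * (p / (p - 1)).
Local Notation g := kernel_exponent.

Let n1 : 1 < n%:R :> R. Proof. by rewrite ltr1n. Qed.
Let p1 : 1 < p. Proof. exact: lt_trans pn. Qed.
Let p10 : 0 < p - 1. Proof. by rewrite subr_gt0. Qed.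
Let p0 : 0 < p. Proof. exact: lt_trans p1. Qed.

Lemma kernel_exponent_gt0 : 0 < g.
Proof. by rewrite mulr_gt0 ?subr_gt0// divr_gt0. Qed.

Lemma dim_sub_kernel_exponent : n%:R - g = (p - n%:R) / (p - 1).
Proof. by rewrite /g; field; rewrite gt_eqF. Qed.

(** This is where p > n makes the kernel integrable. *)
Lemma kernel_exponent_lt : g < n%:R.
Proof. by rewrite -subr_gt0 dim_sub_kernel_exponent divr_gt0// subr_gt0. Qed.

Let mO : measurable Omega. Proof. exact: open_measurable_rV. Qed.

Let LO_fin : L Omega \is a fin_num.
Proof. by rewrite ge0_fin_numE ?measure_ge0//; exact: lebesgue_bounded_lty. Qed.

Let vol := fine (L Omega).
Let V : R := unit_ball_volume n.
Let V0 : 0 < V. Proof. exact: unit_ball_volume_gt0. Qed.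

Let vol0 : 0 < vol.
Proof. by apply: fine_gt0; rewrite lebesgue_open_gt0//= lebesgue_bounded_lty. Qed.

Definition equal_volume_radius : R := (vol / V) `^ (n%:R^-1).
Local Notation rO := equal_volume_radius.

Lemma equal_volume_radius_gt0 : 0 < rO.
Proof. by rewrite powR_gt0// divr_gt0. Qed.

Let n0 : 0 < n%:R :> R. Proof. exact: lt_trans n1. Qed.

Let rON : rO `^ n%:R * V = vol.
Proof.
rewrite /rO -powRrM mulVf ?gt_eqF// powRr1; last by rewrite divr_ge0// ltW.
by rewrite divfK// gt_eqF.
Qed.

Let rOn : rO ^+ n * V = vol.
Proof. by rewrite -rON powR_mulrn// ltW// equal_volume_radius_gt0. Qed.

Lemma lebesgue_eball_equal_volume x : L Omega = L (eball x rO).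
Proof. by rewrite lebesgue_eball ?equal_volume_radius_gt0// rOn fineK. Qed.

(** Integral of the kernel, centred at x, over the ball about x with the volume of Omega: by the
    bathtub principle, an upper bound for [potential] at every point. *)
Definition ball_potential : R := n%:R * V * rO `^ (n%:R - g) / (n%:R - g).

Lemma ball_potential_gt0 : 0 < ball_potential.
Proof.
rewrite divr_gt0 ?subr_gt0 ?kernel_exponent_lt// !mulr_gt0 ?ltr0n ?(ltnW n2)//.
by rewrite powR_gt0 ?equal_volume_radius_gt0.
Qed.

Definition potential (x : 'rV[R]_n) : R :=
  fine (\int[L]_(y in Omega) (riesz_kernel g x y)%:E)%E.

Let int_potential_le x :
  (\int[L]_(y in Omega) (riesz_kernel g x y)%:E <= ball_potential%:E)%E.
Proof.
exact: (integral_riesz_kernel_le kernel_exponent_gt0 kernel_exponent_lt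
  equal_volume_radius_gt0 mO (lebesgue_eball_equal_volume x)).
Qed.

Let int_potential_ge0 x : (0 <= \int[L]_(y in Omega) (riesz_kernel g x y)%:E)%E.
Proof. by apply: integral_ge0 => y _; rewrite lee_fin riesz_kernel_ge0. Qed.

Lemma potentialE x :
  (\int[L]_(y in Omega) (riesz_kernel g x y)%:E)%E = (potential x)%:E.
Proof.
by rewrite fineK// ge0_fin_numE//; apply: le_lt_trans (int_potential_le x) (ltry _).
Qed.

Lemma potential_ge0 x : 0 <= potential x.
Proof. by rewrite -lee_fin -potentialE. Qed.

Lemma potential_le x : potential x <= ball_potential.
Proof. by rewrite -lee_fin -potentialE. Qed.

Lemma potential_eq x : ball_potential <= potential x -> L (eball x rO `\` Omega) = 0%E.
Proof.
rewrite -lee_fin -potentialE => h.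
exact: (integral_riesz_kernel_eq kernel_exponent_gt0 kernel_exponent_lt
  equal_volume_radius_gt0 mO (lebesgue_eball_equal_volume x) h).
Qed.

(** Explains the constant of the theorem: it is (n V)^p divided by the power p - 1 of
    [ball_potential]. *)
Lemma sharp_constantE :
  n%:R * omega n `^ (p / n%:R) * ((p - n%:R) / (p - 1)) `^ (p - 1) *
    vol `^ (1 - p / n%:R) * ball_potential `^ (p - 1) = (n%:R * V) `^ p.
Proof.
rewrite omegaE -/V -rON /ball_potential -dim_sub_kernel_exponent.
apply: sharp_constant_algebra => //.
- exact: equal_volume_radius_gt0.
- by rewrite subr_gt0 kernel_exponent_lt.
- by rewrite dim_sub_kernel_exponent divfK// gt_eqF.
Qed.

Local Notation q := (p / (p - 1)).

(** Hoelder applied to the Riesz potential of the gradient; as the gradient vanishes off Omega, both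
    factors may be restricted to Omega. The potential is kept at x instead of being replaced by its
    upper bound, for the sake of the equality case. *)
Lemma morrey f x : C1_supported Omega f ->
  ((n%:R * V * `|f x|)%:E <=
    Lp_norm Omega p%:E (fun y => enorm (gradient f y)) *
    (potential x `^ q^-1)%:E)%E.
Proof.
move=> C1f; have [df cf [M fM] fO _] := C1f.
have q0 : 0 < q by rewrite divr_gt0.
apply: le_trans (norm_le_riesz_potential df cf x fM n2) _.
pose G := (fun y => enorm (gradient f y)) \_ Omega.
pose k := (fun y => enorm (y - x) `^ (1 - n%:R)) \_ Omega.
have mG : measurable_fun setT G.
  apply/(measurable_restrictT _ mO); apply: measurable_funTS.
  exact: measurable_enorm_gradient.
have mk : measurable_fun setT k.
  apply/(measurable_restrictT _ mO); apply: measurable_funTS.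
  apply: (measurableT_comp (measurable_powR _)); exact: measurable_enorm_sub.
have := @hoelder _ _ _ L G k p q mG mk p0 q0.
rewrite Lnorm1.
have -> : (\int[L]_y `|((EFin \o (G \* k)%R) y)| =
    \int[L]_y (enorm (gradient f y) * enorm (y - x) `^ (1 - n%:R))%:E)%E.
  apply: eq_integral => y _ /=; rewrite /G /k !patchE; case: ifPn => [yO|yO].
    by rewrite ger0_norm// mulr_ge0 ?enorm_ge0 ?powR_ge0.
  rewrite mulr0 normr0 (gradient_out C1f) ?enorm0 ?mul0r//.
  by move=> /mem_set; exact/negP.
move=> /(_ _)/le_trans; apply; first by rewrite invf_div; field; rewrite gt_eqF.
rewrite le_eqVlt; apply/orP; left; apply/eqP; congr (_ * _)%E.
rewrite unlock -poweR_EFin -potentialE; congr (_ `^ _)%E.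
rewrite [RHS]integral_mkcond; apply: eq_integral => y _ /=.
rewrite /k patchE [RHS]patchE; case: ifPn => _.
  rewrite ger0_norm ?powR_ge0// -powRrM /riesz_kernel; congr (_ `^ _)%:E.
  by rewrite /kernel_exponent; ring.
(* Off Omega a restricted function takes the default point of R, which is 0. *)
have -> : (point : R) = 0 by [].
by rewrite normr0 powR0// gt_eqF.
Qed.

End morrey.

(** * Uniform limits of test functions *)

Section uniform_limit.
Context {R : realType} {T : Type}.
Variable F : nat -> T -> R.

Lemma uniform_cauchy_limit :
  (forall e : R, 0 < e -> exists K, forall j k x, (K <= j)%N -> (K <= k)%N ->
    `|F j x - F k x| <= e) ->
  exists u : T -> R, forall e : R, 0 < e -> exists K, forall k x, (K <= k)%N ->
    `|F k x - u x| <= e.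
Proof.
move=> cF.
have cvgF x : cvg (F k x @[k --> \oo]).
  apply: cauchy_cvg; apply: cauchy_exP => e e0.
  have e20 : 0 < e / 2 by rewrite divr_gt0.
  have [K FK] := cF _ e20; exists (F K x); exists K => // k /= Kk.
  by rewrite /ball/= (le_lt_trans (FK _ _ _ _ _))// ltr_pdivrMr// ltr_pMr// ltr1n.
exists (fun x => lim (F k x @[k --> \oo])) => e e0.
have [K FK] := cF _ e0; exists K => k x Kk.
have h : `|F k x - F j x| @[j --> \oo] --> `|F k x - lim (F j x @[j --> \oo])|.
  by apply: cvg_norm; apply: cvgB; [exact: cvg_cst|exact: cvgF].
apply: (cvgr_to_le h); exists K => // j /= Kj; exact: FK.
Qed.

End uniform_limit.

Lemma uniform_limit_continuous_at {R : realType} {T : topologicalType}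
    (F : nat -> T -> R) (u : T -> R) :
  (forall k, continuous (F k)) ->
  (forall e : R, 0 < e -> exists K, forall k x, (K <= k)%N -> `|F k x - u x| <= e) ->
  continuous u.
Proof.
move=> cF Fu x; apply/(@cvgrPdist_le _ _ _ (nbhs x)) => e e0.
have e30 : 0 < e / 3 by rewrite divr_gt0.
have [K FK] := Fu _ e30.
have /(@cvgrPdist_le _ _ _ (nbhs x))/(_ _ e30) := cF K x.
apply: filterS => y h /=.
have := FK K x (leqnn K); have := FK K y (leqnn K).
rewrite -[u x - u y](subrKA (F K x)) => h1 h2.
rewrite (le_trans (ler_normD _ _))// -[F K x - u y](subrKA (F K y)).
rewrite (le_trans (lerD (lexx _) (ler_normD _ _)))//.
rewrite distrC; lra.
Qed.

(** * Norms of functions restricted to Omega *)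

Section Lp_norm_lemmas.
Context {R : realType} {n : nat}.
Variables (Omega : set 'rV[R]_n) (p : R).
Local Notation L := (@lebesgue_rV R n).
Hypotheses (mO : measurable Omega) (p1 : 1 <= p).
Implicit Types f h k : 'rV[R]_n -> R.

Let p0 : 0 < p. Proof. exact: lt_le_trans p1. Qed.

Lemma le_Lp_norm f h : measurable_fun setT (f \_ Omega) ->
  measurable_fun setT (h \_ Omega) ->
  (forall x, Omega x -> `|f x| <= `|h x|) ->
  (Lp_norm Omega p%:E f <= Lp_norm Omega p%:E h)%E.
Proof.
move=> mf mh fh; rewrite /Lp_norm unlock.
have i0 k : (0 <= \int[L]_x (`|(EFin \o k) x| `^ p))%E.
  by apply: integral_ge0 => x _; exact: poweR_ge0.
apply: gt0_ler_poweR; rewrite ?in_itv/= ?leey ?i0 ?invr_ge0 ?(ltW p0)//.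
apply: ge0_le_integral => //=.
- by apply/measurable_EFinP; apply: (measurableT_comp (measurable_powR p)); exact: measurableT_comp.
- by apply/measurable_EFinP; apply: (measurableT_comp (measurable_powR p)); exact: measurableT_comp.
- move=> x _; rewrite lee_fin !patchE; case: ifPn => [/set_mem xO|//].
  by apply: (ge0_ler_powR (ltW p0)); rewrite ?nnegrE// fh.
Qed.

Lemma Lp_norm_le_add f h k : measurable_fun setT (f \_ Omega) ->
  measurable_fun setT (h \_ Omega) -> measurable_fun setT (k \_ Omega) ->
  (forall x, Omega x -> `|f x| <= h x + k x) ->
  (Lp_norm Omega p%:E f <= Lp_norm Omega p%:E h + Lp_norm Omega p%:E k)%E.
Proof.
move=> mf mh mk fhk.
have E : (fun x => h x + k x) \_ Omega = (h \_ Omega) \+ (k \_ Omega).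
  by apply/funext => x; rewrite /= !patchE; case: ifPn => // _; rewrite addr0.
apply: (@le_trans _ _ (Lp_norm Omega p%:E (fun x => h x + k x))).
  apply: le_Lp_norm => //; first by rewrite E; exact: measurable_funD.
  by move=> x xO; rewrite (le_trans (fhk x xO))// ler_norm.
by rewrite /Lp_norm E; exact: minkowski_EFin.
Qed.

Lemma Lp_norm_cst (c : R) : 0 <= c ->
  Lp_norm Omega p%:E (cst c) = (c%:E * L Omega `^ p^-1)%E.
Proof.
move=> c0; rewrite /Lp_norm unlock.
transitivity ((\int[L]_(x in Omega) (c `^ p)%:E) `^ p^-1)%E.
  congr (_ `^ _)%E; rewrite [RHS]integral_mkcond; apply: eq_integral => x _ /=.
  rewrite !patchE; case: ifPn => _; first by rewrite ger0_norm.
  have -> : (point : R) = 0 by [].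
  by rewrite normr0 powR0// gt_eqF.
rewrite integral_cst// poweRM ?lee_fin ?powR_ge0// poweR_EFin.
by rewrite -powRrM mulfV ?gt_eqF// powRr1.
Qed.

Lemma measurable_enorm_restrict (h : 'rV[R]_n -> 'rV[R]_n) :
  (forall i, measurable_fun setT ((fun x => h x 0 i) \_ Omega)) ->
  measurable_fun setT ((fun x => enorm (h x)) \_ Omega).
Proof.
move=> mh; rewrite (_ : _ \_ _ =
    fun x => Num.sqrt (\sum_i (((fun x => h x 0 i) \_ Omega) x) ^+ 2)).
  apply: (measurableT_comp (continuous_measurable_fun (@sqrt_continuous R))).
  by apply: measurable_sum => i; exact: measurable_funX.
apply/funext => x; rewrite patchE; case: ifPn => xO.
  by congr Num.sqrt; apply: eq_bigr => i _; rewrite patchE xO.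
rewrite big1 ?sqrtr0// => i _; rewrite patchE (negbTE xO).
have -> : (point : R) = 0 by [].
by rewrite expr0n.
Qed.

Lemma Lp_measurable f : Lp Omega p f -> measurable_fun setT (f \_ Omega).
Proof. by move=> /andP[/set_mem]. Qed.

Lemma measurable_restrictB f h : measurable_fun setT (f \_ Omega) ->
  measurable_fun setT (h \_ Omega) -> measurable_fun setT ((fun x => f x - h x) \_ Omega).
Proof.
move=> mf mh; rewrite (_ : _ \_ _ = (f \_ Omega) \- (h \_ Omega)).
  exact: measurable_funB.
by apply/funext => x; rewrite /= !patchE; case: ifPn => // _; rewrite subr0.
Qed.

Lemma continuous_measurable_restrict f : continuous f -> measurable_fun setT (f \_ Omega).
Proof.
move=> cf; apply/(measurable_restrictT _ mO); apply: measurable_funTS.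
exact: continuous_measurable_rV.
Qed.

End Lp_norm_lemmas.

(** * Passage to the limit in the pointwise bound *)

Section representative.
Context {R : realType} {n : nat}.
Variables (Omega : set 'rV[R]_n) (p : R).
Local Notation L := (@lebesgue_rV R n).
Local Notation V := (@unit_ball_volume R n).
Local Notation q := (p / (p - 1)).
Hypotheses (n2 : (2 <= n)%N) (pn : n%:R < p).
Hypotheses (oO : open Omega) (bO : bounded_set Omega) (O0 : Omega !=set0).

Let n1 : 1 < n%:R :> R. Proof. by rewrite ltr1n. Qed.
Let p1 : 1 < p. Proof. exact: lt_trans pn. Qed.
Let mO : measurable Omega. Proof. exact: open_measurable_rV. Qed.
Let nV0 : 0 < n%:R * V.
Proof. by rewrite mulr_gt0// ?unit_ball_volume_gt0// (lt_trans _ n1). Qed.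
Let q0 : 0 < q. Proof. by rewrite divr_gt0 ?subr_gt0// (lt_trans _ p1). Qed.

Variables (phi : nat -> 'rV[R]_n -> R) (g : 'rV[R]_n -> 'rV[R]_n).
Hypothesis C1phi : forall k, C1_supported Omega (phi k).
Hypothesis mg : forall i, measurable_fun setT ((fun x => g x 0 i) \_ Omega).
Let e k := Lp_norm Omega p%:E (fun x => enorm (g x - gradient (phi k) x)).
Hypothesis e0 : e k @[k --> \oo] --> 0%E.

Let mgrad k i : measurable_fun setT ((fun x => gradient (phi k) x 0 i) \_ Omega).
Proof.
have [_ cphi _ _ _] := C1phi k.
rewrite (_ : (fun x : 'rV[R]_n => gradient (phi k) x 0 i) = partial i (phi k)); last first.
  by apply/funext => x; rewrite mxE.
by apply: continuous_measurable_restrict => //; exact: cphi.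
Qed.

Let me k : measurable_fun setT ((fun x => enorm (g x - gradient (phi k) x)) \_ Omega).
Proof.
apply: measurable_enorm_restrict => i.
rewrite (_ : (fun x : 'rV[R]_n => (g x - gradient (phi k) x) 0 i) =
    fun x => g x 0 i - gradient (phi k) x 0 i).
  exact: measurable_restrictB.
by apply/funext => x; rewrite !mxE.
Qed.

Let e_small (d : R) : 0 < d -> exists K, forall k, (K <= k)%N -> (e k <= d%:E)%E.
Proof.
move=> d0; have /fine_cvgP[[K1 _ fe] ce] := e0.
have [K2 _ ee] := cvgr_lt _ ce _ d0.
exists (maxn K1 K2) => k; rewrite geq_max => /andP[k1 k2].
rewrite -[e k]fineK; last exact: fe.
by rewrite lee_fin ltW//; exact: ee.
Qed.

Let A := (ball_potential Omega p) `^ q^-1.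
Let A_ge0 : 0 <= A. Proof. exact: powR_ge0. Qed.

Let pot_le x : potential Omega p x `^ q^-1 <= A.
Proof.
apply: ge0_ler_powR; rewrite ?invr_ge0 ?(ltW q0) ?nnegrE//.
- exact: potential_ge0.
- by rewrite ltW// ball_potential_gt0.
- exact: potential_le.
Qed.

(** The pointwise bound for phi_j - phi_k, combined with Minkowski through g, makes the sequence
    uniformly Cauchy. *)
Let pair_bound j k x : (((n%:R * V) * `|phi j x - phi k x|)%:E <= (e j + e k) * A%:E)%E.
Proof.
apply: le_trans (morrey n2 pn oO bO O0 x (C1_supportedB (C1phi j) (C1phi k))) _.
apply: lee_pmul; rewrite ?lee_fin ?powR_ge0 ?pot_le ?Lnorm_ge0//.
apply: (Lp_norm_le_add (ltW p1)); [|exact: me|exact: me|].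
  apply: measurable_enorm_restrict => i.
  rewrite (_ : (fun x : 'rV[R]_n => gradient (phi j - phi k) x 0 i) =
      fun x => gradient (phi j) x 0 i - gradient (phi k) x 0 i).
    exact: measurable_restrictB.
  by apply/funext => y; rewrite (gradientB _ (C1phi j) (C1phi k)) !mxE.
move=> y _; rewrite (gradientB _ (C1phi j) (C1phi k)) ger0_norm ?enorm_ge0//.
rewrite -(subrKA (g y)) (le_trans (ler_enormD _ _))//.
by rewrite (enorm_distC (gradient _ _)).
Qed.

(** The last clause is the limit of [morrey] at a fixed x, so the potential at that x is
    retained. *)
Lemma uniform_limit_exists : exists u : 'rV[R]_n -> R,
  [/\ forall d : R, 0 < d -> exists K, forall k x, (K <= k)%N -> `|phi k x - u x| <= d,
    continuous u, forall x, ~ Omega x -> u x = 0 &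
    forall x, ((n%:R * V * `|u x|)%:E <=
      Lp_norm Omega p%:E (fun y => enorm (g y)) *
      (potential Omega p x `^ q^-1)%:E)%E].
Proof.
have [u uE] : exists u : 'rV[R]_n -> R, forall d : R, 0 < d ->
    exists K, forall k x, (K <= k)%N -> `|phi k x - u x| <= d.
  apply: uniform_cauchy_limit => d d0.
  (* Solves 2 d' (A + 1) = n V d; here, as in the choices below, the added 1 keeps the denominator
     positive. *)
  pose d' := n%:R * V * d / (2 * (A + 1)).
  have A1 : 0 < A + 1 by rewrite ltr_wpDl.
  have d'0 : 0 < d' := divr_gt0 (mulr_gt0 nV0 d0) (mulr_gt0 (ltr0Sn _ 1) A1).
  have [K eK] := e_small d'0; exists K => j k x Kj Kk.
  rewrite -(ler_pM2l nV0) -lee_fin (le_trans (pair_bound j k x))//.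
  apply: (@le_trans _ _ ((d' + d')%:E * (A + 1)%:E)%E).
    apply: lee_pmul; rewrite ?adde_ge0 ?Lnorm_ge0 ?lee_fin ?lerDl//.
    by rewrite EFinD; apply: leeD; exact: eK.
  rewrite -EFinM lee_fin le_eqVlt; apply/orP; left; apply/eqP; rewrite /d'.
  by field; rewrite gt_eqF.
exists u; split => //.
- apply: uniform_limit_continuous_at uE => k.
  by have [_ _ _ _] := C1phi k.
- move=> x Ox; apply/eqP; rewrite -normr_eq0 eq_le normr_ge0 andbT.
  apply/ler_addgt0Pl => d d0; rewrite addr0.
  have [K uK] := uE _ d0; have := uK K x (leqnn K).
  by have [_ _ _ /(_ x Ox)[-> _] _] := C1phi K; rewrite sub0r normrN.
move=> x; apply/lee_addgt0Pr => d d0.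
set B := potential Omega p x `^ q^-1; have B0 : 0 <= B by exact: powR_ge0.
(* Replacing u by phi_k costs n V d1 = d/2 on the left, and replacing grad phi_k by g costs d2 B <=
   d/2 on the right. *)
pose d1 := d / (2 * (n%:R * V)); pose d2 := d / (2 * (B + 1)).
have B1 : 0 < B + 1 by rewrite ltr_wpDl.
have d10 : 0 < d1 := divr_gt0 d0 (mulr_gt0 (ltr0Sn _ 1) nV0).
have d20 : 0 < d2 := divr_gt0 d0 (mulr_gt0 (ltr0Sn _ 1) B1).
have [K1 uK] := uE _ d10; have [K2 eK] := e_small d20.
pose k := maxn K1 K2.
have := uK k x (leq_maxl _ _); have := eK k (leq_maxr _ _) => ek ud.
have : (n%:R * V * `|u x| <= n%:R * V * `|phi k x| + d / 2).
  have -> : d / 2 = n%:R * V * d1.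
    by rewrite /d1; field; rewrite !gt_eqF ?unit_ball_volume_gt0// (lt_trans _ n1).
  rewrite -mulrDr ler_pM2l// -lerBlDl (le_trans _ ud)// distrC.
  exact: lerB_dist.
rewrite -lee_fin => /le_trans; apply.
rewrite EFinD.
have := morrey n2 pn oO bO O0 x (C1phi k); rewrite -/B => /(leeD2r (d / 2)%:E)/le_trans; apply.
have : (Lp_norm Omega p%:E (fun y => enorm (gradient (phi k) y)) <=
    Lp_norm Omega p%:E (fun y => enorm (g y)) + d2%:E)%E.
  apply: (@le_trans _ _ (Lp_norm Omega p%:E (fun y => enorm (g y)) + e k)%E).
    apply: (Lp_norm_le_add (ltW p1)); [| |exact: me|].
    - exact: measurable_enorm_restrict.
    - exact: measurable_enorm_restrict.
    - move=> y _; rewrite ger0_norm ?enorm_ge0//.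
      rewrite [X in _ <= X]addrC enorm_distC -{1}[gradient _ _](subrK (g y)).
      exact: ler_enormD.
  by rewrite leeD2l.
have B0e : (0 <= B%:E)%E by rewrite lee_fin.
move=> /(lee_wpmul2r B0e)/(leeD2r (d / 2)%:E)/le_trans; apply.
rewrite ge0_muleDl ?Lnorm_ge0 ?lee_fin ?(ltW d20)//.
rewrite -addeA leeD2l// -EFinM -EFinD lee_fin.
have : d2 * B <= d / 2.
  by rewrite /d2 mulrAC ler_pdivrMr ?mulr_gt0// mulrA divfK// ler_pM2l// lerDl.
lra.
Qed.

End representative.

(** * The sharp inequality and its equality case *)

Section sobolev.
Context {R : realType} {n : nat}.
Variables (Omega : set 'rV[R]_n) (p : R).
Local Notation L := (@lebesgue_rV R n).
Local Notation V := (@unit_ball_volume R n).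
Local Notation q := (p / (p - 1)).
Hypotheses (n2 : (2 <= n)%N) (pn : n%:R < p).
Hypotheses (oO : open Omega) (bO : bounded_set Omega) (O0 : Omega !=set0).

Let n1 : 1 < n%:R :> R. Proof. by rewrite ltr1n. Qed.
Let p1 : 1 < p. Proof. exact: lt_trans pn. Qed.
Let p0 : 0 < p. Proof. exact: lt_trans p1. Qed.
Let mO : measurable Omega. Proof. exact: open_measurable_rV. Qed.
Let nV0 : 0 < n%:R * V.
Proof. by rewrite mulr_gt0// ?unit_ball_volume_gt0// (lt_trans _ n1). Qed.

Let LO_fin : L Omega \is a fin_num.
Proof. by rewrite ge0_fin_numE ?measure_ge0//; exact: lebesgue_bounded_lty. Qed.

(** The approximants tend to u in L^p and to [ut] uniformly; as Omega has finite measure, uniform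
    convergence implies convergence in L^p, so u - ut has norm 0. *)
Lemma W01p_representative u g : W01p Omega p u g ->
  exists ut : 'rV[R]_n -> R,
  [/\ continuous ut, forall x, ~ Omega x -> ut x = 0,
    forall x, ((n%:R * V * `|ut x|)%:E <=
      Lp_norm Omega p%:E (fun y => enorm (g y)) *
      (potential Omega p x `^ q^-1)%:E)%E &
    {ae L, forall x, Omega x -> u x = ut x}].
Proof.
move=> [[Lu Lg] [phi [tphi uphi gphi]]].
have C1phi k := test_function_C1_supported (tphi k).
have mg i : measurable_fun setT ((fun x => g x 0 i) \_ Omega).
  by have [Lgi _] := Lg i; exact: (@Lp_measurable _ _ _ p).
have [ut [utE cut ut0 utb]] := uniform_limit_exists n2 pn oO bO O0 C1phi mg gphi.
exists ut; split => //.
have mu := Lp_measurable Lu; have mut := continuous_measurable_restrict mO cut.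
have md := measurable_restrictB mu mut.
have mphi k : measurable_fun setT ((phi k) \_ Omega).
  by apply: continuous_measurable_restrict => //; case: (C1phi k).
have N0 : Lp_norm Omega p%:E (fun x => u x - ut x) = 0%E.
  apply/eqP; rewrite eq_le Lnorm_ge0 andbT; apply/lee_addgt0Pr => d d0; rewrite add0e.
  pose v := fine (L Omega `^ p^-1); have v0 : 0 <= v by rewrite fine_ge0// poweR_ge0.
  have v1 : 0 < v + 1 by rewrite ltr_wpDl.
  pose d' := d / 2 / (v + 1); have d'0 : 0 < d' by rewrite !divr_gt0.
  have [K1 K1E] := utE _ d'0.
  have d20 : 0 < d / 2 by rewrite divr_gt0.
  have /fine_cvgP[[K2 _ fe] ce] := uphi.
  have [K3 _ ee] := cvgr_lt _ ce _ d20.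
  pose k := maxn K1 (maxn K2 K3).
  have k1 : (K1 <= k)%N by exact: leq_maxl.
  have k2 : (K2 <= k)%N by rewrite /k leq_max (leq_maxl K2) orbT.
  have k3 : (K3 <= k)%N by rewrite /k leq_max (leq_maxr K2) orbT.
  have ek : (Lp_norm Omega p%:E (fun x => (u x - phi k x)%R) <= (d / 2)%:E)%E.
    by rewrite -[X in (X <= _)%E]fineK ?lee_fin ?ltW//; [exact: ee|exact: fe].
  apply: (@le_trans _ _ (Lp_norm Omega p%:E (fun x => `|u x - phi k x|%R) +
      Lp_norm Omega p%:E (cst d'))%E).
    apply: (Lp_norm_le_add (ltW p1)) => //.
    - rewrite (_ : _ \_ _ = (fun t : R => `|t|) \o ((fun x => u x - phi k x) \_ Omega)).
        by apply: measurableT_comp => //; exact: measurable_restrictB.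
      by apply/funext => x; rewrite /= !patchE; case: ifPn; rewrite ?normr0.
    - by apply: continuous_measurable_restrict => //; exact: cst_continuous.
    - move=> x _; rewrite -(subrKA (phi k x)) (le_trans (ler_normD _ _))//.
      by rewrite lerD2l; exact: K1E.
  rewrite (_ : Lp_norm _ _ (fun x => `|_|) =
      Lp_norm Omega p%:E (fun x => u x - phi k x)); last first.
    rewrite /Lp_norm -[RHS]Lnorm_abse; apply: eq_Lnorm => x /=.
    by rewrite !patchE; case: ifPn; rewrite ?normr0.
  rewrite Lp_norm_cst ?(ltW p1) ?(ltW d'0)//.
  rewrite -[(L Omega `^ _)%E]fineK ?fin_num_poweR// -/v -EFinM.
  rewrite [d]splitr EFinD leeD// lee_fin /d' mulrAC ler_pdivrMr// ler_wpM2l ?(ltW d20)//.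
  by rewrite lerDl.
have := @Lnorm_eq0_eq0 _ _ _ L (EFin \o ((fun x => u x - ut x) \_ Omega)) p%:E.
move=> /(_ _ _ N0)-H.
have {H} : ae_eq L setT (EFin \o ((fun x => u x - ut x) \_ Omega)) (cst 0%E).
  apply: H; last by rewrite lte_fin.
  by apply/measurable_EFinP.
apply: filterS => x /(_ I) /= [+] xO; rewrite patchE mem_set//.
by move/eqP; rewrite subr_eq0 => /eqP.
Qed.

(** M is the maximum of |ut|, attained on the compact closure of Omega. The estimate of the sup norm
    of u by M serves both results below: the bound at x implies the inequality for M, hence for u,
    and equality for u then forces equality for M. *)
Lemma W01p_sup_bound u g : W01p Omega p u g ->
  exists x M, [/\ 0 <= M, (Lp_norm Omega +oo u <= M%:E)%E,
    ((n%:R * V * M)%:E <= Lp_norm Omega p%:E (fun y => enorm (g y)) *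
      (potential Omega p x `^ q^-1)%:E)%E &
    M = 0 -> {ae L, forall x, Omega x -> u x = 0}].
Proof.
move=> /W01p_representative[ut [cut ut0 utb uae]].
have [x _ xmax] : exists2 x, x \in closure Omega &
    forall y, y \in closure Omega -> `|ut y| <= `|ut x|.
  apply: (@EVT_max_rV R n (fun y => `|ut y|)).
  - by have [z Oz] := O0; exists z; exact: subset_closure.
  - apply: bounded_closed_compact; last exact: closed_closure.
    have [r r0 Or] := bounded_setP_enorm 0 bO.
    have cOr : closure Omega `<=` [set y | enorm (y - 0) <= r].
      have /closure_id -> : closed [set y : 'rV[R]_n | enorm (y - 0) <= r] by exact: closed_ecball.
      by apply: closureS => y /Or/ltW.
    have cB : closure Omega `<=` eball 0 (r + 1).
      by move=> y /cOr /= yr; rewrite /eball/= (le_lt_trans yr)// ltrDl.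
    have [K [Kr Kb]] := eball_bounded (0 : 'rV[R]_n) (r + 1).
    by exists K; split => // z Kz y /cB; exact: Kb.
  - apply: continuous_subspaceT => y.
    by apply: (@continuous_comp _ _ _ ut (fun z : R => `|z|)); [exact: cut|exact: norm_continuous].
have utx y : `|ut y| <= `|ut x|.
  have [Oy|nOy] := pselect (Omega y); last by rewrite ut0// normr0.
  by apply: xmax; apply/mem_set/subset_closure.
exists x, `|ut x|; split => //.
(* The library norm for the exponent +oo is an essential supremum only if the whole space has
   positive measure, and 0 otherwise. *)
- rewrite /Lp_norm unlock; case: ifPn => [L0|_]; last by rewrite lee_fin.
  apply/ess_sup_inf.ess_supP; apply: filterS uae => y uy; rewrite /= lee_fin patchE.
  by case: ifPn => [/set_mem yO|_]; rewrite ?normr0// uy.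
- move=> /eqP; rewrite normr_eq0 => /eqP utx0.
  apply: filterS uae => y uy Oy; rewrite uy//.
  by apply/eqP; rewrite -normr_le0 (le_trans (utx y))// utx0 normr0.
Qed.

Let vol := fine (L Omega).
Let C := n%:R * omega n `^ (p / n%:R) * ((p - n%:R) / (p - 1)) `^ (p - 1) *
  vol `^ (1 - p / n%:R).
Local Notation J := (ball_potential Omega p).

Let CJ : C * J `^ (p - 1) = (n%:R * V) `^ p.
Proof. exact: sharp_constantE. Qed.

Let J0 : 0 < J. Proof. exact: ball_potential_gt0. Qed.

Let Jp0 : 0 < J `^ (p - 1). Proof. by rewrite powR_gt0. Qed.

Lemma sharp_constant_gt0 : 0 < C.
Proof. by rewrite -(pmulr_lgt0 _ Jp0) CJ powR_gt0. Qed.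

(** The bound at x raised to the power p, using p / q = p - 1. *)
Let power_bound x M r : 0 <= M -> 0 <= r ->
  n%:R * V * M <= r * potential Omega p x `^ q^-1 ->
  (n%:R * V) `^ p * M `^ p <= r `^ p * potential Omega p x `^ (p - 1).
Proof.
move=> M0 r0 h; have nV := ltW nV0.
have -> : potential Omega p x `^ (p - 1) = (potential Omega p x `^ q^-1) `^ p.
  by rewrite -powRrM invf_div divfK// gt_eqF.
rewrite -!powRM ?powR_ge0//; apply: (ge0_ler_powR (ltW p0)) => //.
  by rewrite nnegrE mulr_ge0.
by rewrite nnegrE mulr_ge0// powR_ge0.
Qed.

Let pot_le x : potential Omega p x `^ (p - 1) <= J `^ (p - 1).
Proof.
apply: ge0_ler_powR; rewrite ?subr_ge0 ?nnegrE ?(ltW p1) ?(ltW J0)//.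
  exact: potential_ge0.
exact: potential_le.
Qed.

Let grad_norm_cases (g : 'rV[R]_n -> 'rV[R]_n) :
  Lp_norm Omega p%:E (fun y => enorm (g y)) = +oo%E \/
  exists2 r, 0 <= r & Lp_norm Omega p%:E (fun y => enorm (g y)) = r%:E.
Proof.
have := @Lnorm_ge0 _ _ _ L p%:E (EFin \o ((fun y => enorm (g y)) \_ Omega)).
rewrite -/(Lp_norm Omega p%:E (fun y => enorm (g y))).
case: (Lp_norm _ _ _) => [r| |]//; last by left.
by rewrite lee_fin => r0; right; exists r.
Qed.

Lemma sharp_sobolev_inequality u g : W01p Omega p u g ->
  (C%:E * Lp_norm Omega +oo u `^ p
     <= Lp_norm Omega p%:E (fun x => enorm (g x)) `^ p)%E.
Proof.
move=> /W01p_sup_bound[x [M [M0 uM + _]]].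
have [->|[r r0 ->]] := grad_norm_cases g.
  by rewrite poweRyr ?leey// gt_eqF.
rewrite -EFinM lee_fin => /(power_bound M0 r0) h.
apply: (@le_trans _ _ (C%:E * M%:E `^ p)%E).
  apply: lee_wpmul2l; first by rewrite lee_fin ltW// sharp_constant_gt0.
  by apply: gt0_ler_poweR; rewrite ?(ltW p0)// in_itv/= ?leey ?andbT ?Lnorm_ge0 ?lee_fin.
rewrite !poweR_EFin -EFinM lee_fin -(ler_pM2r Jp0) mulrAC CJ (le_trans h)//.
by rewrite ler_wpM2l// powR_ge0.
Qed.

(** Equality gives r^p <= C M^p for the gradient norm r, while the bound at x says C J^(p-1) M^p <=
    r^p potential(x)^(p-1). As C M^p > 0, the potential at x is at least J, and the equality case of
    the bathtub principle applies. *)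
Lemma sharp_sobolev_equality_null u g : W01p Omega p u g ->
  ~ {ae L, forall x, Omega x -> u x = 0} ->
  (C%:E * Lp_norm Omega +oo u `^ p
     = Lp_norm Omega p%:E (fun x => enorm (g x)) `^ p)%E ->
  exists x, L (eball x (equal_volume_radius Omega) `\` Omega) = 0%E.
Proof.
move=> /W01p_sup_bound[x [M [M0 uM p2 Mu]]] nu eqn; exists x.
have {Mu nu}M0' : 0 < M by rewrite lt0r M0 andbT; apply/eqP => /Mu.
have CM : (C%:E * Lp_norm Omega +oo u `^ p <= C%:E * M%:E `^ p)%E.
  apply: lee_wpmul2l; first by rewrite lee_fin ltW// sharp_constant_gt0.
  by apply: gt0_ler_poweR; rewrite ?(ltW p0)// in_itv/= ?leey ?andbT ?Lnorm_ge0 ?lee_fin.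
have [gy|[r r0 gr]] := grad_norm_cases g.
  by move: CM; rewrite eqn gy poweRyr ?gt_eqF// poweR_EFin -EFinM leye_eq.
move: p2; rewrite gr -EFinM lee_fin => /(power_bound M0 r0) h.
apply: (potential_eq n2 pn oO bO O0).
have : J `^ (p - 1) <= potential Omega p x `^ (p - 1).
  have rM : r `^ p <= C * M `^ p.
    by move: CM; rewrite eqn gr !poweR_EFin -EFinM lee_fin.
  have Mp0 : 0 < C * M `^ p by rewrite mulr_gt0 ?sharp_constant_gt0 ?powR_gt0.
  rewrite -(ler_pM2l Mp0) mulrAC CJ (le_trans h)//.
  by rewrite ler_wpM2r// powR_ge0.
apply: contraTT; rewrite -!ltNge => pJ.
apply: gt0_ltr_powR => //; rewrite ?subr_gt0 ?nnegrE ?(ltW J0)//.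
exact: potential_ge0.
Qed.

End sobolev.

(** * From a null difference to equality of sets *)

Section null_difference.
Context {R : realType} {n : nat}.
Local Notation L := (@lebesgue_rV R n).
Implicit Types (Omega A : set 'rV[R]_n).

Lemma open_null_set0 A B : open A -> A `<=` B -> measurable B -> L B = 0%E -> A = set0.
Proof.
move=> oA AB mB B0; apply: contrapT => /eqP/set0P A0.
have := lebesgue_open_gt0 oA A0; rewrite lt0e => /andP[/eqP + _]; apply.
by apply: (@subset_measure0 _ _ _ L A B) => //; exact: open_measurable_rV.
Qed.

Lemma continuous_col' (i : 'I_n) : continuous (col' i : 'rV[R]_n -> 'rV[R]_n.-1).
Proof.
move=> x A /nbhs_ballP[e /= e0 eA]; apply/nbhs_ballP; exists e => //= y [_ xy].
by apply: eA; split => // j k; rewrite !mxE; exact: xy.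
Qed.

Lemma coord_continuous_rV (i : 'I_n) : continuous (fun x : 'rV[R]_n => x 0 i).
Proof. exact: coord_continuous. Qed.

(* A null set contains no ball, so the ball lies in the closure of Omega; where it
   met the boundary, a one-sided neighbourhood of the graph would be lost. *)
Lemma eball_of_null_difference Omega x r :
  open Omega -> bounded_set Omega -> smooth_boundary Omega -> 0 < r ->
  L Omega = L (eball x r) -> L (eball x r `\` Omega) = 0%E -> Omega = eball x r.
Proof.
move=> oO bO sO r0 LOr BO0.
have mO := open_measurable_rV oO; have mB := measurable_eball x r.
(* Omega and the ball have the same finite measure, so if one difference is null, the other is null
   too. *)
have OB0 : L (Omega `\` eball x r) = 0%E.
  have mI : L (Omega `&` eball x r) \is a fin_num.
    rewrite ge0_fin_numE ?measure_ge0//; apply: le_lt_trans (lebesgue_eball_lty x r).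
    by apply: le_measure; rewrite ?inE//; exact: measurableI.
  have := LOr; rewrite (@measureDI _ _ _ L Omega (eball x r))//.
  have -> : L (eball x r) = L (Omega `&` eball x r).
    apply: etrans (@measureDI _ _ _ L (eball x r) Omega mB mO) _.
    rewrite [eball x r `&` _]setIC.
    by apply: etrans (congr1 (fun z => z + _)%E BO0) _; rewrite add0e.
  have addeI (a b : \bar R) : b \is a fin_num -> a + b = b -> a = 0%E.
    by move=> bfin /(congr1 (fun z => z - b)%E); rewrite addeK// subee.
  exact: addeI.
have mBO : measurable (eball x r `\` Omega) by exact: measurableD.
have mOB : measurable (Omega `\` eball x r) by exact: measurableD.
apply/seteqP; split => y.
  (* A point of Omega outside the ball, pushed radially outwards by e/2, lies in an open part of
     Omega beyond the ball; that part is null, hence empty. *)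
  move=> Oy; apply: contrapT => nBy.
  have [e e0 eO] := open_eballP oO Oy.
  have ry : r <= enorm (y - x) by rewrite leNgt; apply/negP.
  pose U := eball y e `&` [set z | r < enorm (z - x)].
  have oU : open U.
    apply: openI; first exact: open_eball.
    rewrite (_ : mkset _ = (fun z => enorm (z - x)) @^-1` [set t | r < t])//.
    by apply: open_comp => [z _|]; [exact: enorm_sub_continuous|exact: open_gt].
  have U0 : U = set0.
    apply: open_null_set0 oU _ mOB OB0 => z [/eO Oz rz]; split => // /=.
    by rewrite /eball/= ltNge => /negP; apply; exact: ltW.
  have yx0 : 0 < enorm (y - x) := lt_le_trans r0 ry.
  pose t := e / 2 / enorm (y - x); have t0 : 0 < t by rewrite !divr_gt0.
  suff : U (y + t *: (y - x)) by rewrite U0.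
  split; rewrite /eball/=.
    rewrite addrC addKr enormZ gtr0_norm// /t divfK ?gt_eqF//.
    by rewrite ltr_pdivrMr// ltr_pMr// ltr1n.
  have -> : y + t *: (y - x) - x = (1 + t) *: (y - x).
    by rewrite scalerDl scale1r addrAC.
  rewrite enormZ gtr0_norm ?addr_gt0// mulrDl mul1r.
  by rewrite ltr_pwDr// mulr_gt0.
move=> By; apply: contrapT => nOy.
have oB : open (eball x r) by exact: open_eball.
have clO : closure Omega y.
  apply: contrapT => ncl.
  pose U := eball x r `&` ~` closure Omega.
  have oU : open U by apply: openI => //; apply: closed_openC; exact: closed_closure.
  suff : U y.
    rewrite (open_null_set0 oU _ mBO BO0)// => z [Bz ncz]; split => // Oz.
    by apply: ncz; exact: subset_closure.
  by split.
have [rho [i [s [gamma [rho0 sgamma OE]]]]] : exists (r : R) (i : 'I_n) (s : bool)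
    (gamma : 'rV[R]_n.-1 -> R), [/\ 0 < r, smooth gamma &
      Omega `&` eball y r =
        [set y | gamma (col' i y) < (-1) ^+ s * y 0 i] `&` eball y r].
  by apply: sO; split => // /interior_subset.
have cgamma : continuous gamma by have [] := sgamma 0%N.
pose F (z : 'rV[R]_n) := (-1) ^+ s * z 0 i - gamma (col' i z).
have cF : continuous F.
  move=> z; apply: (@continuousB _ _ _ (fun z : 'rV[R]_n => (-1) ^+ s * z 0 i)
      (fun z => gamma (col' i z))).
    apply: (@continuousM _ _ (cst ((-1) ^+ s)) (fun z : 'rV[R]_n => z 0 i)).
      exact: cst_continuous.
    exact: coord_continuous_rV.
  apply: (@continuous_comp _ _ _ (col' i) gamma); last exact: cgamma.
  exact: continuous_col'.
(* The strict wrong side of the graph near y: it is open, inside the ball and disjoint from Omega,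
   hence empty. *)
pose U := (eball x r `&` eball y rho) `&` [set z | F z < 0].
have oU : open U.
  apply: openI; first by apply: openI => //; exact: open_eball.
  rewrite (_ : mkset _ = F @^-1` [set t | t < 0])//.
  by apply: open_comp => [z _|]; [exact: cF|exact: open_lt].
have U0 : U = set0.
  apply: open_null_set0 oU _ mBO BO0 => z [[Bz rz] Fz]; split => // Oz.
  have : (Omega `&` eball y rho) z by [].
  by rewrite OE => -[/=]; rewrite -subr_gt0 -/(F z) ltNge ltW.
have yy : eball y rho y by rewrite /eball/= subrr enorm0.
have Fy : F y <= 0.
  rewrite leNgt; apply/negP => Fy; apply: nOy.
  have : ([set y | gamma (col' i y) < (-1) ^+ s * y 0 i] `&` eball y rho) y.
    by split => //=; rewrite -subr_gt0.
  by rewrite -OE => -[].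
have [e e0 eB] : exists2 e, 0 < e & eball y e `<=` eball x r `&` eball y rho.
  by apply: open_eballP => //; apply: openI => //; exact: open_eball.
(* Moving y along the axis i leaves the argument of [gamma] unchanged and lowers F by e/2; since F y
   <= 0, the new point is in U. *)
pose z := y - (e / 2 * (-1) ^+ s) *: delta_mx 0 i.
suff : U z by rewrite U0.
have ed : enorm (delta_mx 0 i : 'rV[R]_n) = 1.
  rewrite /enorm (bigD1 i)//= big1 => [|j ji]; last first.
    by rewrite mxE eqxx/= (negbTE ji) expr0n.
  by rewrite mxE !eqxx expr1n addr0 sqrtr1.
have e20 : 0 < e / 2 by rewrite divr_gt0.
split.
  apply: eB; rewrite /eball/= /z addrC addKr enormN enormZ ed mulr1 normrM normr_sign mulr1.
  by rewrite gtr0_norm// ltr_pdivrMr// ltr_pMr// ltr1n.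
have cz : col' i z = col' i y.
  apply/rowP => j; rewrite !mxE eqxx/= eq_sym (negbTE (neq_lift _ _)).
  by rewrite mulr0 subr0.
rewrite /= /F cz /z !mxE !eqxx mulr1 mulrBr mulrCA -expr2 sqrr_sign mulr1.
by rewrite addrAC subr_lt0 (le_lt_trans Fy).
Qed.

End null_difference.

(** * Smooth radial functions *)

(** Each order of smoothness calls for the previous order of the partial derivatives, so the
    functions have to be treated as a class P that is stable under them. *)
Lemma smooth_coinduction {R : realType} n (P : ('rV[R]_n -> R) -> Prop) :
  (forall f, P f -> continuous f /\ forall i,
    (forall x, derivable f x (delta_mx 0 i)) /\ P (partial i f)) ->
  forall f, P f -> smooth f.
Proof.
move=> H f Pf k; elim: k f Pf => [|k ih] f /H[cf dP]; split => // i.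
by have [df Pdf] := dP i; split => //; exact: ih.
Qed.

Section flat.
Context {R : realType}.
Implicit Types b e t : R.

(** The real exponent b makes the family closed under differentiation, up to linear combinations;
    the exponential beats every negative power at 0, so the pieces glue smoothly. *)
Definition flat b e t : R := if 0 < t then t `^ b * expR (- (e / t)) else 0.

Lemma flat_gt0E b e t : 0 < t -> flat b e t = t `^ b * expR (- (e / t)).
Proof. by rewrite /flat => ->. Qed.

Lemma flat_le0E b e t : t <= 0 -> flat b e t = 0.
Proof. by rewrite /flat ltNge => ->. Qed.

Lemma flat_ge0 b e t : 0 <= flat b e t.
Proof. by rewrite /flat; case: ifP => // _; rewrite mulr_ge0 ?powR_ge0 ?expR_ge0. Qed.

(** From exp(e/t) >= (e/t)^m / m! one gets t^b exp(-e/t) <= (m! / e^m) t^(b + m); with m > |b| + 1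
    the exponent b + m exceeds 1, and t <= 1. *)
Lemma flat_le_near0 b e : 0 < e ->
  exists2 K, 0 < K & forall t, `|t| <= 1 -> `|flat b e t| <= K * `|t|.
Proof.
move=> e0; pose m := Num.bound (`|b| + 1).
have mE : `|b| + 1 < m%:R by rewrite archi_boundP// addr_ge0.
have m0 : (0 < m)%N by rewrite -(ltr0n R) (le_lt_trans _ mE)// addr_ge0.
have fe0 : 0 < m`!%:R / e ^+ m by rewrite divr_gt0 ?exprn_gt0 ?ltr0n ?fact_gt0.
exists (m`!%:R / e ^+ m) => // t t1.
have [t0|t0] := ltP 0 t; last by rewrite flat_le0E// normr0 mulr_ge0 ?(ltW fe0).
rewrite flat_gt0E// ger0_norm ?mulr_ge0 ?powR_ge0 ?expR_ge0// gtr0_norm//.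
have ex : expR (- (e / t)) <= m`!%:R / e ^+ m * t ^+ m.
  have et0 : 0 <= e / t by rewrite divr_ge0 ?ltW.
  have := expR_ge1Dxn m.-1 et0; rewrite prednK// => h.
  have pos : 0 < (e / t) ^+ m / m`!%:R.
    by rewrite divr_gt0 ?exprn_gt0 ?divr_gt0 ?ltr0n ?fact_gt0.
  rewrite expRN (_ : _ * _ = ((e / t) ^+ m / m`!%:R)^-1).
    rewrite lef_pV2 ?posrE ?expR_gt0//; apply: le_trans h; by rewrite lerDr.
  by rewrite expr_div_n !invf_div -mulrA [_^-1 * _]mulrC.
apply: (@le_trans _ _ (t `^ b * (m`!%:R / e ^+ m * t ^+ m))).
  by rewrite ler_wpM2l ?powR_ge0.
rewrite mulrCA ler_pM2l// -powR_mulrn ?(ltW t0)// -powRD; last by rewrite (gt_eqF t0) implybT.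
rewrite -[X in _ <= X](powRr1 (ltW t0)); apply: ger_powR.
  by rewrite t0 -(gtr0_norm t0).
have : - `|b| <= b by rewrite lerNl -normrN ler_norm.
by move=> h; rewrite (le_trans _ (lerD h (ltW mE)))// addrA addNr add0r.
Qed.

Lemma is_derive_flat b e t : 0 < e ->
  is_derive t 1 (flat b e) (b * flat (b - 1) e t + e * flat (b - 2) e t).
Proof.
move=> e0; have [t0|t0|->] := ltgtP t 0.
- rewrite !flat_le0E ?ltW// !mulr0 addr0.
  have d0 : is_derive t 1 (cst 0 : R -> R) 0 by exact: is_derive_cst.
  apply: near_eq_is_derive d0; near=> s; rewrite flat_le0E//= ltW//.
  by near: s; exact: lt_nbhsl.
- rewrite !flat_gt0E//.
  apply: (@near_eq_is_derive _ _ _ (fun s : R => s `^ b * expR (- (e / s)))).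
    near=> s; rewrite flat_gt0E//.
    by near: s; exact: lt_nbhsr.
  have d1 : is_derive t 1 (fun s : R => - (e / s)) (e * t ^- 2).
    have t1 : (id t : R) != 0 by rewrite gt_eqF.
    have h := is_deriveV t1 (is_derive_id t 1).
    have := @is_deriveZ _ _ _ (fun s : R => s^-1) (- e) t 1 _ h.
    rewrite (_ : (- e) \*: _ = fun s : R => - (e / s)).
      rewrite (_ : (- e *: _ : R) = e * t ^- 2)//.
      by rewrite /GRing.scale/= mulr1 mulrNN.
    by apply/funext => s; rewrite [LHS](_ : _ = - e * s^-1)// mulNr.
  have d2 := @is_derive1_comp _ (@expR R) _ t _ _ (is_derive_expR _) d1.
  have d3 := is_deriveM (is_derive1_powR b t0) d2.
  apply: is_derive_eq d3 _; rewrite /GRing.scale/=.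
  rewrite !powRB ?(gt_eqF t0) ?implybT// powRr1 ?(ltW t0)// powR_mulrn ?(ltW t0)//.
  by ring.
- rewrite !flat_le0E// !mulr0 addr0; apply: cvg_is_derive.
  have [K K0 KE] := flat_le_near0 (b - 1) e0.
  apply/cvgrPdist_le => d d0; near=> h.
  rewrite sub0r normrN addr0 [h *: 1]mulr1 [X in _ - X]flat_le0E// subr0.
  have h0 : h != 0 by near: h; exact: nbhs_dnbhs_neq.
  (* The difference quotient at 0 is again in the family, and it tends to 0 by [flat_le_near0]. *)
  have -> : h^-1 *: flat b e h = flat (b - 1) e h.
    have [hp|hn] := ltP 0 h; last by rewrite !flat_le0E// scaler0.
    rewrite !flat_gt0E// powRB ?h0 ?implybT// powRr1 ?(ltW hp)//.
    by rewrite /GRing.scale/=; ring.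
  apply: (le_trans (KE _ _)).
    by near: h; apply: dnbhs0_le.
  rewrite mulrC -ler_pdivlMr//; near: h; apply: dnbhs0_le.
  exact: divr_gt0.
Unshelve. all: by end_near. Qed.

Lemma continuous_flat b e : 0 < e -> continuous (flat b e).
Proof.
move=> e0 t; apply: differentiable_continuous; apply/derivable1_diffP.
by apply: ex_derive; exact: is_derive_flat.
Qed.

End flat.

Section radial.
Context {R : realType} {n : nat}.
Implicit Types (f : 'rV[R]_n -> R) (x v : 'rV[R]_n).

(** Restricting f to the line through x with direction v reduces this to the chain rule in one
    variable. *)
Lemma is_derive_comp (F : R -> R) f x v (df dF : R) :
  is_derive x v f df -> is_derive (f x) 1 F dF ->
  is_derive x v (F \o f) (dF * df).
Proof.
move=> fd Fd; have d1 : is_derive (0 : R) 1 (fun s => f (s *: v + x)) df.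
  by apply: is_derive_line; rewrite scale0r add0r.
have d2 : is_derive ((fun s : R => f (s *: v + x)) 0) 1 F dF.
  by rewrite scale0r add0r.
have [dv dE] := @is_derive1_comp _ F _ 0 _ _ d2 d1.
have E : (fun h : R => h^-1 *: ((F \o f) (h *: v + x) - (F \o f) x)) =
    (fun h : R => h^-1 *: ((F \o (fun s : R => f (s *: v + x))) (h *: 1 + 0) -
      (F \o (fun s : R => f (s *: v + x))) 0)).
  by apply/funext => h /=; rewrite addr0 scale0r add0r [h *: 1]mulr1.
by split; rewrite /derivable /derive E.
Qed.

Variables (c : 'rV[R]_n) (e a r : R).
Hypotheses (e0 : 0 < e).

(** The shift keeps the base positive, so that every real power of it is differentiable, also at
    c. *)
Definition shifted_sqr x := enorm (x - c) ^+ 2 + e.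
Local Notation q := shifted_sqr.

Definition truncation_level x := r `^ a - q x `^ (a / 2).
Local Notation T := truncation_level.

Lemma shifted_sqr_gt0 x : 0 < q x.
Proof. by rewrite ltr_wpDl// sqr_ge0. Qed.

(* Contains the approximants of the extremal function and is closed under partial
   derivatives, hence consists of smooth functions by coinduction. *)
Inductive radial_algebra : ('rV[R]_n -> R) -> Prop :=
| radial_cst (k : R) : radial_algebra (cst k)
| radial_coord i : radial_algebra (fun x => x 0 i - c 0 i)
| radial_add f g : radial_algebra f -> radial_algebra g -> radial_algebra (f + g)
| radial_mul f g : radial_algebra f -> radial_algebra g -> radial_algebra (f * g)
| radial_pow b : radial_algebra (fun x => q x `^ b)
| radial_flat b : radial_algebra (flat b e \o T).

Lemma is_derive_coord x (i j : 'I_n) :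
  is_derive x (delta_mx 0 i) (fun y : 'rV[R]_n => y 0 j - c 0 j) ((i == j)%:R : R).
Proof.
apply: cvg_is_derive; apply: cvg_near_cst; near=> h.
rewrite !mxE opprB addrA [_ - c 0 j + _]addrAC.
have h0 : h != 0 by near: h; exact: nbhs_dnbhs_neq.
rewrite !addrK.
by rewrite eqxx/= eq_sym /GRing.scale/= mulrA mulVf// mul1r.
Unshelve. all: by end_near. Qed.

Lemma is_derive_shifted_sqr x i :
  is_derive x (delta_mx 0 i) q (2 * (x 0 i - c 0 i)).
Proof.
rewrite (_ : q = (\sum_j (fun y : 'rV[R]_n => y 0 j - c 0 j) ^+ 2) + cst e); last first.
  apply/funext => y; rewrite /q enorm_sqr
    [RHS](_ : _ = (\sum_j (fun y : 'rV[R]_n => y 0 j - c 0 j) ^+ 2) y + e)//; congr (_ + _).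
  rewrite fct_sumE.
  by apply: eq_bigr => j _; rewrite !mxE.
have h j := is_deriveX 2 (is_derive_coord x i j).
have := is_deriveD (is_derive_sum h) (is_derive_cst e x (delta_mx 0 i)).
move=> /is_derive_eq; apply; rewrite addr0 (bigD1 i)//= big1 ?addr0.
  by rewrite eqxx /GRing.scale/= mulr1 expr1.
by move=> j ji; rewrite eq_sym (negbTE ji) scaler0.
Qed.

Lemma is_derive_shifted_pow b x i :
  is_derive x (delta_mx 0 i) (fun y => q y `^ b)
    (b * q x `^ (b - 1) * (2 * (x 0 i - c 0 i))).
Proof.
exact: (is_derive_comp (is_derive_shifted_sqr x i)
  (is_derive1_powR b (shifted_sqr_gt0 x))).
Qed.

Lemma is_derive_truncation_level x i :
  is_derive x (delta_mx 0 i) T (- (a * q x `^ (a / 2 - 1) * (x 0 i - c 0 i))).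
Proof.
have := is_deriveB (is_derive_cst (r `^ a) x (delta_mx 0 i)) (is_derive_shifted_pow (a / 2) x i).
by move=> /is_derive_eq; apply; rewrite sub0r; congr (- _); field.
Qed.

Lemma is_derive_flat_truncation b x i :
  is_derive x (delta_mx 0 i) (flat b e \o T)
    ((b * flat (b - 1) e (T x) + e * flat (b - 2) e (T x)) *
     - (a * q x `^ (a / 2 - 1) * (x 0 i - c 0 i))).
Proof.
exact: (is_derive_comp (is_derive_truncation_level x i) (is_derive_flat b (T x) e0)).
Qed.

Lemma continuous_shifted_pow b : continuous (fun x => q x `^ b).
Proof.
move=> x; apply: (@continuous_comp _ _ _ q (fun t : R => t `^ b)).
  have ce : {for x, continuous (cst e : 'rV[R]_n -> R)} by exact: cst_continuous.
  apply: (continuousD _ ce).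
  have cn : {for x, continuous (fun y : 'rV[R]_n => enorm (y - c))}.
    exact: enorm_sub_continuous.
  exact: (continuousM cn cn).
apply: continuous_powR_gt0; exact: shifted_sqr_gt0.
Qed.

Lemma continuous_truncation_level : continuous T.
Proof.
move=> x; apply: (@continuousB _ _ _ (cst (r `^ a)) (fun y => q y `^ (a / 2))).
  exact: cst_continuous.
exact: continuous_shifted_pow.
Qed.

Lemma radial_algebra_derive f : radial_algebra f ->
  continuous f /\ forall i, exists2 df, radial_algebra df &
    forall x, is_derive x (delta_mx 0 i) f (df x).
Proof.
have Z h k : radial_algebra h -> radial_algebra (cst k * h).
  by move=> rh; apply: radial_mul => //; exact: radial_cst.
elim=> {f} [k|j|f g rf [cf df] rg [cg dg]|f g rf [cf df] rg [cg dg]|b|b].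
- split=> [|i]; first exact: cst_continuous.
  by exists (cst 0) => [|x]; [exact: radial_cst|exact: is_derive_cst].
- split=> [x|i].
    apply: (@continuousB _ _ _ (fun y : 'rV[R]_n => y 0 j) (cst (c 0 j))).
      exact: coord_continuous_rV.
    exact: cst_continuous.
  exists (cst (i == j)%:R) => [|x]; [exact: radial_cst|exact: is_derive_coord].
- split=> [x|i]; first exact: (continuousD (cf x) (cg x)).
  have [f' rf' dff] := df i; have [g' rg' dgg] := dg i.
  by exists (f' + g') => [|x]; [exact: radial_add|exact: is_deriveD].
- split=> [x|i]; first exact: (continuousM (cf x) (cg x)).
  have [f' rf' dff] := df i; have [g' rg' dgg] := dg i.
  exists (f * g' + g * f') => [|x]; last exact: is_deriveM.
  by apply: radial_add; exact: radial_mul.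
- split=> [|i]; first exact: continuous_shifted_pow.
  exists (cst b * (fun x => q x `^ (b - 1)) * (cst 2 * (fun x => x 0 i - c 0 i))).
    apply: radial_mul; apply: (Z); [exact: radial_pow|exact: radial_coord].
  by move=> x; exact: is_derive_shifted_pow.
- split=> [x|i].
    apply: (@continuous_comp _ _ _ T (flat b e)); first exact: continuous_truncation_level.
    exact: continuous_flat.
  exists ((cst b * (flat (b - 1) e \o T) + cst e * (flat (b - 2) e \o T)) *
      (cst (- 1) * (cst a * (fun x => q x `^ (a / 2 - 1)) * (fun x => x 0 i - c 0 i)))).
    apply: radial_mul.
      by apply: radial_add; apply: (Z); exact: radial_flat.
    apply: (Z); apply: radial_mul; last exact: radial_coord.
    by apply: (Z); exact: radial_pow.
  move=> x; have /is_derive_eq := is_derive_flat_truncation b x i; apply.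
  by rewrite !fctE /= mulN1r.
Qed.

Lemma smooth_radial f : radial_algebra f -> smooth f.
Proof.
move=> rf; apply: smooth_coinduction rf => {}f rf.
have [cf df] := radial_algebra_derive rf; split=> // i.
have [df' rf' dff] := df i; split=> [x|]; first by apply: ex_derive.
rewrite (_ : partial i f = df')//; apply/funext => x.
exact: derive_val.
Qed.

End radial.

(** * Integration by parts *)

Section integration_by_parts.
Context {R : realType} {n : nat}.
Local Notation L := (@lebesgue_rV R n).
Implicit Types (f g : 'rV[R]_n -> R) (Omega : set 'rV[R]_n).

(** The affine change of variables with ratio 1, applied to the positive and negative parts. *)
Lemma integral_translate (F : 'rV[R]_n -> \bar R) c : measurable_fun setT F ->
  (\int[L]_x F (x + c)%R = \int[L]_x F x)%E.
Proof.
move=> mF.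
have h (G : 'rV[R]_n -> \bar R) : measurable_fun setT G -> (forall x, 0 <= G x)%E ->
    (\int[L]_x G (x + c)%R = \int[L]_x G x)%E.
  move=> mG G0; have := ge0_integral_rV_affine c (@ltr01 R) mG G0.
  rewrite expr1n invr1 mul1e => <-.
  by apply: eq_integral => x _; rewrite scale1r.
have hp := h _ (measurable_funepos mF) (funepos_ge0 F).
have hn := h _ (measurable_funeneg mF) (funeneg_ge0 F).
rewrite integralE [RHS]integralE -hp -hn.
by congr (_ - _)%E; apply: eq_integral => x _; rewrite ?funeposE ?funenegE.
Qed.

Lemma continuous_supported_bounded f M : continuous f ->
  (forall y, M <= enorm y -> f y = 0) -> exists2 B, 0 <= B & forall y, `|f y| <= B.
Proof.
move=> cf fM.
have [x _ xmax] : exists2 x, x \in [set y : 'rV[R]_n | enorm (y - 0) <= `|M|] &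
    forall y, y \in [set y : 'rV[R]_n | enorm (y - 0) <= `|M|] -> `|f y| <= `|f x|.
  apply: (@EVT_max_rV R n (fun y => `|f y|)).
  - by exists 0; rewrite /= subrr enorm0.
  - apply: bounded_closed_compact; last exact: closed_ecball.
    have [K [Kr Kb]] := eball_bounded (0 : 'rV[R]_n) (`|M| + 1).
    by exists K; split => // z Kz y yM; apply: (Kb _ Kz); rewrite /eball/= (le_lt_trans yM)// ltrDl.
  - apply: continuous_subspaceT => y.
    by apply: (@continuous_comp _ _ _ f (fun z : R => `|z|)); [exact: cf|exact: norm_continuous].
exists `|f x| => // y; have [yM|/ltW My] := leP (enorm y) `|M|.
  by apply: xmax; rewrite inE/= subr0.
by rewrite fM ?normr0// (le_trans (ler_norm _)).
Qed.

Lemma integrable_continuous_supported f M : continuous f ->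
  (forall y, M <= enorm y -> f y = 0) -> L.-integrable setT (EFin \o f).
Proof.
move=> cf fM; have [B B0 fB] := continuous_supported_bounded cf fM.
have mf : measurable_fun setT (EFin \o f).
  by apply/measurable_EFinP; exact: continuous_measurable_rV.
apply/integrableP; split => //.
have mD := measurable_eball (0 : 'rV[R]_n) M.
apply: (@le_lt_trans _ _ (\int[L]_(x in eball 0 M) (cst B%:E x))%E).
  rewrite [leRHS]integral_mkcond; apply: ge0_le_integral => //.
  - exact: measurableT_comp.
  - by apply/(measurable_restrictT _ mD); exact: measurable_cst.
  move=> x _; rewrite patchE; case: ifPn => [_|xM]; first by rewrite /= lee_fin.
  rewrite /= fM ?normr0// leNgt; apply/negP => h.
  by move: xM; rewrite mem_set//= /eball/= subr0.
rewrite integral_cst//; apply: lte_mul_pinfty; rewrite ?lee_fin//.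
exact: lebesgue_eball_lty.
Qed.

(** The margin 1 leaves a whole ball around y on which f is 0. *)
Lemma partial_supported f M (i : 'I_n) : (forall y, M <= enorm y -> f y = 0) ->
  forall y, M + 1 <= enorm y -> partial i f y = 0.
Proof.
move=> fM y yM; apply: partial_near0.
have : \forall z \near y, eball y 1 z by exact: eball_nbhs.
apply: filterS => z zy; apply: fM.
have := ler_enormB y (y - z); rewrite subKr => h.
move: zy; rewrite /eball/= enorm_distC => zy; lra.
Qed.

(* The difference quotients of f have integral 0 by translation invariance. *)
Lemma integral_partial_eq0 f M (i : 'I_n) : (forall y, derivable f y (delta_mx 0 i)) ->
  continuous f -> continuous (partial i f) -> (forall y, M <= enorm y -> f y = 0) ->
  (\int[L]_x (partial i f x)%:E = 0)%E.
Proof.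
move=> df cf cpf fM; have pM := partial_supported i fM.
have [B B0 pB] := continuous_supported_bounded cpf pM.
(* As the steps h k are at most 1, all difference quotients vanish outside this set of finite
   measure. *)
pose D : set 'rV[R]_n := eball 0 (M + 1).
have mD : measurable D by exact: measurable_eball.
have outD x : ~ D x -> M + 1 <= enorm x.
  by move=> nD; rewrite leNgt; apply/negP => h; apply: nD; rewrite /D/eball/= subr0.
pose e : 'rV[R]_n := delta_mx 0 i.
pose h (k : nat) : R := k.+1%:R^-1.
have h0 k : 0 < h k by rewrite invr_gt0.
have h1 k : h k <= 1 by rewrite invf_le1// ler1n.
pose G k x := (h k)^-1 * (f (h k *: e + x) - f x).
have ed : enorm e = 1.
  rewrite /enorm (bigD1 i)//= big1 => [|j ji]; last first.
    by rewrite mxE eqxx/= (negbTE ji) expr0n.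
  by rewrite mxE !eqxx expr1n addr0 sqrtr1.
have shiftM k y : M + 1 <= enorm y -> f (h k *: e + y) = 0.
  move=> My; apply: fM; have := ler_enormB y (- (h k *: e)).
  rewrite opprK enormN enormZ ed mulr1 gtr0_norm// [y + _]addrC => H.
  have := h1 k; lra.
have cshift k : continuous (fun x => f (h k *: e + x)).
  move=> x; apply: (@continuous_comp _ _ _ (fun x => h k *: e + x) f); last exact: cf.
  have c1 : {for x, continuous (cst (h k *: e) : 'rV[R]_n -> 'rV[R]_n)} by exact: cst_continuous.
  exact: (continuousD c1 (fun A => id)).
have cG k : continuous (G k).
  move=> x; have c1 : {for x, continuous (cst (h k)^-1 : 'rV[R]_n -> R)} by exact: cst_continuous.
  exact: (continuousM c1 (continuousB (cshift k x) (cf x))).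
have G0 k x : ~ D x -> G k x = 0.
  move=> /outD Mx; rewrite /G shiftM// fM ?subrr ?mulr0//.
  by rewrite (le_trans _ Mx)// lerDl.
have intG k : (\int[L]_(x in D) (G k x)%:E = 0)%E.
  transitivity (\int[L]_x (G k x)%:E)%E.
    rewrite integral_mkcond; apply: eq_integral => x _; rewrite patchE.
    by case: ifPn => // /negP xD; rewrite G0// => Dx; apply: xD; exact: mem_set.
  have i1 : L.-integrable setT (EFin \o (fun x => f (h k *: e + x))).
    exact: (integrable_continuous_supported (cshift k) (shiftM k)).
  have i2 := integrable_continuous_supported cf fM.
  transitivity ((h k)^-1%:E * \int[L]_x ((f (h k *: e + x))%:E - (f x)%:E))%E.
    by rewrite -integralZl//; exact: integrableB.
  rewrite integralB//.
  have -> : (\int[L]_x (f (h k *: e + x))%:E = \int[L]_x (f x)%:E)%E.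
    rewrite -[RHS](@integral_translate (fun x => (f x)%:E) (h k *: e)).
      by apply: eq_integral => x _; rewrite addrC.
    by apply/measurable_EFinP; exact: continuous_measurable_rV.
  by rewrite subee ?mule0//; exact: integrable_fin_num.
have -> : (\int[L]_x (partial i f x)%:E = \int[L]_(x in D) (EFin \o partial i f) x)%E.
  rewrite [RHS]integral_mkcond; apply: eq_integral => x _; rewrite patchE.
  by case: ifPn => // /negP xD; rewrite pM// outD// => Dx; apply: xD; exact: mem_set.
have cG_partial x : G k x @[k --> \oo] --> partial i f x.
  have /cvgrPdist_lt cd := df x.
  apply/cvgrPdist_lt => d d0; have /= := cd _ d0.
  rewrite -/(partial i f x) => /nbhs_ballP[r /= r0 rb].
  have [K _ hK] := cvgr_lt _ (@cvg_harmonic R) _ r0.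
  exists K => // k /= Kk; apply: rb; last by rewrite gt_eqF.
  by rewrite -ball_normE/= sub0r normrN gtr0_norm//; exact: hK.
have [|||||_ _ +] := @dominated_convergence _ _ _ L D mD (fun k => EFin \o G k)
  (EFin \o partial i f) (cst B%:E).
- by move=> k; apply/measurable_EFinP; apply: measurable_funTS; exact: continuous_measurable_rV.
- by apply/measurable_EFinP; apply: measurable_funTS; exact: continuous_measurable_rV.
- by apply: aeW => x _; apply/fine_cvgP; split; [exact: nearW|exact: cG_partial].
- apply/integrableP; split; first exact: measurable_cst.
  rewrite /= integral_cst//; apply: lte_mul_pinfty => //.
  exact: lebesgue_eball_lty.
(* By the mean value theorem a difference quotient is a value of the partial derivative, hence
   bounded by B. *)
- apply: aeW => x k _; rewrite /= lee_fin /G.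
  have [th _ ->] := mean_value_partial x (h k) df.
  by rewrite mulKf ?gt_eqF.
rewrite (_ : (fun k => _) = cst 0%E); last by apply/funext => k /=; exact: intG.
move=> /(cvg_lim (@ereal_hausdorff R)) <-; rewrite lim_cst//.
Qed.

Lemma partialM f g (i : 'I_n) y : derivable f y (delta_mx 0 i) ->
  derivable g y (delta_mx 0 i) ->
  partial i (f * g) y = f y * partial i g y + g y * partial i f y.
Proof. exact: deriveM. Qed.

(** The partial derivative of f g integrates to 0 over the space and vanishes off Omega, so no
    boundary term appears. *)
Lemma integration_by_parts Omega f g i : measurable Omega ->
  C1_supported Omega f -> C1_supported Omega g ->
  \int[L]_(x in Omega) (f x * partial i g x) =
  - \int[L]_(x in Omega) (partial i f x * g x).
Proof.
move=> mO [df cdf [M fM] fO cf] [dg cdg [M' gM] gO cg].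
have c1 : continuous (f * partial i g) by move=> x; exact: (continuousM (cf x) (cdg i x)).
have c2 : continuous (partial i f * g) by move=> x; exact: (continuousM (cdf i x) (cg x)).
have i1 : L.-integrable Omega (EFin \o (f * partial i g)).
  apply: (integrableS measurableT) => //.
  by apply: (integrable_continuous_supported c1 (M := M)) => y /fM fy; rewrite fctE fy mul0r.
have i2 : L.-integrable Omega (EFin \o (partial i f * g)).
  apply: (integrableS measurableT) => //.
  by apply: (integrable_continuous_supported c2 (M := M')) => y /gM fy; rewrite fctE fy mulr0.
have E0 : (\int[L]_(x in Omega) ((f x * partial i g x)%:E + (partial i f x * g x)%:E) = 0)%E.
  have pE x : partial i (f * g) x = f x * partial i g x + partial i f x * g x.
    by rewrite partialM// [g x * _]mulrC.
  rewrite -[RHS](@integral_partial_eq0 (f * g) M i).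
  - rewrite integral_mkcond; apply: eq_integral => x _; rewrite patchE.
    case: ifPn => [_|/negP xO]; first by rewrite pE.
    have Ox : ~ Omega x by move=> /mem_set.
    have [f0 pf0] := fO x Ox; have [g0 _] := gO x Ox.
    by rewrite pE f0 g0 mul0r mulr0 addr0.
  - by move=> y; exact: derivableM.
  - by move=> x; exact: (continuousM (cf x) (cg x)).
  - rewrite (_ : partial i (f * g) = f * partial i g + partial i f * g).
      by move=> x; exact: (continuousD (c1 x) (c2 x)).
    exact/funext.
  - by move=> y /fM fy; rewrite fctE fy mul0r.
rewrite /Rintegral; move: E0; rewrite integralD//.
have f1 := integrable_fin_num mO i1; have f2 := integrable_fin_num mO i2.
move=> /(congr1 fine); rewrite fineD//= => /eqP; rewrite addr_eq0 => /eqP ->.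
by [].
Qed.

End integration_by_parts.

(** * Dominated convergence in L^p *)

Lemma cvg_continuous_seq {R : realType} (h : R -> R) (v : nat -> R) l :
  {for l, continuous h} -> v k @[k --> \oo] --> l -> h (v k) @[k --> \oo] --> h l.
Proof. by move=> ch cv; apply: (@continuous_cvg nat R R \oo _ v h l). Qed.

Lemma powR_cvg0 {R : realType} (u : nat -> R) b : 0 < b -> (forall k, 0 <= u k) ->
  u k @[k --> \oo] --> 0 -> u k `^ b @[k --> \oo] --> 0.
Proof.
move=> b0 u0 /cvgrPdist_le cu; apply/cvgrPdist_le => d d0.
apply: filterS (cu (d `^ b^-1) (powR_gt0 _ d0)) => k.
rewrite !sub0r !normrN !ger0_norm ?powR_ge0// => ud.
rewrite -[X in _ <= X](powRr1 (ltW d0)) -(mulVf (lt0r_neq0 b0)) powRrM.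
by apply: (ge0_ler_powR (ltW b0)); rewrite ?nnegrE ?powR_ge0.
Qed.

Section Lp_dominated.
Context {R : realType} {n : nat}.
Variables (Omega : set 'rV[R]_n) (p : R).
Local Notation L := (@lebesgue_rV R n).
Hypotheses (mO : measurable Omega) (p0 : 0 < p).
Implicit Types f : 'rV[R]_n -> R.
Variable G : 'rV[R]_n -> R.
Hypothesis intG : L.-integrable Omega (fun x => (G x `^ p)%:E).

Lemma integral_restrict_powR f :
  (\int[L]_x (`|(EFin \o (f \_ Omega : 'rV[R]_n -> R)) x| `^ p) =
    \int[L]_(x in Omega) (`|f x| `^ p)%:E)%E.
Proof.
rewrite [RHS]integral_mkcond; apply: eq_integral => x _.
rewrite /= !patchE; case: ifPn => // _.
have -> : (point : R) = 0 by [].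
by rewrite normr0 powR0// gt_eqF.
Qed.

Lemma Lp_norm_powR f :
  (Lp_norm Omega p%:E f `^ p = \int[L]_(x in Omega) (`|f x| `^ p)%:E)%E.
Proof.
rewrite /Lp_norm unlock -poweRrM mulVf ?gt_eqF// poweRe1; first exact: integral_restrict_powR.
by apply: integral_ge0 => x _; exact: poweR_ge0.
Qed.

Let measurable_normr_powR f : measurable_fun setT (f \_ Omega) ->
  measurable_fun Omega (fun x => (`|f x| `^ p)%:E).
Proof.
move=> /(measurable_restrictT _ mO) mf; apply/measurable_EFinP.
by apply: (measurableT_comp (measurable_powR p)); exact: measurableT_comp.
Qed.

Let le_powR f x : `|f x| <= G x -> `|f x| `^ p <= G x `^ p.
Proof.
by move=> h; apply: (ge0_ler_powR (ltW p0)); rewrite ?nnegrE// (le_trans _ h).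
Qed.

Lemma Lp_dominated f : measurable_fun setT (f \_ Omega) ->
  (forall x, Omega x -> `|f x| <= G x) -> Lp Omega p f.
Proof.
move=> mf fG; apply/andP; split; apply/mem_set => //=.
rewrite /finite_norm -/(Lp_norm Omega p%:E f).
suff : (Lp_norm Omega p%:E f `^ p < +oo)%E.
  case: (Lp_norm _ _ _) => [r| |]//; first by move=> _; exact: ltry.
  by rewrite poweRyr ?gt_eqF.
rewrite Lp_norm_powR; have /integrableP[mG] := intG.
apply: le_lt_trans; apply: ge0_le_integral => //.
- exact: measurable_normr_powR.
- exact: measurableT_comp.
- by move=> x Ox; rewrite lee_fin (le_trans (le_powR (fG x Ox)))// ler_norm.
Qed.

(** Dominated convergence for the p-th powers, followed by the p-th root. *)
Lemma Lp_norm_cvg0 (F : nat -> 'rV[R]_n -> R) :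
  (forall k, measurable_fun setT ((F k) \_ Omega)) ->
  (forall k x, Omega x -> `|F k x| <= G x) ->
  (forall x, Omega x -> F k x @[k --> \oo] --> 0) ->
  Lp_norm Omega p%:E (F k) @[k --> \oo] --> 0%E.
Proof.
move=> mF FG F0.
have [|||||_ _ +] := @dominated_convergence _ _ _ L Omega mO
  (fun k x => (`|F k x| `^ p)%:E) (cst 0%E) (fun x => (G x `^ p)%:E).
- by move=> k; exact: measurable_normr_powR.
- exact: measurable_cst.
- apply: aeW => x Ox; apply: cvg_EFin; first exact: nearW.
  apply: powR_cvg0 => //.
  by rewrite -[X in _ --> X](@normr0 _ R); apply: cvg_norm; exact: F0.
- exact: intG.
- apply: aeW => x k Ox; rewrite /= ger0_norm ?powR_ge0// lee_fin.
  by apply: le_powR; exact: FG.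
rewrite integral_cst// mul0e => /fine_cvgP[fin c0].
have E k : Lp_norm Omega p%:E (F k) =
    ((\int[L]_(x in Omega) (`|F k x| `^ p)%:E) `^ p^-1)%E.
  by rewrite /Lp_norm unlock integral_restrict_powR.
rewrite (_ : (fun k => _) =
    (fun k => (\int[L]_(x in Omega) (`|F k x| `^ p)%:E) `^ p^-1)%E); last first.
  by apply/funext => k; exact: E.
apply: cvg_EFin.
  by apply: filterS fin => k kfin; rewrite fin_num_poweR.
rewrite (_ : fine \o _ = fun k => fine (\int[L]_(x in Omega) (`|F k x| `^ p)%:E)%E `^ p^-1).
  apply: powR_cvg0; rewrite ?invr_gt0// => k.
  by rewrite fine_ge0// integral_ge0// => x _; rewrite lee_fin powR_ge0.
apply/funext => k /=.
have : (0 <= \int[L]_(x in Omega) (`|F k x| `^ p)%:E)%E.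
  by apply: integral_ge0 => x _; rewrite lee_fin powR_ge0.
case: (integral _ _ _) => [a _| |//]; first by rewrite poweR_EFin.
(* Since [fine] sends +oo to 0, both sides are 0 in the infinite case. *)
by rewrite poweRyr ?gt_eqF ?invr_gt0//= powR0// gt_eqF ?invr_gt0.
Qed.

End Lp_dominated.

Lemma Rintegral_dominated_convergence {R : realType} {n : nat} (Omega : set 'rV[R]_n)
    (F : nat -> 'rV[R]_n -> R) (f G : 'rV[R]_n -> R) : measurable Omega ->
  (forall k, measurable_fun Omega (F k)) -> measurable_fun Omega f ->
  (forall x, Omega x -> F k x @[k --> \oo] --> f x) ->
  (@lebesgue_rV R n).-integrable Omega (EFin \o G) ->
  (forall k x, Omega x -> `|F k x| <= G x) ->
  (\int[lebesgue_rV n]_(x in Omega) F k x) @[k --> \oo] -->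
    \int[lebesgue_rV n]_(x in Omega) f x.
Proof.
move=> mO mF mf Ff iG FG; rewrite /Rintegral.
have [|||||intf _ +] := @dominated_convergence _ _ _ (lebesgue_rV n) Omega mO
  (fun k => EFin \o F k) (EFin \o f) (EFin \o G).
- by move=> k; exact/measurable_EFinP.
- exact/measurable_EFinP.
- by apply: aeW => x Ox; apply: cvg_EFin; [exact: nearW|exact: Ff].
- exact: iG.
- by apply: aeW => x k Ox; rewrite lee_fin; exact: FG.
rewrite -[(\int[_]_(x in Omega) (EFin \o f) x)%E]fineK ?(integrable_fin_num mO intf)//.
by move=> /fine_cvgP[].
Qed.

(** * The extremal function of a ball *)

Section extremal.
Context {R : realType} {n : nat}.
Variables (c : 'rV[R]_n) (rho p : R).
Local Notation L := (@lebesgue_rV R n).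
Local Notation V := (@unit_ball_volume R n).
Hypotheses (n2 : (2 <= n)%N) (pn : n%:R < p) (rho0 : 0 < rho).

Local Notation Omega := (eball c rho).
(** Since (a - 1) p = -(n - 1) p / (p - 1), the power p of the gradient of |x - c|^a is a multiple
    of the Riesz kernel: the equality case of Hoelder. *)
Definition extremal_exponent : R := (p - n%:R) / (p - 1).
Local Notation a := extremal_exponent.

Let n1 : 1 < n%:R :> R. Proof. by rewrite ltr1n. Qed.
Let n0 : 0 < n%:R :> R. Proof. exact: lt_trans n1. Qed.
Let p1 : 1 < p. Proof. exact: lt_trans pn. Qed.
Let p0 : 0 < p. Proof. exact: lt_trans p1. Qed.
Let p10 : 0 < p - 1. Proof. by rewrite subr_gt0. Qed.
Let a0 : 0 < a. Proof. by rewrite divr_gt0// subr_gt0. Qed.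
Let a1 : a < 1. Proof. by rewrite ltr_pdivrMr// mul1r ltrD2l ltrN2. Qed.
Let mO : measurable Omega. Proof. exact: measurable_eball. Qed.

Let e (k : nat) : R := k.+1%:R^-1.
Let e0 k : 0 < e k. Proof. by rewrite invr_gt0. Qed.
Let e_cvg0 : e k @[k --> \oo] --> 0. Proof. exact: cvg_harmonic. Qed.

Local Notation T k := (truncation_level c (e k) a rho).
Local Notation q k := (shifted_sqr c (e k)).

Definition extremal x := rho `^ a - enorm (x - c) `^ a.
Local Notation u := extremal.

Definition extremal_gradient (x : 'rV[R]_n) : 'rV[R]_n :=
  (- (a * enorm (x - c) `^ (a - 2))) *: (x - c).
Local Notation g := extremal_gradient.

Definition extremal_slope (x : 'rV[R]_n) : R := a * enorm (x - c) `^ (a - 1).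
Local Notation G := extremal_slope.

(* T k replaces |x - c| by (|x - c|^2 + e k)^(1/2) in u, which makes it smooth and
   pushes its zero set into the ball; [flat 1] is a smooth positive part. *)
Let phi k : 'rV[R]_n -> R := flat 1 (e k) \o T k.
(** The derivative of [flat 1 (e k)] at [T k x]; in the ball it tends to 1. *)
Let chi k x := flat 0 (e k) (T k x) + e k * flat (- 1) (e k) (T k x).
Let sigma k x := chi k x * q k x `^ (a / 2 - 1).

Let gradient_phi k x : gradient (phi k) x = (- (a * sigma k x)) *: (x - c).
Proof.
apply/rowP => i; rewrite !mxE.
have h := is_derive_flat_truncation c a rho (e0 k) 1 x i.
rewrite /partial; apply: etrans (@derive_val _ _ _ _ _ _ _ h) _.
rewrite subrr (_ : 1 - 2 = - 1 :> R); last by ring.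
by rewrite mul1r -/(chi k x) /sigma; ring.
Qed.

(** Where it is nonzero, chi is (1 + s) exp(-s) with s = e k / T k x >= 0, and exp s >= 1 + s. *)
Let chi_bound k x : 0 <= chi k x <= 1.
Proof.
rewrite /chi; have [T0|T0] := ltP 0 (T k x); last first.
  by rewrite !flat_le0E// mulr0 addr0 lexx ler01.
rewrite !flat_gt0E// powRr0 mul1r powR_inv1 ?(ltW T0)// mulrA -[X in X + _]mul1r -mulrDl.
have s0 : 0 <= e k / T k x by rewrite divr_ge0 ?ltW.
rewrite mulr_ge0 ?expR_ge0 ?addr_ge0//= expRN ler_pdivrMr ?expR_gt0// mul1r.
exact: expR_ge1Dx.
Qed.

Let sqr_powR x s : (enorm (x - c) ^+ 2) `^ s = enorm (x - c) `^ (s * 2).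
Proof. by rewrite -powR_mulrn ?enorm_ge0// -powRrM mulrC. Qed.

Let halfE (s : R) : s - 2 = (s / 2 - 1) * 2. Proof. by field. Qed.

Let q_cvg x : q k x @[k --> \oo] --> enorm (x - c) ^+ 2.
Proof.
rewrite -[X in _ --> X]addr0; apply: cvgD; [exact: cvg_cst|exact: e_cvg0].
Qed.

Let q_powR_cvg x s : x != c -> q k x `^ s @[k --> \oo] --> enorm (x - c) `^ (s * 2).
Proof.
move=> xc; rewrite -sqr_powR.
have E0 : 0 < enorm (x - c) ^+ 2 by rewrite exprn_gt0// enorm_gt0 subr_eq0.
exact: (cvg_continuous_seq (@continuous_powR_gt0 R s _ E0) (@q_cvg x)).
Qed.

Let T_cvg x : T k x @[k --> \oo] --> u x.
Proof.
apply: cvgB; first exact: cvg_cst.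
have [->|xc] := eqVneq x c; last first.
  by have := @q_powR_cvg x (a / 2) xc; rewrite [a / 2 * 2]divfK.
(* Continuity of powers is available at positive bases only; at the centre the base tends to 0 and
   the exponent a/2 is positive. *)
rewrite subrr enorm0 powR0 ?gt_eqF//; apply: powR_cvg0; first by rewrite divr_gt0.
  by move=> k; rewrite ltW// shifted_sqr_gt0.
by have := @q_cvg c; rewrite subrr enorm0 expr0n.
Qed.

Let u_gt0 x : Omega x -> 0 < u x.
Proof.
move=> Ox; rewrite subr_gt0; apply: gt0_ltr_powR => //; rewrite ?nnegrE ?enorm_ge0//.
exact: ltW.
Qed.

Let flat_cvg b x : Omega x -> flat b (e k) (T k x) @[k --> \oo] --> u x `^ b.
Proof.
move=> /u_gt0 u0; have cT := @T_cvg x.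
have near_pos : \forall k \near \oo, 0 < T k x by exact: (cvgr_gt _ cT _ u0).
apply: (@cvg_trans _ ((fun k => T k x `^ b * expR (- (e k / T k x))) @ \oo)).
  apply: near_eq_cvg; apply: filterS near_pos => k Tk; by rewrite flat_gt0E.
rewrite (_ : u x `^ b = u x `^ b * expR 0); last by rewrite expR0 mulr1.
apply: cvgM.
  exact: (cvg_continuous_seq (@continuous_powR_gt0 R b _ u0) cT).
apply: (cvg_continuous_seq (@continuous_expR R 0)).
rewrite -[X in _ --> X]oppr0; apply: cvgN.
rewrite -[X in _ --> X](mul0r (u x)^-1); apply: cvgM; first exact: e_cvg0.
by apply: cvgV => //; rewrite gt_eqF.
Qed.

Let phi_cvg x : Omega x -> phi k x @[k --> \oo] --> u x.
Proof.
move=> Ox; rewrite -[X in _ --> X]powRr1; last exact: ltW (u_gt0 Ox).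
exact: flat_cvg.
Qed.

Let chi_cvg x : Omega x -> chi k x @[k --> \oo] --> (1 : R).
Proof.
move=> Ox; rewrite -[X in _ --> X]addr0; apply: cvgD.
  by rewrite -(powRr0 (u x)); exact: flat_cvg.
rewrite -[X in _ --> X](mul0r (u x `^ (- 1))); apply: cvgM; first exact: e_cvg0.
exact: flat_cvg.
Qed.

Let sigma_cvg x : Omega x -> x != c ->
  sigma k x @[k --> \oo] --> enorm (x - c) `^ (a - 2).
Proof.
move=> Ox xc; rewrite -[X in _ --> X]mul1r; apply: cvgM; first exact: chi_cvg.
by rewrite (halfE a); exact: q_powR_cvg.
Qed.

(** The exponent a/2 - 1 is negative, so adding e k to the base only lowers the power. Hence all
    approximating gradients are dominated by the slope G. *)
Let sigma_bound k x : x != c -> 0 <= sigma k x <= enorm (x - c) `^ (a - 2).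
Proof.
move=> xc; have /andP[chi0 chi1] := chi_bound k x.
have E0 : 0 < enorm (x - c) ^+ 2 by rewrite exprn_gt0// enorm_gt0 subr_eq0.
have qE : q k x `^ (a / 2 - 1) <= enorm (x - c) `^ (a - 2).
  rewrite (halfE a) -sqr_powR -[a / 2 - 1]opprB !(powRN _ (1 - a / 2)).
  rewrite lef_pV2 ?posrE ?powR_gt0 ?shifted_sqr_gt0//.
  apply: ge0_ler_powR; rewrite ?nnegrE ?(ltW E0) ?ltW ?shifted_sqr_gt0 ?e0//.
    by have := a1; lra.
  by rewrite /shifted_sqr ltrDl.
rewrite mulr_ge0 ?powR_ge0//= (le_trans _ qE)//.
by rewrite ler_piMl// powR_ge0.
Qed.

(** True at c as well, where both sides are 0 by the default value of powers at 0. *)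
Let slopeE x : enorm (x - c) `^ (a - 2) * enorm (x - c) = enorm (x - c) `^ (a - 1).
Proof.
have a10 : a - 1 != 0 by rewrite subr_eq0 lt_eqF.
have [->|E0] := eqVneq (enorm (x - c)) 0; first by rewrite mulr0 powR0.
rewrite -{2}(powRr1 (enorm_ge0 (x - c))) -powRD ?E0 ?implybT//.
by congr (_ `^ _); ring.
Qed.

Lemma enorm_extremal_gradient x : enorm (g x) = G x.
Proof.
rewrite /g enormZ normrN ger0_norm; last exact: (mulr_ge0 (ltW a0) (powR_ge0 _ _)).
by rewrite -mulrA slopeE.
Qed.

Let gradient_error k x : g x - gradient (phi k) x =
  (a * (sigma k x - enorm (x - c) `^ (a - 2))) *: (x - c).
Proof. by rewrite gradient_phi -scalerBl; congr (_ *: _); ring. Qed.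

Let gradient_error_le k x : enorm (g x - gradient (phi k) x) <= G x.
Proof.
rewrite gradient_error enormZ; have [->|xc] := eqVneq x c.
  by rewrite subrr enorm0 mulr0 mulr_ge0 ?powR_ge0 ?(ltW a0).
have /andP[s0 s1] := sigma_bound k xc.
rewrite normrM gtr0_norm// -mulrA ler_pM2l// -slopeE ler_wpM2r ?enorm_ge0//.
by rewrite ler0_norm ?subr_le0// opprB lerBlDr lerDl.
Qed.

Let gradient_error_cvg x : Omega x ->
  enorm (g x - gradient (phi k) x) @[k --> \oo] --> 0.
Proof.
move=> Ox; have [->|xc] := eqVneq x c.
  rewrite (_ : (fun k => _) = cst 0); first exact: cvg_cst.
  by apply/funext => k; rewrite gradient_error subrr scaler0 enorm0.
rewrite (_ : (fun k => _) = fun k =>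
    `|a * (sigma k x - enorm (x - c) `^ (a - 2))| * enorm (x - c)).
  rewrite -[X in _ --> X](mul0r (enorm (x - c))); apply: cvgM; last exact: cvg_cst.
  rewrite -[X in _ --> X](@normr0 _ R); apply: cvg_norm.
  rewrite -[X in _ --> X](mulr0 a); apply: cvgM; first exact: cvg_cst.
  rewrite -[X in _ --> X](subrr (enorm (x - c) `^ (a - 2))).
  by apply: cvgB; [exact: sigma_cvg|exact: cvg_cst].
by apply/funext => k; rewrite gradient_error enormZ.
Qed.

Let gradient_phi_le k x : enorm (gradient (phi k) x) <= G x.
Proof.
rewrite gradient_phi enormZ normrN; have [->|xc] := eqVneq x c.
  by rewrite subrr enorm0 mulr0 mulr_ge0 ?powR_ge0 ?(ltW a0).
have /andP[s0 s1] := sigma_bound k xc.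
rewrite ger0_norm; last exact: (mulr_ge0 (ltW a0) s0).
rewrite -mulrA ler_pM2l// -slopeE.
by rewrite ler_wpM2r ?enorm_ge0.
Qed.

(** Confines the support of phi k to a closed ball inside the open one, whence its compactness in
    Omega. *)
Let truncation_ball k x : 0 < T k x -> enorm (x - c) ^+ 2 <= rho ^+ 2 - e k.
Proof.
rewrite subr_gt0 => h; rewrite lerBrDr leNgt; apply/negP => rq.
move: h; rewrite ltNge => /negP; apply.
have -> : rho `^ a = (rho ^+ 2) `^ (a / 2).
  by rewrite -powR_mulrn ?(ltW rho0)// -powRrM mulrC divfK.
apply: ge0_ler_powR; rewrite ?nnegrE ?sqr_ge0 ?(ltW (shifted_sqr_gt0 _ _ _))//.
  by rewrite divr_ge0// ltW.
exact: ltW.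
Qed.

Let test_phi k : test_function Omega (phi k).
Proof.
(* If rho^2 <= e k, the root is 0 and K is reduced to c, still within the ball. *)
pose K : set 'rV[R]_n := [set x | enorm (x - c) <= Num.sqrt (rho ^+ 2 - e k)].
have supK : closure [set x | phi k x != 0] `<=` K.
  have /closure_id -> : closed K by exact: closed_ecball.
  apply: closureS => x /=; have [Tx|Tx] := leP (T k x) 0.
    by rewrite /phi/= flat_le0E// eqxx.
  move=> _; have xr := truncation_ball Tx; rewrite /K/=.
  rewrite -[enorm _]ger0_norm ?enorm_ge0// -sqrtr_sqr ler_wsqrtr//.
have KO : K `<=` Omega.
  move=> x /le_lt_trans; apply; rewrite -[X in _ < X](gtr0_norm rho0) -sqrtr_sqr.
  by rewrite ltr_sqrt ?exprn_gt0// ltrBlDr ltrDl.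
split.
- by apply: smooth_radial; [exact: e0|exact: radial_flat].
- apply: bounded_closed_compact; last exact: closed_closure.
  have [M [Mr Mb]] := eball_bounded c rho.
  by exists M; split => // z Mz y /supK/KO; exact: Mb.
- by move=> x /supK/KO.
Qed.

Let phi_bound k x : 0 <= phi k x <= rho `^ a.
Proof.
rewrite /phi/= flat_ge0/=; have [Tx|Tx] := leP (T k x) 0.
  by rewrite flat_le0E// powR_ge0.
rewrite flat_gt0E// powRr1 ?(ltW Tx)//.
apply: (@le_trans _ _ (T k x)); last by rewrite gerBl powR_ge0.
rewrite ler_piMr ?(ltW Tx)// expR_le1 oppr_le0 divr_ge0 ?(ltW Tx)//.
exact: ltW.
Qed.

Lemma integrable_riesz_kernel s : 0 < s -> s < n%:R ->
  L.-integrable Omega (EFin \o riesz_kernel s c).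
Proof.
move=> s0 sn; apply/integrableP; split.
  apply/measurable_EFinP; apply: measurable_funTS; exact: measurable_riesz_kernel.
rewrite (_ : (\int[L]_(x in Omega) _ = \int[L]_(x in Omega) (riesz_kernel s c x)%:E)%E).
  by rewrite (integral_riesz_kernel_eball s0 sn c rho0) ltry.
by apply: eq_integral => x _; rewrite /= ger0_norm// riesz_kernel_ge0.
Qed.

Let integrable_slope : L.-integrable Omega (EFin \o G).
Proof.
have : L.-integrable Omega (EFin \o riesz_kernel (1 - a) c).
  apply: integrable_riesz_kernel; first by rewrite subr_gt0.
  by rewrite (lt_trans _ n1)// gtrBl.
move=> /(integrableZl mO a); apply: eq_integrable => // x _.
by rewrite /= /riesz_kernel opprB.
Qed.

Local Notation gam := (@kernel_exponent R n p).

Let kernel_dim : n%:R - gam = a.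
Proof. exact: dim_sub_kernel_exponent. Qed.

Let slope_powR x : G x `^ p = a `^ p * riesz_kernel gam c x.
Proof.
rewrite /G powRM ?powR_ge0 ?(ltW a0)//; congr (_ * _).
rewrite /riesz_kernel -powRrM; congr (_ `^ _).
by rewrite /extremal_exponent /kernel_exponent; field; rewrite gt_eqF.
Qed.

Let integral_slope_powR :
  (\int[L]_(x in Omega) (G x `^ p)%:E = (a `^ p * (n%:R * V * rho `^ a / a))%:E)%E.
Proof.
have k0 := kernel_exponent_gt0 n2 pn; have kn := kernel_exponent_lt n2 pn.
under eq_integral do rewrite slope_powR EFinM.
rewrite (integralZl _ (integrable_riesz_kernel k0 kn))//.
by rewrite (integral_riesz_kernel_eball k0 kn c rho0) kernel_dim.
Qed.

Let integrable_slope_powR : L.-integrable Omega (fun x => (G x `^ p)%:E).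
Proof.
have k0 := kernel_exponent_gt0 n2 pn; have kn := kernel_exponent_lt n2 pn.
have := integrableZl mO (a `^ p) (integrable_riesz_kernel k0 kn).
by apply: eq_integrable => // x _; rewrite /= slope_powR.
Qed.

Let measurable_enorm_powR s : measurable_fun setT (fun x : 'rV[R]_n => enorm (x - c) `^ s).
Proof.
apply: (measurableT_comp (measurable_powR s)); exact: measurable_enorm_sub.
Qed.

Let measurable_u : measurable_fun setT u.
Proof. by apply: measurable_funB => //; exact: measurable_enorm_powR. Qed.

Let measurable_g i : measurable_fun setT (fun x => g x 0 i).
Proof.
rewrite (_ : (fun x => _) = fun x => - (a * enorm (x - c) `^ (a - 2)) * (x 0 i - c 0 i)).
  apply: measurable_funM.
    by apply: measurableT_comp => //; exact: measurable_funM.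
  apply: measurable_funB => //; apply: continuous_measurable_rV.
  exact: coord_continuous_rV.
by apply/funext => x; rewrite !mxE.
Qed.

Let measurable_patch (f : 'rV[R]_n -> R) : measurable_fun setT f ->
  measurable_fun setT (f \_ Omega).
Proof. by move=> mf; apply/(measurable_restrictT _ mO); exact: measurable_funTS. Qed.

Let u_bound x : Omega x -> `|u x| <= rho `^ a.
Proof. by move=> Ox; rewrite gtr0_norm ?u_gt0// gerBl powR_ge0. Qed.

Let integrable_cst k : L.-integrable Omega (EFin \o (cst k : 'rV[R]_n -> R)).
Proof.
apply/integrableP; split; first by apply/measurable_EFinP; exact: measurable_cst.
rewrite /= integral_cst//; apply: lte_mul_pinfty => //; exact: lebesgue_eball_lty.
Qed.

Let integrable_dominated (f h : 'rV[R]_n -> R) : measurable_fun setT f ->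
  L.-integrable Omega (EFin \o h) -> (forall x, Omega x -> `|f x| <= h x) ->
  L.-integrable Omega (EFin \o f).
Proof.
move=> mf ih fh; apply: le_integrable ih => //.
  by apply/measurable_EFinP; exact: measurable_funTS.
by move=> x Ox; rewrite /= lee_fin (le_trans (fh x Ox))// ler_norm.
Qed.

Let integrable_L1loc f : L.-integrable Omega (EFin \o f) -> L1loc Omega f.
Proof.
move=> fi K cK KO; apply: (integrableS mO _ KO fi).
apply: closed_measurable_rV; apply: compact_closed cK; exact: norm_hausdorff.
Qed.

Let coord_g x i : `|g x 0 i| <= G x.
Proof. by rewrite -enorm_extremal_gradient coord_le_enorm. Qed.

Let phi_C1 k := test_function_C1_supported (test_phi k).

Let coord_gradient_phi_cvg x i : Omega x ->
  partial i (phi k) x @[k --> \oo] --> g x 0 i.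
Proof.
move=> Ox; apply/cvgrPdist_le => d d0.
have /cvgrPdist_le/(_ _ d0) := gradient_error_cvg Ox.
apply: filterS => k; rewrite sub0r normrN ger0_norm ?enorm_ge0//.
by apply: le_trans; have := coord_le_enorm (g x - gradient (phi k) x) i; rewrite !mxE.
Qed.

(** Integration by parts holds for phi k and a test function; dominated convergence, with a constant
    for phi k and a multiple of G for its gradient, carries it to the limit. *)
Lemma weak_partial_extremal i : weak_partial Omega i u (fun x => g x 0 i).
Proof.
split.
- by apply: integrable_L1loc; apply: (integrable_dominated _ (integrable_cst (rho `^ a))).
- by apply: integrable_L1loc; apply: (integrable_dominated _ integrable_slope).
move=> psi /test_function_C1_supported C1psi.
have [dpsi cdpsi [M psiM] psiO cpsi] := C1psi.
have [B0 _ B0E] := continuous_supported_bounded cpsi psiM.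
have [B1 _ B1E] := continuous_supported_bounded (cdpsi i) (partial_supported i psiM).
have mpsi : measurable_fun setT psi by exact: continuous_measurable_rV.
have mdpsi : measurable_fun setT (partial i psi) by apply: continuous_measurable_rV; exact: cdpsi.
have lhs : (\int[L]_(x in Omega) (phi k x * partial i psi x)) @[k --> \oo] -->
    \int[L]_(x in Omega) (u x * partial i psi x).
  apply: (Rintegral_dominated_convergence mO (G := cst (rho `^ a * B1))).
  - move=> k; apply: measurable_funTS; apply: measurable_funM => //.
    by apply: continuous_measurable_rV; have [_ _ _ _] := phi_C1 k.
  - by apply: measurable_funTS; exact: measurable_funM.
  - by move=> x Ox; apply: cvgM; [exact: phi_cvg|exact: cvg_cst].
  - exact: integrable_cst.
  - move=> k x Ox; have /andP[f0 f1] := phi_bound k x.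
    by rewrite normrM ger0_norm// ler_pM.
have rhs : (\int[L]_(x in Omega) (partial i (phi k) x * psi x)) @[k --> \oo] -->
    \int[L]_(x in Omega) (g x 0 i * psi x).
  apply: (Rintegral_dominated_convergence mO (G := fun x => B0 * G x)).
  - move=> k; apply: measurable_funTS; apply: measurable_funM => //.
    by apply: continuous_measurable_rV; have [_ + _ _ _] := phi_C1 k; exact.
  - by apply: measurable_funTS; exact: measurable_funM.
  - by move=> x Ox; apply: cvgM; [exact: coord_gradient_phi_cvg|exact: cvg_cst].
  - exact: integrableZl integrable_slope.
  - move=> k x Ox; rewrite normrM mulrC ler_pM//.
    by have := coord_le_enorm (gradient (phi k) x) i; rewrite mxE => /le_trans; exact.
have lhsN : (\int[L]_(x in Omega) (phi k x * partial i psi x)) @[k --> \oo] -->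
    - \int[L]_(x in Omega) (g x 0 i * psi x).
  rewrite (_ : (fun k => _) = fun k => - \int[L]_(x in Omega) (partial i (phi k) x * psi x)).
    exact: cvgN.
  by apply/funext => k; exact: integration_by_parts.
exact: (cvg_unique (@Rhausdorff R) lhs lhsN).
Qed.

Lemma W01p_extremal : W01p Omega p u g.
Proof.
split; first split.
- apply: (@Lp_dominated _ _ _ _ mO p0 (cst (rho `^ a))) => //.
  + have := integrable_cst ((rho `^ a) `^ p); exact.
  + exact: measurable_patch.
- move=> i; split; last exact: weak_partial_extremal.
  apply: (Lp_dominated mO p0 integrable_slope_powR); first exact: measurable_patch.
  by move=> x _; exact: coord_g.
exists phi; split; first exact: test_phi.
- apply: (@Lp_norm_cvg0 _ _ _ _ mO p0 (cst (rho `^ a))).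
  + have := integrable_cst ((rho `^ a) `^ p); exact.
  + move=> k; apply: measurable_patch; apply: measurable_funB => //.
    by apply: continuous_measurable_rV; have [_ _ _ _] := phi_C1 k.
  + move=> k x Ox; have /andP[f0 f1] := phi_bound k x.
    have := u_bound Ox; rewrite gtr0_norm ?u_gt0// => u1.
    have := u_gt0 Ox => u0; rewrite ler_norml /=; lra.
  + move=> x Ox; rewrite -[X in _ --> X](subrr (u x)).
    by apply: cvgB; [exact: cvg_cst|exact: phi_cvg].
- apply: (Lp_norm_cvg0 mO p0 integrable_slope_powR).
  + move=> k; apply: measurable_enorm_restrict => i; apply: measurable_patch.
    rewrite (_ : (fun x => _) = fun x => g x 0 i - partial i (phi k) x); last first.
      by apply/funext => x; rewrite !mxE.
    apply: measurable_funB => //; apply: continuous_measurable_rV.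
    by have [_ + _ _ _] := phi_C1 k; exact.
  + by move=> k x Ox; rewrite ger0_norm ?enorm_ge0//; exact: gradient_error_le.
  + by move=> x; exact: gradient_error_cvg.
Qed.

Lemma Lp_norm_extremal_gradient :
  (Lp_norm Omega p%:E (fun x => enorm (g x)) `^ p =
    (a `^ p * (n%:R * V * rho `^ a / a))%:E)%E.
Proof.
rewrite Lp_norm_powR// -integral_slope_powR; apply: eq_integral => x _.
rewrite ger0_norm ?enorm_ge0// enorm_extremal_gradient//.
Qed.

(** The value at the single point c says nothing about an essential supremum; but for r < rho^a the
    function exceeds r on a small ball around c, which has positive measure. *)
Lemma sup_norm_extremal : (Lp_norm Omega +oo u >= (rho `^ a)%:E)%E.
Proof.
rewrite leNgt; apply/negP => h.
have [r [r0 rr rE]] : exists r : R, [/\ 0 <= r, r < rho `^ a & Lp_norm Omega +oo u = r%:E].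
  have : (0 <= Lp_norm Omega +oo u)%E by exact: Lnorm_ge0.
  move: h; case: (Lp_norm _ _ _) => [r| |]//; rewrite lte_fin lee_fin => rr r0.
  by exists r.
have LT0 : (0 < L setT)%E by apply: lebesgue_open_gt0; [exact: openT|exists 0].
have ae_le : {ae L, forall x, (`|(u \_ Omega) x|%:E <= r%:E)%E}.
  by rewrite -rE /Lp_norm unlock LT0; exact: ess_sup_inf.ess_sup_ge.
have rr0 : 0 < rho `^ a - r by rewrite subr_gt0.
(* Within this distance of c one is in the ball and |x - c|^a < rho^a - r, that is, u > r. *)
pose s := Num.min rho ((rho `^ a - r) `^ a^-1).
have s0 : 0 < s by rewrite lt_min rho0 powR_gt0.
have : L (eball c s) = 0%E.
  apply/negligibleP; first exact: measurable_eball.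
  apply: negligibleS ae_le => x /=; rewrite /eball/= lt_min => /andP[xrho xr].
  rewrite lee_fin patchE mem_set// => /(le_trans (ler_norm _)).
  rewrite /u lerBlDr -lerBlDl leNgt => /negP; apply.
  rewrite -[X in _ < X](powRr1 (ltW rr0)) -(mulVf (lt0r_neq0 a0)) [X in _ < X]powRrM.
  by apply: (gt0_ltr_powR a0); rewrite ?nnegrE ?enorm_ge0 ?powR_ge0.
by move=> E; have := lebesgue_eball_gt0 c s0; rewrite E ltxx.
Qed.

End extremal.

(** * Equality on balls *)

Section equality_case.
Context {R : realType} {n : nat}.
Variables (c : 'rV[R]_n) (rho p : R).
Local Notation L := (@lebesgue_rV R n).
Local Notation V := (@unit_ball_volume R n).
Hypotheses (n2 : (2 <= n)%N) (pn : n%:R < p) (rho0 : 0 < rho).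
Local Notation Omega := (eball c rho).
Local Notation a := (@extremal_exponent R n p).
Let vol := fine (L Omega).
Let C := n%:R * omega n `^ (p / n%:R) * ((p - n%:R) / (p - 1)) `^ (p - 1) *
  vol `^ (1 - p / n%:R).

Let n0 : 0 < n%:R :> R. Proof. by rewrite ltr0n (ltnW n2). Qed.
Let p1 : 1 < p. Proof. by rewrite (lt_trans _ pn)// ltr1n. Qed.
Let p0 : 0 < p. Proof. exact: lt_trans p1. Qed.
Let a0 : 0 < a. Proof. by rewrite divr_gt0 ?subr_gt0. Qed.

(** Multiply both sides by J^(p-1) with J = n V rho^a / a: since C J^(p-1) = (n V)^p, both become (n
    V rho^a)^p = (a J)^p. *)
Let constantE : C * (rho `^ a) `^ p = a `^ p * (n%:R * V * rho `^ a / a).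
Proof.
have V0 : 0 < V by exact: unit_ball_volume_gt0.
have nV0 : 0 < n%:R * V by rewrite mulr_gt0.
have ra0 : 0 < rho `^ a by rewrite powR_gt0.
pose J := n%:R * V * rho `^ a / a; have J0 : 0 < J := divr_gt0 (mulr_gt0 nV0 ra0) a0.
have CJ : C * J `^ (p - 1) = (n%:R * V) `^ p.
  rewrite /C /vol lebesgue_eball//= omegaE -powR_mulrn ?(ltW rho0)//.
  apply: sharp_constant_algebra => //.
  by rewrite divfK// gt_eqF// subr_gt0.
have Jp : J `^ (p - 1) != 0 by rewrite gt_eqF// powR_gt0.
apply: (mulIf Jp); rewrite mulrAC CJ -/J -mulrA mulr_powRB1 ?(ltW J0)//.
rewrite -!powRM ?(ltW nV0) ?(ltW ra0) ?(ltW a0) ?(ltW J0)//.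
by rewrite /J [a * _]mulrC divfK// gt_eqF.
Qed.

(** One direction is the general inequality; the other only needs the lower bound rho^a for the sup
    norm, as C (rho^a)^p is already the integral of |grad u|^p. *)
Lemma eball_sharp_equality : exists u gradu, [/\ W01p Omega p u gradu,
  ~ {ae L, forall x, Omega x -> u x = 0} &
  (C%:E * Lp_norm Omega +oo u `^ p
     = Lp_norm Omega p%:E (fun x => enorm (gradu x)) `^ p)%E].
Proof.
have W := W01p_extremal c n2 pn rho0.
have O0 : Omega !=set0 by exists c; rewrite /eball/= subrr enorm0.
have sup := sup_norm_extremal c n2 pn rho0.
exists (extremal c rho p), (extremal_gradient c p); split => //.
  move=> u0.
  have : ((rho `^ a)%:E <= 0)%E.
    apply: (le_trans sup); rewrite /Lp_norm unlock; case: ifPn => // _.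
    apply/ess_sup_inf.ess_supP; apply: filterS u0 => x ux /=.
    by rewrite lee_fin patchE; case: ifPn => [/set_mem/ux ->|_]; rewrite normr0.
  by rewrite lee_fin leNgt powR_gt0.
apply/eqP; rewrite eq_le; apply/andP; split.
  exact: (sharp_sobolev_inequality n2 pn (@open_eball R n c rho) (eball_bounded c rho) O0 W).
rewrite Lp_norm_extremal_gradient// -constantE EFinM -poweR_EFin.
apply: lee_wpmul2l.
  by rewrite lee_fin !mulr_ge0 ?powR_ge0.
apply: gt0_ler_poweR; rewrite ?(ltW p0)// in_itv/= ?leey ?andbT ?Lnorm_ge0 ?lee_fin ?powR_ge0//.
Qed.

End equality_case.

Theorem corollary2p9 (R : realType) (N : nat) (Omega : set 'rV[R]_N) (p : R)
    (N2 : (2 <= N)%N) (domOmega : domain Omega) (bndOmega : bounded_set Omega)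
    (smoothOmega : smooth_boundary Omega) (pN : N%:R < p) :
  let vol := fine (lebesgue_rV N Omega) in
  let C := N%:R * omega N `^ (p / N%:R)
           * ((p - N%:R) / (p - 1)) `^ (p - 1) * vol `^ (1 - p / N%:R) in
  (forall u gradu, W01p Omega p u gradu ->
     (C%:E * Lp_norm Omega +oo u `^ p
        <= Lp_norm Omega p%:E (fun x => enorm (gradu x)) `^ p)%E) /\
  ((exists u gradu, [/\ W01p Omega p u gradu,
      ~ {ae lebesgue_rV N, forall x, Omega x -> u x = 0} &
      (C%:E * Lp_norm Omega +oo u `^ p
         = Lp_norm Omega p%:E (fun x => enorm (gradu x)) `^ p)%E]) <->
   is_eball Omega).
Proof.
move=> vol C; have [ne oO _] := domOmega; split.
  by move=> u g; exact: sharp_sobolev_inequality.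
split=> [[u [g [Wu u0 eqn]]]|[c [rho [rho0 OE]]]]; last first.
  by have := eball_sharp_equality c N2 pN rho0; rewrite -OE.
have [x x0] := sharp_sobolev_equality_null N2 pN oO bndOmega ne Wu u0 eqn.
have r0 := equal_volume_radius_gt0 oO bndOmega ne.
exists x, (equal_volume_radius Omega); split => //.
by apply: eball_of_null_difference => //; exact: lebesgue_eball_equal_volume.
Qed.
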